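(* The algebra automorphisms $\widetilde\tau_1,\dots,\widetilde\tau_r$ of $B_{\mathbf c}$ satisfy $\widetilde\tau_r\widetilde\tau_{r-1}\widetilde\tau_r\widetilde\tau_{r-1}=\widetilde\tau_{r-1}\widetilde\tau_r\widetilde\tau_{r-1}\widetilde\tau_r$, and $\widetilde\tau_r\widetilde\tau_i=\widetilde\tau_i\widetilde\tau_r$ for every $1\le i<r-1$.
   Context: Let $\mathbb K$ be a field of characteristic zero, $q$ an indeterminate, and $\mathbb K'$ a field extension of $\mathbb K(q^{1/2})$ containing square roots of all parameters $c_i$ below; all algebras are over $\mathbb K'$. Let $n\ge1$, $I=\{1,\dots,n\}$, $\mathfrak g=\mathfrak{sl}_{n+1}(\mathbb C)$ with simple roots $\alpha_i$, fundamental weights $\varpi_i$, weight lattice $P$, Cartan matrix $a_{ii}=2$, $a_{ij}=-1$ if $|i-j|=1$, $a_{ij}=0$ otherwise, bilinear form $(\alpha_i,\alpha_j)=a_{ij}$, $(\alpha_i,\varpi_j)=\delta_{ij}$; $\sigma_i$ simple reflections. $U_q(\mathfrak g)$ is generated by $E_i,F_i$, $K_\mu$ ($\mu\in P$) with $K_0=1$, $K_\mu K_\lambda=K_{\mu+\lambda}$, $K_\mu E_i=q^{(\alpha_i,\mu)}E_iK_\mu$, $K_\mu F_i=q^{-(\alpha_i,\mu)}F_iK_\mu$, $E_iF_j-F_jE_i=\delta_{ij}\frac{K_i-K_i^{-1}}{q-q^{-1}}$ ($K_i=K_{\alpha_i}$), and the quantum Serre relations. $[a,b]_c=ab-cba$.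 Lusztig automorphisms: $T_i(E_i)=-F_iK_i$, $T_i(F_i)=-K_i^{-1}E_i$, $T_i(K_\mu)=K_{\sigma_i(\mu)}$, $T_i(E_j)=E_j,T_i(F_j)=F_j$ if $a_{ij}=0$, $T_i(E_j)=[E_i,E_j]_{q^{-1}}$, $T_i(F_j)=[F_j,F_i]_q$ if $a_{ij}=-1$. Fix $r$ with $1\le r\le\lceil n/2\rceil-1$, $X=\{r+1,\dots,n-r\}$, $\tau(i)=n-i+1$ (extended to weights by $\varpi_i\mapsto\varpi_{\tau(i)}$). $E_X^\pm$, $F_X^\pm$: $E_X^+=[E_{r+1},[E_{r+2},\dots,[E_{n-r-1},E_{n-r}]_{q^{-1}}\dots]]$, $E_X^-=[E_{n-r},[\dots,[E_{r+2},E_{r+1}]_{q^{-1}}\dots]]$ (all brackets $[\,,]_{q^{-1}}$), $F_X^+=[F_{r+1},[\dots,[F_{n-r-1},F_{n-r}]_q\dots]_q]_q$, $F_X^-=[F_{n-r},[\dots,[F_{r+2},F_{r+1}]_q\dots]_q]_q$; $K_X=K_{r+1}\cdots K_{n-r}$; $L_i=K_iK_{\tau(i)}^{-1}$; $\varpi'_i=\varpi_i-\varpi_{\tau(i)}$. $\mathcal M_X$ is generated by $E_j,F_j,K_j^{\pm1}$, $j\in X$; $U^0_\Theta$ by $K_\mu$ with $-w_X\tau(\mu)=\mu$ ($w_X$ longest element of the parabolic subgroup for $X$). Parameters $c_i\in\mathbb K(q^{1/2})^\times$ ($i\in I\setminus X$) with $c_i=c_{\tau(i)}$ for $i\notin X\cup\{r,\tau(r)\}$.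 $B_i=F_i-c_iE_{\tau(i)}K_i^{-1}$ for $i\in I\setminus(X\cup\{r,\tau(r)\})$, $B_r=F_r-c_r[E_X^+,E_{\tau(r)}]_{q^{-1}}K_r^{-1}$, $B_{\tau(r)}=F_{\tau(r)}-c_{\tau(r)}[E_X^-,E_r]_{q^{-1}}K_{\tau(r)}^{-1}$; $B_{\mathbf c}$ is generated by $\mathcal M_X$, $U^0_\Theta$ and the $B_i$, $i\in I\setminus X$. $C=(qc_rc_{\tau(r)})^{-1/2}$. It is understood that $r\ge2$ (so that $\widetilde\tau_{r-1}$ exists). For $1\le i\le r-1$, $\widetilde\tau_i$ is the unique algebra automorphism of $B_{\mathbf c}$ equal to $T_iT_{\tau(i)}$ on $\mathcal M_XU^0_\Theta$ with $\widetilde\tau_i(B_j)=q^{-1}B_{\tau(j)}L_{\tau(j)}$ if $j\in\{i,\tau(i)\}$, $(qc_i)^{-1/2}[B_j,B_i]_q$ if $a_{ij}=-1$, $(qc_{\tau(i)})^{-1/2}[B_j,B_{\tau(i)}]_q$ if $a_{\tau(i)j}=-1$, $B_j$ if $a_{ij}=a_{\tau(i)j}=0$ ($j\in I\setminus X$). $\widetilde\tau_r$ is the unique algebra automorphism of $B_{\mathbf c}$ equal to $T_rT_{r+1}\cdots T_{n-r+1}\cdots T_{r+1}T_r$ on $\mathcal M_XU^0_\Theta$ with $\widetilde\tau_r(B_r)=q^{-1}B_rL_rK_{\varpi'_{r+1}}$, $\widetilde\tau_r(B_{\tau(r)})=q^{-1}B_{\tau(r)}L_{\tau(r)}K_{\varpi'_{\tau(r+1)}}$,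 $\widetilde\tau_r(B_{r-1})=C([B_{r-1},[B_r,[F_X^+,B_{\tau(r)}]_q]_q]_q+qc_{\tau(r)}B_{r-1}L_rK_X^{-1})$, $\widetilde\tau_r(B_{\tau(r-1)})=C([B_{\tau(r-1)},[B_{\tau(r)},[F_X^-,B_r]_q]_q]_q+qc_rB_{\tau(r-1)}L_{\tau(r)}K_X^{-1})$, $\widetilde\tau_r(B_j)=B_j$ otherwise. *)

(* Defs.v *)
From HB Require Import structures.
From mathcomp Require Import all_boot all_order all_algebra.
Set Implicit Arguments. Unset Strict Implicit. Unset Printing Implicit Defensive.
Import Order.TTheory GRing.Theory Num.Theory.
Local Open Scope ring_scope.

(* ---------- Weights of sl_{n+1} ----------
   Indices of I = {1,...,n} are natural numbers 1..n.
   A weight mu = sum_j m_j varpi_j of P is stored as its coordinates in the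
   basis of fundamental weights: coordinate j (1<=j<=n) is stored at the
   ordinal j-1 : 'I_n. *)
Definition weight (n : nat) := {ffun 'I_n -> int}.

Definition w_of n (f : nat -> int) : weight n := [ffun j : 'I_n => f j.+1].

(* varpi_i-coordinate of mu (0 if i is not in I); equals (alpha_i, mu) *)
Definition wc n (mu : weight n) (i : nat) : int := \sum_(j < n | j.+1 == i) mu j.

Definition cartan (i j : nat) : int :=
  if i == j then 2 else if (i == j.+1) || (j == i.+1) then -1 else 0.

Definition fweight n (i : nat) : weight n := w_of n (fun j => (j == i)%:Z).
Definition sroot n (i : nat) : weight n := w_of n (fun j => cartan j i).
Definition srefl n (i : nat) (mu : weight n) : weight n :=
  mu - sroot n i *~ wc mu i.
Definition tauI (n i : nat) : nat := n - i + 1.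
Definition tauw n (mu : weight n) : weight n := w_of n (fun j => wc mu (tauI n j)).
Definition varpi' n (i : nat) : weight n := fweight n i - fweight n (tauI n i).

Definition inX (n r j : nat) : bool := ((r < j) && (j <= n - r))%N.
Definition inI (n j : nat) : bool := ((0 < j) && (j <= n))%N.

(* reduced word of the longest element w_X of the parabolic subgroup W_X:
   w_X = (s_a)(s_{a+1} s_a)(s_{a+2} s_{a+1} s_a)...(s_b ... s_a),
   with a = r+1, b = n-r. *)
Definition wX_word (n r : nat) : seq nat :=
  flatten [seq rev (iota r.+1 k.+1) | k <- iota 0 (n - r - r)].
Definition wX_act n r (mu : weight n) : weight n := foldr (@srefl n) mu (wX_word n r).
Definition in_Theta n r (mu : weight n) : Prop := - wX_act r (tauw mu) = mu.

Inductive subalg_gen (F : fieldType) (A : algType F) (G : A -> Prop) : A -> Prop :=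
| sg_gen x : G x -> subalg_gen G x
| sg_one : subalg_gen G 1
| sg_add x y : subalg_gen G x -> subalg_gen G y -> subalg_gen G (x + y)
| sg_scale (a : F) x : subalg_gen G x -> subalg_gen G (a *: x)
| sg_mul x y : subalg_gen G x -> subalg_gen G y -> subalg_gen G (x * y).

Definition is_alg_aut_on (F : fieldType) (A : algType F) (P : A -> Prop) (f : A -> A)
  : Prop :=
  (forall x, P x -> P (f x)) /\
  (forall x y, P x -> P y -> f (x + y) = f x + f y) /\
  (forall (a : F) x, P x -> f (a *: x) = a *: f x) /\
  (forall x y, P x -> P y -> f (x * y) = f x * f y) /\
  f 1 = 1 /\
  (forall x y, P x -> P y -> f x = f y -> x = y) /\
  (forall y, P y -> exists2 x, P x & f x = y).

Section Uq.
Variables (F : fieldType) (A : algType F) (n r : nat) (t : F)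
  (E Fg : nat -> A) (Kw : weight n -> A) (c : nat -> F) (sq : F -> F).

(* q = (q^{1/2})^2 with t = q^{1/2} *)
Definition qq : F := t ^+ 2.

Definition qbr (a b : A) (s : F) : A := a * b - s *: (b * a).

Definition Ki (i : nat) : A := Kw (sroot n i).
Definition Kinv (i : nat) : A := Kw (- sroot n i).
Definition Lw (i : nat) : A := Kw (sroot n i - sroot n (tauI n i)).

Definition Uq_rels : Prop :=
  Kw 0 = 1 /\
  (forall mu la, Kw (mu + la) = Kw mu * Kw la) /\
  (forall mu i, inI n i -> Kw mu * E i = (qq ^ (wc mu i)) *: (E i * Kw mu)) /\
  (forall mu i, inI n i -> Kw mu * Fg i = (qq ^ (- wc mu i)) *: (Fg i * Kw mu)) /\
  (forall i j, inI n i -> inI n j ->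
     E i * Fg j - Fg j * E i =
       (if i == j then (qq - qq^-1)^-1 *: (Ki i - Kinv i) else 0)) /\
  (forall i j, inI n i -> inI n j -> cartan i j = -1 ->
     E i * E i * E j - (qq + qq^-1) *: (E i * E j * E i) + E j * E i * E i = 0 /\
     Fg i * Fg i * Fg j - (qq + qq^-1) *: (Fg i * Fg j * Fg i) + Fg j * Fg i * Fg i = 0) /\
  (forall i j, inI n i -> inI n j -> cartan i j = 0 ->
     E i * E j = E j * E i /\ Fg i * Fg j = Fg j * Fg i).

Definition Lusztig (T : nat -> A -> A) : Prop :=
  forall i, inI n i ->
    is_alg_aut_on (fun _ => True) (T i) /\
    T i (E i) = - (Fg i * Ki i) /\
    T i (Fg i) = - (Kinv i * E i) /\
    (forall mu, T i (Kw mu) = Kw (srefl i mu)) /\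
    (forall j, inI n j -> cartan i j = 0 -> T i (E j) = E j /\ T i (Fg j) = Fg j) /\
    (forall j, inI n j -> cartan i j = -1 ->
       T i (E j) = qbr (E i) (E j) qq^-1 /\ T i (Fg j) = qbr (Fg j) (Fg i) qq).

Definition EXp : A :=
  foldr (fun j acc => qbr (E j) acc qq^-1) (E (n - r)) (iota r.+1 (n - r - r).-1).
Definition EXm : A :=
  foldr (fun j acc => qbr (E j) acc qq^-1) (E r.+1) (rev (iota r.+2 (n - r - r).-1)).
Definition FXp : A :=
  foldr (fun j acc => qbr (Fg j) acc qq) (Fg (n - r)) (iota r.+1 (n - r - r).-1).
Definition FXm : A :=
  foldr (fun j acc => qbr (Fg j) acc qq) (Fg r.+1) (rev (iota r.+2 (n - r - r).-1)).
Definition KXw : weight n := \sum_(j <- iota r.+1 (n - r - r)) sroot n j.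

Definition Bg (i : nat) : A :=
  if i == r then Fg r - c r *: (qbr EXp (E (tauI n r)) qq^-1 * Kinv r)
  else if i == tauI n r then Fg i - c i *: (qbr EXm (E r) qq^-1 * Kinv i)
  else Fg i - c i *: (E (tauI n i) * Kinv i).

Definition MXTheta_gens (x : A) : Prop :=
  (exists j, inX n r j /\ (x = E j \/ x = Fg j \/ x = Ki j \/ x = Kinv j)) \/
  (exists mu, in_Theta r mu /\ x = Kw mu).

Definition Bc_gens (x : A) : Prop :=
  MXTheta_gens x \/ (exists i, inI n i /\ ~~ inX n r i /\ x = Bg i).

Definition Bc : A -> Prop := subalg_gen Bc_gens.

(* (q c_i)^{-1/2}, using the fixed square roots q^{1/2} = t and sq (c_i) *)
Definition qcinvsqrt (i : nat) : F := (t * sq (c i))^-1.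
(* C = (q c_r c_{tau r})^{-1/2} *)
Definition Ccst : F := (t * sq (c r) * sq (c (tauI n r)))^-1.

Definition tau_small_spec (T : nat -> A -> A) (i : nat) (f : A -> A) : Prop :=
  is_alg_aut_on Bc f /\
  (forall x, subalg_gen MXTheta_gens x -> f x = T i (T (tauI n i) x)) /\
  (forall j, inI n j -> ~~ inX n r j ->
     f (Bg j) =
       if (j == i) || (j == tauI n i) then qq^-1 *: (Bg (tauI n j) * Lw (tauI n j))
       else if cartan i j == -1 then qcinvsqrt i *: qbr (Bg j) (Bg i) qq
       else if cartan (tauI n i) j == -1 then
         qcinvsqrt (tauI n i) *: qbr (Bg j) (Bg (tauI n i)) qq
       else Bg j).

Definition tauR_word : seq nat :=
  iota r (n - r - r).+2 ++ rev (iota r (n - r - r).+1).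

Definition tau_r_spec (T : nat -> A -> A) (f : A -> A) : Prop :=
  is_alg_aut_on Bc f /\
  (forall x, subalg_gen MXTheta_gens x -> f x = foldr (fun i y => T i y) x tauR_word) /\
  (forall j, inI n j -> ~~ inX n r j ->
     f (Bg j) =
       if j == r then qq^-1 *: (Bg r * Lw r * Kw (varpi' n r.+1))
       else if j == tauI n r then
         qq^-1 *: (Bg (tauI n r) * Lw (tauI n r) * Kw (varpi' n (tauI n r.+1)))
       else if j == r.-1 then
         Ccst *: (qbr (Bg r.-1) (qbr (Bg r) (qbr FXp (Bg (tauI n r)) qq) qq) qq
                  + (qq * c (tauI n r)) *: (Bg r.-1 * Lw r * Kw (- KXw)))
       else if j == tauI n r.-1 then
         Ccst *: (qbr (Bg (tauI n r.-1)) (qbr (Bg (tauI n r)) (qbr FXm (Bg r) qq) qq) qq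
                  + (qq * c r) *: (Bg (tauI n r.-1) * Lw (tauI n r) * Kw (- KXw)))
       else Bg j).

End Uq.

(* Main.v *)
(* On the subalgebra generated by M_X and U^0_Theta the automorphism tau_r is the identity:
   its word spells the reflection in the highest root of the interval [r, tau(r)], which
   fixes the inner simple roots and the weights of Theta; and tau_i, i < r, acts there
   through the transpositions s_i and s_{tau(i)} of the coordinates of a weight. So only
   the B_j matter, and by the diagram automorphism only those with j <= r.

   Put Y = [B_r, [F_X^+, B_{tau(r)}]_q]_q, so that tau_r(B_{r-1}) is, up to the scalar C,
   [B_{r-1}, Y]_q plus a torus multiple of B_{r-1}. Since F_X^+ is fixed and the torus
   factors cancel, tau_r(Y) = Y. The Serre relations and the commutators of B_r with
   B_{tau(r)} and of E_X^-+ with F_X^+- show that tau_{r-1} tau_r (B_{r-1}) is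
   C ([Y, B_{tau(r-1)}]_q + c_{tau(r)} B_{tau(r-1)} K) with K in the torus, and that tau_r
   sends this element to B_{tau(r-1)}. Similarly
   tau_{r-1} tau_r tau_{r-1} (B_r) = C B1 with B1 a multicommutator of B_r, F_X^+, E_X^+
   times a torus element, on which tau_r acts as it does on B_r. These values settle the
   braid relation on B_{r-1} and B_r; B_{r-2} is moved by tau_{r-1} only and reduces to
   them, and the B_j with j < r - 2 are fixed by both maps. *)
Require Import Defs.
From HB Require Import structures.
From mathcomp Require Import all_boot all_order all_algebra.
From mathcomp Require Import zify ring.
Set Implicit Arguments. Unset Strict Implicit. Unset Printing Implicit Defensive.
Import Order.TTheory GRing.Theory Num.Theory.
Local Open Scope ring_scope.

(** * Normal forms in finitely presented algebras *)

(** Every identity is deduced from the listed relations alone, by rewriting in a free algebra. The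
    obstacle is that X has arbitrary length, so the multicommutators E_X^+-, F_X^+- cannot be
    expanded. They are kept as letters, and what is needed of them is a finite list of
    q-commutation, Serre and sl_2 relations ([rel_half]), proved by induction on the length of X;
    the braid relation becomes a computation in boundedly many letters. Several commutations are
    reached only after multiplication by q + q^-1, as explicit combinations of Serre elements; this
    is where q^2 + 1 != 0 enters. For B_r and [F_X^+, B_{tau(r)}]_q the Serre relation fails,
    because B_r and B_{tau(r)} do not commute, and the second summand of tau_r(B_{r-1}) compensates
    part of the defect; the remaining part is the multicommutator that appears in tau_{r-1} tau_r
    tau_{r-1} (B_r). Of the square roots only the values of C^2 and of (q c_{r-1})^{-1} enter the
    rank two computation. Statements about B_{tau(j)} are those about B_j for relabelled data, so
    the lemmas take arbitrary [E], [Fg], [Kw] subject to the relations, and arbitrary parameters. *)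

Inductive cexpr : Type :=
  | CZero | COne | CVar of nat | CAdd of cexpr & cexpr | CMul of cexpr & cexpr
  | COpp of cexpr.

Inductive aexpr : Type :=
  | AZero | AOne | AVar of nat | AAdd of aexpr & aexpr | AMul of aexpr & aexpr
  | AOpp of aexpr | AScale of cexpr & aexpr.

(** Coefficients stay formal expressions, trimmed only of zeros and ones: whether they vanish is
    decided at the end, in the field. *)
Definition cadd c d :=
  match c, d with CZero, _ => d | _, CZero => c | _, _ => CAdd c d end.
Definition cmul c d :=
  match c, d with
  | CZero, _ => CZero | _, CZero => CZero | COne, _ => d | _, COne => c
  | _, _ => CMul c d
  end.

Definition ncpoly := seq (cexpr * seq nat).

Fixpoint pinsert (m : cexpr * seq nat) (p : ncpoly) : ncpoly :=
  match p with
  | [::] => [:: m]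
  | m' :: p' => if m.2 == m'.2 then (cadd m.1 m'.1, m'.2) :: p'
                else m' :: pinsert m p'
  end.
Definition padd (p p' : ncpoly) : ncpoly := foldr pinsert p' p.
Definition pscale c (p : ncpoly) : ncpoly := [seq (cmul c m.1, m.2) | m <- p].
Definition pmulw (c : cexpr) (w : seq nat) (p : ncpoly) : ncpoly :=
  [seq (cmul c m.1, w ++ m.2) | m <- p].
Definition pmul (p p' : ncpoly) : ncpoly :=
  foldr (fun m acc => padd (pmulw m.1 m.2 p') acc) [::] p.

Fixpoint pnorm (e : aexpr) : ncpoly :=
  match e with
  | AZero => [::]
  | AOne => [:: (COne, [::])]
  | AVar i => [:: (COne, [:: i])]
  | AAdd e1 e2 => padd (pnorm e1) (pnorm e2)
  | AMul e1 e2 => pmul (pnorm e1) (pnorm e2)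
  | AOpp e1 => pscale (COpp COne) (pnorm e1)
  | AScale c e1 => pscale c (pnorm e1)
  end.

Fixpoint strip_prefix (l w : seq nat) : option (seq nat) :=
  match l, w with
  | [::], _ => Some w
  | i :: l', j :: w' => if i == j then strip_prefix l' w' else None
  | _, _ => None
  end.

Definition ncrule := (seq nat * ncpoly)%type.

Fixpoint head_step (rs : seq ncrule) (w : seq nat) : option ncpoly :=
  match rs with
  | [::] => None
  | (l, p) :: rs' =>
    match strip_prefix l w with
    | Some v => Some [seq (m.1, m.2 ++ v) | m <- p]
    | None => head_step rs' w
    end
  end.

Fixpoint word_step (rs : seq ncrule) (w : seq nat) : option ncpoly :=
  match head_step rs w with
  | Some p => Some p
  | None =>
    match w with
    | [::] => None
    | i :: w' => match word_step rs w' with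
                 | Some p => Some [seq (m.1, i :: m.2) | m <- p]
                 | None => None
                 end
    end
  end.

(** The fuel bounds the number of monomials treated; what is left when it runs out is added
    unreduced, so the value is preserved in every case. *)
Fixpoint reduce (fuel : nat) (rs : seq ncrule) (p acc : ncpoly) : ncpoly :=
  match fuel, p with
  | _, [::] => acc
  | 0, _ => padd p acc
  | fuel'.+1, m :: p' =>
    match word_step rs m.2 with
    | Some p1 => reduce fuel' rs (pscale m.1 p1 ++ p') acc
    | None => reduce fuel' rs p' (pinsert m acc)
    end
  end.

(** Meaningful on products of variables only; the empty word elsewhere is a default that [is_word]
    excludes. *)
Fixpoint as_word (e : aexpr) : seq nat :=
  match e with
  | AVar i => [:: i]
  | AMul e1 e2 => as_word e1 ++ as_word e2
  | _ => [::]
  end.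
Fixpoint is_word (e : aexpr) : bool :=
  match e with
  | AVar _ => true
  | AMul e1 e2 => is_word e1 && is_word e2
  | _ => false
  end.

Definition rule_of (r : aexpr * aexpr) : ncrule := (as_word r.1, pnorm r.2).

Section Eval.
Variables (F : fieldType) (A : algType F) (rho : seq F) (env : seq A).

Fixpoint ceval (c : cexpr) : F :=
  match c with
  | CZero => 0
  | COne => 1
  | CVar i => nth 0 rho i
  | CAdd c1 c2 => ceval c1 + ceval c2
  | CMul c1 c2 => ceval c1 * ceval c2
  | COpp c1 => - ceval c1
  end.

Fixpoint aeval (e : aexpr) : A :=
  match e with
  | AZero => 0
  | AOne => 1
  | AVar i => nth 0 env i
  | AAdd e1 e2 => aeval e1 + aeval e2
  | AMul e1 e2 => aeval e1 * aeval e2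
  | AOpp e1 => - aeval e1
  | AScale c e1 => ceval c *: aeval e1
  end.

Definition weval (w : seq nat) : A := foldr (fun i acc => nth 0 env i * acc) 1 w.
Definition peval (p : ncpoly) : A :=
  foldr (fun m acc => ceval m.1 *: weval m.2 + acc) 0 p.

Lemma ceval_cadd c d : ceval (cadd c d) = ceval c + ceval d.
Proof. by case: c => *; case: d => * //=; rewrite ?add0r ?addr0. Qed.

Lemma ceval_cmul c d : ceval (cmul c d) = ceval c * ceval d.
Proof.
by case: c => *; case: d => * //=; rewrite ?mul0r ?mulr0 ?mul1r ?mulr1.
Qed.

Lemma weval_cat u v : weval (u ++ v) = weval u * weval v.
Proof. by elim: u => [|i u IH] /=; rewrite ?mul1r // IH mulrA. Qed.

Lemma peval_cat p p' : peval (p ++ p') = peval p + peval p'.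
Proof. by elim: p => [|m p IH] /=; rewrite ?add0r // IH addrA. Qed.

Lemma peval_pinsert m p : peval (pinsert m p) = ceval m.1 *: weval m.2 + peval p.
Proof.
elim: p => [|m' p IH] //=; case: eqP => [E|_] /=.
  by rewrite ceval_cadd scalerDl E addrA.
by rewrite IH addrCA.
Qed.

Lemma peval_padd p p' : peval (padd p p') = peval p + peval p'.
Proof.
by elim: p => [|m p IH] /=; rewrite ?add0r // peval_pinsert IH addrA.
Qed.

Lemma peval_pscale c p : peval (pscale c p) = ceval c *: peval p.
Proof.
elim: p => [|m p IH] /=; first by rewrite scaler0.
by rewrite IH ceval_cmul scalerDr scalerA.
Qed.

Lemma peval_pmulw c w p : peval (pmulw c w p) = ceval c *: (weval w * peval p).
Proof.
elim: p => [|m p IH] /=; first by rewrite mulr0 scaler0.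
by rewrite IH ceval_cmul mulrDr scalerDr weval_cat -scalerAr scalerA.
Qed.

Lemma peval_pmul p p' : peval (pmul p p') = peval p * peval p'.
Proof.
elim: p => [|m p IH] /=; first by rewrite mul0r.
by rewrite peval_padd peval_pmulw IH mulrDl scalerAl.
Qed.

Lemma peval_pnorm e : peval (pnorm e) = aeval e.
Proof.
elim: e => [||i|e1 IH1 e2 IH2|e1 IH1 e2 IH2|e IH|c e IH] //=.
- by rewrite scale1r addr0.
- by rewrite scale1r addr0 mulr1.
- by rewrite peval_padd IH1 IH2.
- by rewrite peval_pmul IH1 IH2.
- by rewrite peval_pscale IH /= scaleN1r.
- by rewrite peval_pscale IH.
Qed.

Lemma peval_right p v :
  peval [seq (m.1, m.2 ++ v) | m <- p] = peval p * weval v.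
Proof.
elim: p => [|m p IH] /=; first by rewrite mul0r.
by rewrite IH weval_cat mulrDl scalerAl.
Qed.

Lemma peval_left i p :
  peval [seq (m.1, i :: m.2) | m <- p] = nth 0 env i * peval p.
Proof.
elim: p => [|m p IH] /=; first by rewrite mulr0.
by rewrite IH mulrDr scalerAr.
Qed.

Lemma strip_prefixP l w v : strip_prefix l w = Some v -> w = l ++ v.
Proof.
elim: l w => [w [<-]|i l IH [|j w] //=] //.
by case: eqP => // -> /IH->.
Qed.

Definition rule_ok (r : ncrule) : Prop := weval r.1 = peval r.2.
Fixpoint all_rules (P : ncrule -> Prop) (rs : seq ncrule) : Prop :=
  if rs is r :: rs' then P r /\ all_rules P rs' else True.

Lemma head_stepP rs w p :
  all_rules rule_ok rs -> head_step rs w = Some p -> weval w = peval p.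
Proof.
elim: rs => [|[l r] rs IH] //= [Hr Hrs].
case E: strip_prefix => [v|]; last exact: IH.
by move=> [<-]; rewrite (strip_prefixP E) weval_cat peval_right Hr.
Qed.

Lemma word_stepP rs w p :
  all_rules rule_ok rs -> word_step rs w = Some p -> weval w = peval p.
Proof.
move=> Hrs; elim: w p => [|i w IH] p /=.
  by case E: head_step => [p'|] // [<-]; rewrite -(head_stepP Hrs E).
case E: head_step => [p'|]; first by move=> [<-]; rewrite -(head_stepP Hrs E).
by case E': word_step => [p''|] // [<-]; rewrite peval_left (IH _ E').
Qed.

Lemma peval_reduce fuel rs p acc :
  all_rules rule_ok rs -> peval (reduce fuel rs p acc) = peval p + peval acc.
Proof.
move=> Hrs; elim: fuel p acc => [|n IH] [|m p] acc; rewrite ?add0r //.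
  by rewrite /= peval_pinsert peval_padd addrA.
rewrite /=; case E: word_step => [p1|]; rewrite IH.
  by rewrite peval_cat peval_pscale (word_stepP Hrs E).
by rewrite peval_pinsert addrCA addrA.
Qed.

Lemma weval_as_word e : is_word e -> weval (as_word e) = aeval e.
Proof.
elim: e => [||i||e1 IH1 e2 IH2||] //=; first by rewrite mulr1.
by case/andP=> w1 w2; rewrite weval_cat IH1 ?IH2.
Qed.

Fixpoint rules_hold (rs : seq (aexpr * aexpr)) : Prop :=
  if rs is r :: rs' then aeval r.1 = aeval r.2 /\ rules_hold rs' else True.

Fixpoint coefs_vanish (p : ncpoly) : Prop :=
  match p with
  | [::] => True
  | m :: p' => ceval m.1 = 0 /\ coefs_vanish p'
  end.

(** Soundness of rewriting: each rule is a true equation, so a reduced difference with vanishing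
    coefficients is zero. The reduced form [p] is a separate argument so that it can be computed
    beforehand. *)
Lemma nc_eq fuel rs e1 e2 (p : ncpoly) :
  all (fun r : aexpr * aexpr => is_word r.1) rs -> rules_hold rs ->
  reduce fuel (map rule_of rs) (pnorm (AAdd e1 (AOpp e2))) [::] = p ->
  coefs_vanish p -> aeval e1 = aeval e2.
Proof.
move=> Hw Hr Ep Hp; apply/subr0_eq.
have -> : aeval e1 - aeval e2 = aeval (AAdd e1 (AOpp e2)) by [].
rewrite -peval_pnorm -[LHS]addr0 -[X in _ + X]/(peval [::]).
rewrite -(@peval_reduce fuel (map rule_of rs)).
  rewrite Ep; elim: p Hp {Ep} => [|m p IH] //= [-> Hp].
  by rewrite scale0r add0r IH.
elim: rs Hw Hr {Ep Hp} => [|r rs IH] //= /andP[w Hw] [Hr Hrs]; split; last exact: IH.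
by rewrite /rule_ok /= weval_as_word // peval_pnorm.
Qed.

End Eval.

(** * Reification and tactics for identities in algebras *)

Ltac nc_mem x l :=
  lazymatch l with
  | nil => constr:(false)
  | cons x _ => constr:(true)
  | cons _ ?l' => nc_mem x l'
  end.
Ltac nc_add x l :=
  let b := nc_mem x l in
  lazymatch b with
  | true => l
  | false => constr:(cons x l)
  end.
Ltac nc_find x l :=
  lazymatch l with
  | cons x _ => constr:(0%nat)
  | cons _ ?l' => let n := nc_find x l' in constr:(S n)
  end.

Ltac nc_catoms c l :=
  lazymatch c with
  | (?x + ?y)%R => let l1 := nc_catoms x l in nc_catoms y l1
  | (?x * ?y)%R => let l1 := nc_catoms x l in nc_catoms y l1
  | (- ?x)%R => nc_catoms x l
  | 0%R => l
  | 1%R => l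
  | _ => nc_add c l
  end.
Ltac nc_reify_c c l :=
  lazymatch c with
  | (?x + ?y)%R => let u := nc_reify_c x l in let v := nc_reify_c y l in constr:(CAdd u v)
  | (?x * ?y)%R => let u := nc_reify_c x l in let v := nc_reify_c y l in constr:(CMul u v)
  | (- ?x)%R => let u := nc_reify_c x l in constr:(COpp u)
  | 0%R => constr:(CZero)
  | 1%R => constr:(COne)
  | _ => let n := nc_find c l in constr:(CVar n)
  end.
Ltac nc_atoms e p :=
  lazymatch e with
  | (?x + ?y)%R => let p1 := nc_atoms x p in nc_atoms y p1
  | (?x * ?y)%R => let p1 := nc_atoms x p in nc_atoms y p1
  | (- ?x)%R => nc_atoms x p
  | qbr ?x ?y ?c =>
    lazymatch p with
    | (?lc, ?la) =>
      let lc1 := nc_catoms c lc in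
      let p1 := nc_atoms x constr:((lc1, la)) in nc_atoms y p1
    end
  | (?c *: ?x)%R =>
    lazymatch p with
    | (?lc, ?la) => let lc1 := nc_catoms c lc in nc_atoms x constr:((lc1, la))
    end
  | 0%R => p
  | 1%R => p
  | _ => lazymatch p with
         | (?lc, ?la) => let la1 := nc_add e la in constr:((lc, la1))
         end
  end.
Ltac nc_reify e lc la :=
  lazymatch e with
  | (?x + ?y)%R => let u := nc_reify x lc la in let v := nc_reify y lc la in constr:(AAdd u v)
  | (?x * ?y)%R => let u := nc_reify x lc la in let v := nc_reify y lc la in constr:(AMul u v)
  | (- ?x)%R => let u := nc_reify x lc la in constr:(AOpp u)
  | qbr ?x ?y ?c =>
    let k := nc_reify_c c lc in
    let u := nc_reify x lc la in
    let v := nc_reify y lc la in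
    constr:(AAdd (AMul u v) (AOpp (AScale k (AMul v u))))
  | (?c *: ?x)%R => let k := nc_reify_c c lc in let u := nc_reify x lc la in constr:(AScale k u)
  | 0%R => constr:(AZero)
  | 1%R => constr:(AOne)
  | _ => let n := nc_find e la in constr:(AVar n)
  end.

Ltac nc_rules_atoms hs p :=
  lazymatch hs with
  | (?hs', ?h) =>
    let p1 := nc_rules_atoms hs' p in
    let T := type of h in
    let T' := eval hnf in T in
    lazymatch T' with
    | ?x = ?y => let p2 := nc_atoms x p1 in nc_atoms y p2
    end
  | tt => p
  end.
Ltac nc_rules_reify hs lc la acc :=
  lazymatch hs with
  | (?hs', ?h) =>
    let T := type of h in
    let T' := eval hnf in T in
    lazymatch T' with
    | ?x = ?y =>
      let u := nc_reify x lc la in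
      let v := nc_reify y lc la in
      nc_rules_reify hs' lc la constr:(cons (u, v) acc)
    end
  | tt => acc
  end.
Ltac nc_rules_proof hs acc :=
  lazymatch hs with
  | (?hs', ?h) => nc_rules_proof hs' constr:(conj h acc)
  | tt => acc
  end.


(** Each factor of a denominator left by [field] has to be nonzero by a hypothesis of the context;
    this is why q^2 - 1 != 0 and q^2 + 1 != 0 are carried along in exactly this form. *)
Ltac nc_side :=
  repeat match goal with |- is_true (_ && _) => apply/andP; split end;
  first [exact isT | assumption | exact: oner_neq0].

(* [nc_with hs tac] proves an equation in an [F]-algebra by expanding both sides in the
   free algebra on the atoms and rewriting monomials with the oriented equations [hs] (a
   nested tuple starting with [tt], whose left-hand sides are monomials); [tac] has to
   show that the scalar coefficients of the normal form vanish. *)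
Ltac nc_with hs tac :=
  lazymatch goal with
  | A : GRing.Algebra.type ?F |- @eq _ ?x ?y =>
    let p0 := constr:((@nil (GRing.Field.sort F), @nil (GRing.Algebra.sort A))) in
    let p1 := nc_atoms x p0 in
    let p2 := nc_atoms y p1 in
    let p3 := nc_rules_atoms hs p2 in
    lazymatch p3 with
    | (?lc, ?la) =>
      let e1 := nc_reify x lc la in
      let e2 := nc_reify y lc la in
      let rs := nc_rules_reify hs lc la (@nil (aexpr * aexpr)) in
      let pf := nc_rules_proof hs I in
      let p := eval vm_compute in
        (reduce 4000 (map rule_of rs) (pnorm (AAdd e1 (AOpp e2))) [::]) in
      refine (@nc_eq F A lc la 4000 rs e1 e2 p (erefl true) _ _ _);
      [ exact pf
      | vm_cast_no_check (erefl p)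
      | lazy beta iota delta [coefs_vanish ceval nth fst snd];
        repeat (split; [ tac | ]); exact I ]
    end
  end.
Ltac nc hs := nc_with hs ltac:(field; nc_side).

Ltac idx_lia :=
  repeat match goal with
  | |- context [if ?b then _ else _] =>
    lazymatch b with
    | context [if _ then _ else _] => fail
    | _ => let H := fresh "H" in case H : b
    end
  end; lia.

(** * Weights *)

Section Weights.
Variable n : nat.
Implicit Types (mu la : weight n) (x y : nat -> int).

(* Coordinates of a weight in the basis of gl_{n+1}: the weight sum_k x_k eps_k, on
   which the simple reflections act by transposing indices. *)
Definition wt x : weight n := w_of n (fun j => x j - x j.+1).

Lemma wc_w_of (f : nat -> int) i : inI n i -> wc (w_of n f) i = f i.
Proof.
case: i => [|i] // /andP[_ lt_in].
rewrite /wc (bigD1 (Ordinal lt_in)) //= ffunE /= big1 ?addr0 // => j.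
by case/andP=> /eqP[E] /eqP[]; apply: val_inj.
Qed.

Lemma wc_wt x i : inI n i -> wc (wt x) i = x i - x i.+1.
Proof. exact: wc_w_of. Qed.

Lemma weightP mu la : (forall i, inI n i -> wc mu i = wc la i) -> mu = la.
Proof.
have E nu (j : 'I_n) : wc nu j.+1 = nu j.
  rewrite /wc (bigD1 j) //= big1 ?addr0 // => k.
  by case/andP=> /eqP[E] /eqP[]; apply: val_inj.
by move=> H; apply/ffunP=> j; rewrite -!E H // /inI ltn_ord.
Qed.

Lemma wcD mu la i : wc (mu + la) i = wc mu i + wc la i.
Proof. by rewrite /wc -big_split /=; apply: eq_bigr => j _; rewrite ffunE. Qed.

Lemma wcN mu i : wc (- mu) i = - wc mu i.
Proof. by rewrite /wc -sumrN; apply: eq_bigr => j _; rewrite ffunE. Qed.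

Lemma wcB mu la i : wc (mu - la) i = wc mu i - wc la i.
Proof. by rewrite wcD wcN. Qed.

Lemma wc_mulz mu (z : int) i : wc (mu *~ z) i = wc mu i * z.
Proof.
by rewrite /wc mulr_suml; apply: eq_bigr => j _; rewrite ffunMzE -mulrzr intz.
Qed.

Lemma eq_wt x y :
  (forall i, inI n i -> x i - x i.+1 = y i - y i.+1) -> wt x = wt y.
Proof. by move=> H; apply: weightP => i Hi; rewrite !wc_wt // H. Qed.

Lemma wtD x y : wt x + wt y = wt (fun k => x k + y k).
Proof. by apply: weightP => i Hi; rewrite wcD !wc_wt //; ring. Qed.

Lemma wtN x : - wt x = wt (fun k => - x k).
Proof. by apply: weightP => i Hi; rewrite wcN !wc_wt //; ring. Qed.

Lemma wtB x y : wt x - wt y = wt (fun k => x k - y k).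
Proof. by rewrite wtN wtD. Qed.

Lemma wt0 : wt (fun=> 0) = 0.
Proof. by apply/ffunP=> j; rewrite !ffunE subrr. Qed.

Lemma wt_onto mu : exists x, mu = wt x.
Proof.
(* Negated partial sums: their consecutive differences are the coordinates of [mu]. *)
exists (fun k => - \sum_(1 <= j < k) wc mu j); apply: weightP => i Hi.
have /andP[i0 _] := Hi.
by rewrite wc_wt // big_nat_recr //=; ring.
Qed.

Lemma sroot_wt i :
  inI n i -> sroot n i = wt (fun k => (k == i)%:Z - (k == i.+1)%:Z).
Proof.
move=> Hi; apply: weightP => j Hj; rewrite wc_wt // wc_w_of // /cartan.
do 2![rewrite ?eqSS; case: eqP => ? /=]; try lia.
all: repeat (case: eqP => ? /=); lia.
Qed.

Definition swap_idx i k := if k == i then i.+1 else if k == i.+1 then i else k.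

Lemma srefl_wt i x : inI n i -> srefl i (wt x) = wt (x \o swap_idx i).
Proof.
move=> Hi; apply: weightP => j Hj.
rewrite /srefl wcB wc_mulz sroot_wt // !wc_wt // /= /swap_idx eqSS.
repeat (case: eqP => ? /=); try lia; subst; ring.
Qed.

(** The diagram automorphism is minus the longest element of the Weyl group, which reverses the n+1
    coordinates; hence the sign and [n.+2 - k]. *)
Lemma tauw_wt x : tauw (wt x) = wt (fun k => - x (n.+2 - k)%N).
Proof.
apply: weightP => j Hj; rewrite wc_w_of // !wc_wt; rewrite /tauI.
- have -> : (n - j + 1 = n.+2 - j.+1)%N by move: Hj; rewrite /inI; lia.
  have -> : ((n.+2 - j.+1).+1 = n.+2 - j)%N by move: Hj; rewrite /inI; lia.
  by ring.
- by move: Hj; rewrite /inI; lia.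
- by move: Hj; rewrite /inI; lia.
Qed.

(** The two mutually inverse cycles on the positions i, ..., i+l. They describe the products of
    simple transpositions along an interval, in decreasing and in increasing order. *)
Definition cycle_up i l k :=
  if (i <= k < i + l)%N then k.+1 else if k == (i + l)%N then i else k.
Definition cycle_down i l k :=
  if k == i then (i + l)%N else if (i < k <= i + l)%N then k.-1 else k.

Lemma srefl_rev_iota x i l : (0 < i)%N -> (i + l <= n.+1)%N ->
  foldr (@srefl n) (wt x) (rev (iota i l)) = wt (x \o cycle_up i l).
Proof.
move=> i0; elim: l => [|l IH] il.
  apply: eq_wt => j _ /=; rewrite /cycle_up addn0.
  have E k : (i <= k < i)%N = false by lia.
  by rewrite !E; do 2![case: eqP => [->|_] //].
rewrite -addn1 iotaD rev_cat /= IH; last by lia.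
rewrite srefl_wt; last by rewrite /inI; lia.
apply: eq_wt => j _ /=; rewrite /cycle_up /swap_idx.
by congr (x _ - x _); idx_lia.
Qed.

Lemma srefl_iota x i l : (0 < i)%N -> (i + l <= n.+1)%N ->
  foldr (@srefl n) (wt x) (iota i l) = wt (x \o cycle_down i l).
Proof.
elim: l i => [|l IH] i i0 il.
  apply: eq_wt => j _ /=; rewrite /cycle_down addn0.
  by congr (x _ - x _); idx_lia.
rewrite /= IH; [|by lia|by lia].
rewrite srefl_wt; last by rewrite /inI; lia.
apply: eq_wt => j _ /=; rewrite /cycle_down /swap_idx.
by congr (x _ - x _); idx_lia.
Qed.

(** * The weights of the torus of Theta *)

Section Theta.
Variable r : nat.
Hypotheses (r_gt0 : (0 < r)%N) (r_le : (r <= n.+1./2 - 1)%N).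

(** The permutation w_X: W_X permutes the positions r+1, ..., n+1-r, and its longest element
    reverses them. *)
Definition rev_X k := if (r < k <= n.+1 - r)%N then (n.+2 - k)%N else k.

Lemma wX_act_wt x : wX_act r (wt x) = wt (x \o rev_X).
Proof.
rewrite /wX_act /wX_word.
(* The first m blocks of the word of w_X reverse the m+1 positions r+1, ..., r+m+1; each further
   block is a cycle that brings in one more position. *)
pose rv m k := if (r < k <= r + m.+1)%N then (r + r + m.+2 - k)%N else k.
suff H m y : (r + m <= n - r)%N ->
    foldr (@srefl n) (wt y) (flatten [seq rev (iota r.+1 k.+1) | k <- iota 0 m])
    = wt (y \o rv m).
  rewrite H; last by lia.
  by apply: eq_wt => j _ /=; rewrite /rv /rev_X; congr (x _ - x _); idx_lia.
elim: m y => [|m IH] y rm.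
  by apply: eq_wt => j _ /=; rewrite /rv; congr (y _ - y _); idx_lia.
rewrite -[m.+1]addn1 iotaD map_cat flatten_cat foldr_cat.
have -> : flatten [seq rev (iota r.+1 k.+1) | k <- iota (0 + m) 1]
    = rev (iota r.+1 m.+1) by rewrite /= cats0.
rewrite srefl_rev_iota; [|by []|by lia].
rewrite IH; last by lia.
by apply: eq_wt => j _ /=; rewrite /rv /cycle_up; congr (y _ - y _); idx_lia.
Qed.

(** The two reversals, of all positions by tau and of the inner ones by w_X, cancel on the inner
    positions and leave the exchange of k with n+2-k on the outer ones; the two signs cancel as
    well. *)
Lemma in_Theta_wt x :
  in_Theta r (wt x) <-> (forall k, (0 < k <= r)%N -> x k = x (n.+2 - k)%N).
Proof.
rewrite /in_Theta tauw_wt wX_act_wt wtN.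
set y := fun k => _.
have yE k : (0 < k <= n.+1)%N ->
    y k = if (r < k <= n.+1 - r)%N then x k else x (n.+2 - k)%N.
  by move=> Hk; rewrite /y /= opprK /rev_X; case: ifP => E; congr x; idx_lia.
split=> [Exy k kr|Hx]; last first.
  apply: eq_wt => j /andP[j0 jn]; rewrite !yE; try lia.
  have Hx' i : (n.+1 - r < i <= n.+1)%N -> x (n.+2 - i)%N = x i.
    by move=> Hi; rewrite Hx; [congr x|]; idx_lia.
  congr (_ - _); case: ifP => // Hj.
    by case: (leqP j r) => ?; [rewrite -Hx|rewrite Hx']; lia.
  by case: (leqP j.+1 r) => ?; [rewrite -Hx|rewrite Hx']; lia.
have E j : inI n j -> y j - y j.+1 = x j - x j.+1.
  by move=> Hj; rewrite -!wc_wt // Exy.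
have /andP[k0 {}kr] := kr.
(* Equality of weights compares only consecutive differences, so the equality of coordinates is
   propagated outwards from position r+1, where [x] and [y] agree. *)
have -> : k = (r - (r - k))%N by lia.
have : (r - k < r)%N by lia.
elim: (r - k)%N => [|d IH] dr.
  have := E r; rewrite !yE; try lia.
  have -> : (r < r <= n.+1 - r)%N = false by lia.
  have -> : (r < r.+1 <= n.+1 - r)%N by lia.
  by rewrite subn0 => /(_ _); rewrite /inI; lia.
have := E (r - d.+1)%N; rewrite !yE; try lia.
have -> : (r < r - d.+1 <= n.+1 - r)%N = false by lia.
have -> : (r < (r - d.+1).+1 <= n.+1 - r)%N = false by lia.
have -> : ((r - d.+1).+1 = r - d)%N by lia.
have := IH; rewrite /inI; lia.
Qed.

Lemma in_ThetaN mu : in_Theta r mu -> in_Theta r (- mu).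
Proof.
have [x ->] := wt_onto mu; move=> /in_Theta_wt Hx.
by rewrite wtN; apply/in_Theta_wt => k Hk; rewrite (Hx k).
Qed.

(** The two cycles compose to the transposition of the positions r and n+2-r, at which a weight of
    Theta has equal coordinates. *)
Lemma tauR_word_Theta mu :
  in_Theta r mu -> foldr (@srefl n) mu (tauR_word n r) = mu.
Proof.
have [x ->] := wt_onto mu => /in_Theta_wt Hx.
rewrite /tauR_word foldr_cat srefl_rev_iota ?srefl_iota; try lia.
apply: eq_wt => j Hj; rewrite /=.
suff E k : (0 < k <= n.+1)%N ->
    x (cycle_up r (n - r - r).+1 (cycle_down r (n - r - r).+2 k)) = x k.
  by move: Hj; rewrite /inI => Hj; rewrite !E; lia.
move=> Hk; have Hr := Hx r; rewrite /cycle_up /cycle_down.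
case: (eqVneq k r) => [->|kr].
  by rewrite Hr; [congr x|]; idx_lia.
case: (eqVneq k (n.+2 - r)%N) => [->|kr2]; last by congr x; idx_lia.
by rewrite -Hr; [congr x|]; idx_lia.
Qed.

(** The permutation s_i s_{tau(i)} commutes with the exchange of k and n+2-k, and i < r makes it
    preserve the range 1, ..., r. *)
Lemma in_Theta_srefl2 i mu : (0 < i < r)%N -> in_Theta r mu ->
  in_Theta r (srefl i (srefl (tauI n i) mu)).
Proof.
move=> Hi; have [x ->] := wt_onto mu; move=> /in_Theta_wt Hx.
rewrite !srefl_wt; try by rewrite /inI /tauI; lia.
apply/in_Theta_wt => k Hk /=.
have -> : swap_idx (tauI n i) (swap_idx i k) = swap_idx i k.
  by rewrite /swap_idx /tauI; idx_lia.
have -> : swap_idx (tauI n i) (swap_idx i (n.+2 - k)%N) = (n.+2 - swap_idx i k)%N.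
  by rewrite /swap_idx /tauI; idx_lia.
by apply: Hx; rewrite /swap_idx; idx_lia.
Qed.

End Theta.
End Weights.

(** * Iterated q-commutators *)

Section Chains.
Variables (F : fieldType) (A : algType F) (s : F).
Implicit Types (u v w y : A) (x : nat -> A).

(** The quantum Serre relation, solved for its monomial [u * u * v] so that it can serve as a
    rewriting rule. It is symmetric in s and s^-1; s is q for the F_i and the B_i, and q^-1 for the
    E_i. *)
Definition serre u v := u * u * v = (s + s^-1) *: (u * v * u) - v * u * u.

Lemma serreP u v : serre u v -> v * u * u = (s + s^-1) *: (u * v * u) - u * u * v.
Proof. by move=> ->; rewrite opprB addrC subrK. Qed.

Lemma qbrC u v w : u * v = v * u -> u * w = w * u -> u * qbr v w s = qbr v w s * u.
Proof. by move=> E1 E2; nc (tt, E1, E2). Qed.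

Lemma qbr_qcommr u v w (c : F) : u * v = v * u -> u * w = c *: (w * u) ->
  u * qbr v w s = c *: (qbr v w s * u).
Proof. by move=> E1 E2; nc (tt, E1, E2). Qed.

Lemma qbr_qcomml u v w (c : F) : u * v = c *: (v * u) -> u * w = w * u ->
  u * qbr v w s = c *: (qbr v w s * u).
Proof. by move=> E1 E2; nc (tt, E1, E2). Qed.

Lemma qbrA u v w : u * w = w * u -> qbr (qbr u v s) w s = qbr u (qbr v w s) s.
Proof. by move=> E; nc (tt, E). Qed.

Definition qchain x (l : seq nat) y := foldr (fun j acc => qbr (x j) acc s) y l.

Lemma eq_qchain x x' l y y' : {in l, x =1 x'} -> y = y' ->
  qchain x l y = qchain x' l y'.
Proof.
move=> Hl ->; elim: l Hl => [|j l IH] Hl //=.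
by rewrite Hl ?mem_head // IH // => k Hk; apply: Hl; rewrite in_cons Hk orbT.
Qed.

Lemma qchain_cat x l1 l2 y : qchain x (l1 ++ l2) y = qchain x l1 (qchain x l2 y).
Proof. by rewrite /qchain foldr_cat. Qed.

Lemma qchain_comm x l y w : (forall j, j \in l -> w * x j = x j * w) ->
  w * y = y * w -> w * qchain x l y = qchain x l y * w.
Proof.
move=> Hl Hy; elim: l Hl => [|j l IH] Hl //=.
apply: qbrC; first by apply: Hl; rewrite mem_head.
by apply: IH => k Hk; apply: Hl; rewrite in_cons Hk orbT.
Qed.

Lemma qchain_qcomm x l y w (c : F) : (forall j, j \in l -> w * x j = x j * w) ->
  w * y = c *: (y * w) -> w * qchain x l y = c *: (qchain x l y * w).
Proof.
move=> Hl Hy; elim: l Hl => [|j l IH] Hl //=.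
apply: qbr_qcommr; first by apply: Hl; rewrite mem_head.
by apply: IH => k Hk; apply: Hl; rewrite in_cons Hk orbT.
Qed.

Lemma qchain_qbr x l y w : (forall j, j \in l -> x j * w = w * x j) ->
  qbr (qchain x l y) w s = qchain x l (qbr y w s).
Proof.
elim: l => [|j l IH] Hl //=.
rewrite qbrA; last by apply: Hl; rewrite mem_head.
by rewrite IH // => k Hk; apply: Hl; rewrite in_cons Hk orbT.
Qed.

(** The shape of E_X^- and F_X^-, as [chain] below is that of E_X^+ and F_X^+. The length [l] counts
    the commutators, one less than the number of indices. *)
Definition dchain x i l := qchain x (rev (iota i.+1 l)) (x i).

Lemma dchain0 x i : dchain x i 0 = x i.
Proof. by []. Qed.

Lemma dchain_rcons x i l : dchain x i l.+1 = qbr (x (i + l.+1)%N) (dchain x i l) s.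
Proof. by rewrite /dchain -{1}[l.+1]addn1 iotaD rev_cat /= addSnnS. Qed.

Lemma dchainS x i l :
  (forall j, (i.+1 < j <= i + l.+1)%N -> x j * x i = x i * x j) ->
  dchain x i l.+1 = qbr (dchain x i.+1 l) (x i) s.
Proof.
move=> H; rewrite /dchain [iota _ l.+1]/= rev_cons -cats1 qchain_cat qchain_qbr //.
by move=> j; rewrite mem_rev mem_iota => Hj; apply: H; lia.
Qed.

Lemma dchain_comm x i l w : (forall j, (i <= j <= i + l)%N -> w * x j = x j * w) ->
  w * dchain x i l = dchain x i l * w.
Proof.
move=> H; apply: qchain_comm => [j|]; last by apply: H; lia.
by rewrite mem_rev mem_iota => Hj; apply: H; lia.
Qed.

Definition chain x i l := qchain x (iota i l) (x (i + l)%N).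

Lemma chain0 x i : chain x i 0 = x i.
Proof. by rewrite /chain addn0. Qed.

Lemma chainS x i l : chain x i l.+1 = qbr (x i) (chain x i.+1 l) s.
Proof. by rewrite /chain /= addSnnS. Qed.

Lemma chain_comm x i l w : (forall j, (i <= j <= i + l)%N -> w * x j = x j * w) ->
  w * chain x i l = chain x i l * w.
Proof.
move=> H; apply: qchain_comm => [j|]; last by apply: H; lia.
by rewrite mem_iota => Hj; apply: H; lia.
Qed.

Lemma dchain_qcommr x i l w (c : F) :
  (forall j, (i <= j < i + l)%N -> w * x j = x j * w) ->
  w * x (i + l)%N = c *: (x (i + l)%N * w) -> w * dchain x i l = c *: (dchain x i l * w).
Proof.
case: l => [|l] H H'; first by move: H'; rewrite addn0.
by rewrite dchain_rcons; apply: qbr_qcomml => //; apply: dchain_comm => j Hj; apply: H; lia.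
Qed.

Lemma chain_qcommr x i l w (c : F) :
  (forall j, (i <= j < i + l)%N -> w * x j = x j * w) ->
  w * x (i + l)%N = c *: (x (i + l)%N * w) -> w * chain x i l = c *: (chain x i l * w).
Proof.
by move=> H H'; apply: qchain_qcomm => // j; rewrite mem_iota => Hj; apply: H.
Qed.

Lemma chain_qcomml x i l w (c : F) :
  (forall j, (i < j <= i + l)%N -> w * x j = x j * w) ->
  w * x i = c *: (x i * w) -> w * chain x i l = c *: (chain x i l * w).
Proof.
case: l => [|l] H H'; first by rewrite chain0.
rewrite chainS; apply: qbr_qcomml => //; apply: chain_comm => j Hj; apply: H; lia.
Qed.


Set Default Proof Using "All".
Hypotheses (s_neq0 : s != 0) (s2_neq0 : s ^+ 2 + 1 != 0).
(** For this parameter the Serre relation is the same as q-commutation of [u] with its bracket;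
    [qcomm_serre] is the converse. *)
Lemma serre_left u v : serre u v -> u * qbr u v s = s^-1 *: (qbr u v s * u).
Proof. by move=> E; nc (tt, E). Qed.

Lemma serre_right u v : serre u v -> qbr v u s * u = s^-1 *: (u * qbr v u s).
Proof. by move=> /serreP E; nc (tt, E). Qed.

Lemma serre_qbrr u v w : serre u v -> u * w = w * u -> serre u (qbr v w s).
Proof. by move=> E1 E2; rewrite /serre; nc (tt, E1, E2). Qed.

Lemma serre_qbrl u v w : serre u v -> u * w = w * u -> serre u (qbr w v s).
Proof. by move=> E1 E2; rewrite /serre; nc (tt, E1, E2). Qed.

Lemma qcomm_serre u v : u * qbr u v s = s^-1 *: (qbr u v s * u) -> serre u v.
Proof.
move=> E; rewrite /serre.
transitivity (u * qbr u v s + s *: (u * v * u)); first by nc tt.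
by rewrite E; nc tt.
Qed.

(** The rank three fact that the middle generator commutes with the root vector of the highest root.
    Multiplied by s + s^-1, the commutator is a combination of the Serre elements [D1] and [D2], and
    s^2 + 1 != 0 allows the division. *)
Lemma serre_interior u v w : serre u v -> serre u w -> v * w = w * v ->
  u * qbr v (qbr u w s) s = qbr v (qbr u w s) s * u.
Proof.
move=> E1 E2 E3; apply/(@scalerI _ _ (s + s^-1)).
  apply: contraNneq s2_neq0 => /(congr1 ( *%R s)).
  by rewrite mulr0 mulrDr divff // -expr2 => ->.
pose D1 := u * u * v - ((s + s^-1) *: (u * v * u) - v * u * u).
pose D2 := u * u * w - ((s + s^-1) *: (u * w * u) - w * u * u).
have D10 : D1 = 0 by rewrite /D1 E1 subrr.
have D20 : D2 = 0 by rewrite /D2 E2 subrr.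
apply/subr0_eq.
transitivity (s ^+ 2 *: (w * D1) - D1 * w + v * D2 - s ^+ 2 *: (D2 * v)).
  rewrite /D1 /D2.
  nc (tt, E3).
by rewrite D10 D20 !mul0r !mulr0 !scaler0 !addr0 ?oppr0 ?addr0.
Qed.

(** The companion of [serre_interior], for the root vectors of the two sums of adjacent simple roots
    in rank three; the same division by s + s^-1 is made. *)
Lemma serre_comm u v w : serre u v -> serre u w -> v * w = w * v ->
  qbr u v s * qbr u w s = qbr u w s * qbr u v s.
Proof.
move=> E1 E2 E3; apply/(@scalerI _ _ (s + s^-1)).
  apply: contraNneq s2_neq0 => /(congr1 ( *%R s)).
  by rewrite mulr0 mulrDr divff // -expr2 => ->.
pose D1 := u * u * v - ((s + s^-1) *: (u * v * u) - v * u * u).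
pose D2 := u * u * w - ((s + s^-1) *: (u * w * u) - w * u * u).
have D10 : D1 = 0 by rewrite /D1 E1 subrr.
have D20 : D2 = 0 by rewrite /D2 E2 subrr.
apply/subr0_eq.
transitivity (s ^+ 2 *: (w * D1) - D1 * w + D2 * v - s ^+ 2 *: (v * D2)).
  by rewrite /D1 /D2; nc (tt, E3).
by rewrite D10 D20 !mul0r !mulr0 !scaler0 !addr0 ?oppr0 ?addr0.
Qed.

(** * Root vectors in a family with the relations of type A *)

Section Family.
Variables (x : nat -> A) (lo hi : nat).
Hypotheses (x_far : forall i j, (lo <= i)%N -> (i.+1 < j)%N -> (j <= hi)%N ->
                      x i * x j = x j * x i)
  (x_serre : forall i, (lo <= i)%N -> (i < hi)%N ->
               serre (x i) (x i.+1) /\ serre (x i.+1) (x i)).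

(** Brackets are reassociated by [qbrA]: the first member of the chain is far from the new last one
    and commutes with it. *)
Lemma chain_rcons i l : (lo <= i)%N -> (i + l.+1 <= hi)%N ->
  chain x i l.+1 = qbr (chain x i l) (x (i + l.+1)%N) s.
Proof.
elim: l i => [|l IH] i lo_i i_hi; first by rewrite chainS !chain0 addn1.
rewrite chainS IH; try lia.
by rewrite [chain x i _]chainS qbrA ?addSnnS //; apply: x_far; lia.
Qed.

Lemma chain_serrel i l : (lo <= i)%N -> (i + l.+1 <= hi)%N ->
  serre (x i) (chain x i.+1 l).
Proof.
case: l => [|l] lo_i i_hi; first by rewrite chain0; have [] := x_serre lo_i ltac:(lia).
rewrite chainS; apply: serre_qbrr; first by have [] := x_serre lo_i ltac:(lia).
by apply: chain_comm => j Hj; apply: x_far; lia.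
Qed.

Lemma chain_serrer i l : (lo <= i)%N -> (i + l.+1 <= hi)%N ->
  serre (x (i + l.+1)%N) (chain x i l).
Proof.
elim: l i => [|l IH] i lo_i i_hi.
  by rewrite chain0 addn1; have [] := x_serre lo_i ltac:(lia).
rewrite chainS -addSnnS; apply: serre_qbrl; first by apply: IH; lia.
by symmetry; apply: x_far; lia.
Qed.

Lemma chain_left i l : (lo <= i)%N -> (i + l.+1 <= hi)%N ->
  x i * chain x i l.+1 = s^-1 *: (chain x i l.+1 * x i).
Proof. by move=> lo_i i_hi; rewrite chainS; apply/serre_left/chain_serrel. Qed.

Lemma chain_right i l : (lo <= i)%N -> (i + l.+1 <= hi)%N ->
  chain x i l.+1 * x (i + l.+1)%N = s^-1 *: (x (i + l.+1)%N * chain x i l.+1).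
Proof.
by move=> lo_i i_hi; rewrite chain_rcons //; apply/serre_right/chain_serrer.
Qed.

(** The second member is handled by [serre_interior]; for a later one the first member of the chain
    is peeled off, since it is far from [x j]. *)
Lemma chain_interior i l j : (lo <= i)%N -> (i + l <= hi)%N -> (i < j < i + l)%N ->
  x j * chain x i l = chain x i l * x j.
Proof.
elim: l i => [|l IH] i lo_i i_hi; first by lia.
rewrite leq_eqVlt => /andP[/orP[/eqP<-|ij] jl].
  case: l {IH} i_hi jl => [|l] i_hi jl; first by lia.
  rewrite !chainS; apply: serre_interior.
  - by have [] := x_serre lo_i ltac:(lia).
  - by apply: chain_serrel; lia.
  - by apply: chain_comm => k Hk; apply: x_far; lia.
rewrite chainS; apply: qbrC; last by apply: IH; lia.
by symmetry; apply: x_far; lia.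
Qed.

Lemma chain_tail i l : (lo <= i)%N -> (i + l.+1 <= hi)%N ->
  chain x i l.+1 * chain x i.+1 l = s^-1 *: (chain x i.+1 l * chain x i l.+1).
Proof.
move=> lo_i i_hi; apply: chain_qcommr => [j Hj|].
  by rewrite chain_interior //; lia.
by rewrite addSnnS chain_right.
Qed.

Lemma chain_init i l : (lo <= i)%N -> (i + l.+1 <= hi)%N ->
  chain x i l * chain x i l.+1 = s^-1 *: (chain x i l.+1 * chain x i l).
Proof.
move=> lo_i i_hi.
suff -> : chain x i l.+1 * chain x i l = s *: (chain x i l * chain x i l.+1).
  by rewrite scalerA mulVf // scale1r.
apply: chain_qcomml => [j Hj|]; first by rewrite chain_interior //; lia.
by rewrite chain_left // scalerA divff // scale1r.
Qed.

(** The chain can play the part of a simple generator: its q-commutation with the chain longer by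
    one is the Serre relation in disguise. *)
Lemma chain_serre_tail i l : (lo <= i)%N -> (i + l.+1 <= hi)%N ->
  serre (chain x i l) (x (i + l.+1)%N).
Proof.
by move=> lo_i i_hi; apply: qcomm_serre; rewrite -chain_rcons // chain_init.
Qed.

End Family.
End Chains.
Unset Default Proof Using.

Definition root (i j k : nat) : int := (k == i)%:Z - (k == j)%:Z.

Lemma inv_sqr_add1_neq0 (F : fieldType) (q : F) :
  q != 0 -> q ^+ 2 + 1 != 0 -> q^-1 ^+ 2 + 1 != 0.
Proof.
move=> q0; apply: contraNneq => /(congr1 ( *%R (q ^+ 2))).
by rewrite mulr0 mulrDr mulr1 exprVn (mulfV (expf_neq0 2 q0)) => H; rewrite addrC H.
Qed.

(** * Relations in the quantum group and between the B_j *)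

Section UqRelations.
Set Default Proof Using "All".
Variables (F : fieldType) (A : algType F) (n : nat) (t : F).
Variables (E Fg : nat -> A) (Kw : weight n -> A).
Local Notation q := (qq t).
Local Notation nu := ((q - q^-1)^-1).
Local Notation Kx x := (Kw (wt n x)).
Hypotheses (q_neq0 : q != 0) (q2_neq1 : q ^+ 2 - 1 != 0) (q2_neqN1 : q ^+ 2 + 1 != 0).
Hypothesis rels : Uq_rels t E Fg Kw.

Let qV_neq0 : q^-1 != 0. Proof. by rewrite invr_eq0. Qed.
Let qV2_neqN1 : q^-1 ^+ 2 + 1 != 0.
Proof. exact: inv_sqr_add1_neq0. Qed.

Lemma Kw_0 : Kw 0 = 1. Proof. by case: rels. Qed.
Lemma Kw_D mu la : Kw (mu + la) = Kw mu * Kw la.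
Proof. by case: rels => _ []. Qed.
Lemma Kw_comm mu la : Kw mu * Kw la = Kw la * Kw mu.
Proof. by rewrite -!Kw_D addrC. Qed.
Lemma Kw_V mu : Kw mu * Kw (- mu) = 1.
Proof. by rewrite -Kw_D subrr Kw_0. Qed.
Lemma Kw_V' mu : Kw (- mu) * Kw mu = 1.
Proof. by rewrite -Kw_D addNr Kw_0. Qed.

(** The exponent is a variable tied to [x] by an equation, so that each instance reduces to linear
    integer arithmetic. *)
Lemma KE x z i : inI n i -> x i - x i.+1 = z ->
  Kx x * E i = q ^ z *: (E i * Kx x).
Proof. by case: rels => _ [_ [H _]] Hi <-; rewrite H // wc_wt. Qed.
Lemma KF x z i : inI n i -> x i - x i.+1 = - z ->
  Kx x * Fg i = q ^ z *: (Fg i * Kx x).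
Proof. by case: rels => _ [_ [_ [H _]]] Hi Hz; rewrite H // wc_wt // Hz opprK. Qed.

Lemma KE_chain x z i l : (0 < i)%N -> (i + l <= n)%N -> x i - x (i + l).+1 = z ->
  Kx x * chain q^-1 E i l = q ^ z *: (chain q^-1 E i l * Kx x).
Proof.
elim: l i z => [|l IH] i z i0 iln; first by rewrite chain0 addn0; apply: KE; rewrite /inI; lia.
rewrite -addSnnS chainS => Hz.
have H1 := @KE x (x i - x i.+1) i ltac:(rewrite /inI; lia) erefl.
have H2 := IH i.+1 _ isT ltac:(lia) erefl.
rewrite (_ : z = (x i - x i.+1) + (x i.+1 - x (i.+1 + l).+1)); last by lia.
by rewrite expfzDr //; nc (tt, H1, H2).
Qed.

Lemma KE_dchain x z i l : (0 < i)%N -> (i + l <= n)%N -> x i - x (i + l).+1 = z ->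
  Kx x * dchain q^-1 E i l = q ^ z *: (dchain q^-1 E i l * Kx x).
Proof.
move=> i0; elim: l z => [|l IH] z iln; first by rewrite dchain0 addn0; apply: KE; rewrite /inI; lia.
rewrite dchain_rcons => Hz.
have H1 := @KE x _ (i + l.+1) ltac:(rewrite /inI; lia) erefl.
have H2 := IH _ ltac:(lia) erefl.
rewrite (_ : z = (x (i + l.+1)%N - x (i + l.+1).+1) + (x i - x (i + l).+1)); last first.
  by rewrite -Hz addnS; lia.
by rewrite expfzDr //; nc (tt, H1, H2).
Qed.

Lemma KF_chain x z i l : (0 < i)%N -> (i + l <= n)%N -> x i - x (i + l).+1 = - z ->
  Kx x * chain q Fg i l = q ^ z *: (chain q Fg i l * Kx x).
Proof.
elim: l i z => [|l IH] i z i0 iln; first by rewrite chain0 addn0; apply: KF; rewrite /inI; lia.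
rewrite -addSnnS chainS => Hz.
have H1 := @KF x (x i.+1 - x i) i ltac:(rewrite /inI; lia) ltac:(lia).
have H2 := IH i.+1 (x (i.+1 + l).+1 - x i.+1) isT ltac:(lia) ltac:(lia).
rewrite (_ : z = (x i.+1 - x i) + (x (i.+1 + l).+1 - x i.+1)); last by lia.
by rewrite expfzDr //; nc (tt, H1, H2).
Qed.

Lemma EF_neq i j : inI n i -> inI n j -> i != j -> E i * Fg j = Fg j * E i.
Proof.
case: rels => _ [_ [_ [_ [H _]]]] Hi Hj ij; apply/subr0_eq.
by rewrite H // (negbTE ij).
Qed.

Lemma Ki_wt i : inI n i -> Ki Kw i = Kx (root i i.+1).
Proof. by move=> Hi; rewrite /Ki sroot_wt. Qed.
Lemma Kinv_wt i : inI n i -> Kinv Kw i = Kx (root i.+1 i).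
Proof. by move=> Hi; rewrite /Kinv sroot_wt // wtN; congr Kw; apply: eq_wt => k _; rewrite /root; lia. Qed.

Lemma EF_eq i : inI n i ->
  E i * Fg i = Fg i * E i + nu *: (Kx (root i i.+1) - Kx (root i.+1 i)).
Proof.
case: rels => _ [_ [_ [_ [H _]]]] Hi.
by rewrite -Ki_wt // -Kinv_wt //; have := H i i Hi Hi; rewrite eqxx => <-; rewrite addrC subrK.
Qed.

Lemma far_comm i j : inI n i -> inI n j -> ((i.+1 < j) || (j.+1 < i))%N ->
  E i * E j = E j * E i /\ Fg i * Fg j = Fg j * Fg i.
Proof.
case: rels => _ [_ [_ [_ [_ [_ H]]]]] Hi Hj ij; apply: H => //.
by rewrite /cartan; idx_lia.
Qed.

Lemma adj_serre i j : inI n i -> inI n j -> (i.+1 == j) || (j.+1 == i) ->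
  serre q^-1 (E i) (E j) /\ serre q (Fg i) (Fg j).
Proof.
case: rels => _ [_ [_ [_ [_ [H _]]]]] Hi Hj ij.
have [] := H i j Hi Hj; first by rewrite /cartan; idx_lia.
rewrite /serre invrK [q^-1 + q]addrC => H1 H2; split.
  by apply/eqP; rewrite -subr_eq0 opprB addrCA addrC H1.
by apply/eqP; rewrite -subr_eq0 opprB addrCA addrC H2.
Qed.

Lemma E_far i j : (0 < i)%N -> (i.+1 < j)%N -> (j <= n)%N -> E i * E j = E j * E i.
Proof. by move=> i0 ij jn; case: (@far_comm i j) => //; rewrite /inI; lia. Qed.
Lemma F_far i j : (0 < i)%N -> (i.+1 < j)%N -> (j <= n)%N -> Fg i * Fg j = Fg j * Fg i.
Proof. by move=> i0 ij jn; case: (@far_comm i j) => //; rewrite /inI; lia. Qed.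
Lemma E_serre i : (0 < i)%N -> (i < n)%N ->
  serre q^-1 (E i) (E i.+1) /\ serre q^-1 (E i.+1) (E i).
Proof.
move=> i0 jn; split; first by case: (@adj_serre i i.+1) => //; rewrite /inI; lia.
by case: (@adj_serre i.+1 i) => //; rewrite /inI; lia.
Qed.
Lemma F_serre i : (0 < i)%N -> (i < n)%N ->
  serre q (Fg i) (Fg i.+1) /\ serre q (Fg i.+1) (Fg i).
Proof.
move=> i0 jn; split; first by case: (@adj_serre i i.+1) => //; rewrite /inI; lia.
by case: (@adj_serre i.+1 i) => //; rewrite /inI; lia.
Qed.

Lemma chainE_F_left i l : (0 < i)%N -> (i + l.+1 <= n)%N ->
  chain q^-1 E i l.+1 * Fg i
  = Fg i * chain q^-1 E i l.+1 - chain q^-1 E i.+1 l * Kx (root i.+1 i).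
Proof.
move=> i0 iln; rewrite chainS.
have H1 : chain q^-1 E i.+1 l * Fg i = Fg i * chain q^-1 E i.+1 l.
  by symmetry; apply: chain_comm => j Hj; rewrite EF_neq //; rewrite /inI; lia.
have H2 := @EF_eq i ltac:(rewrite /inI; lia).
have H3 := @KE_chain (root i i.+1) (-1) i.+1 l isT ltac:(lia) ltac:(rewrite /root; lia).
have H4 := @KE_chain (root i.+1 i) 1 i.+1 l isT ltac:(lia) ltac:(rewrite /root; lia).
move: H3 H4; rewrite exprN1 expr1z => H3 H4.
by nc (tt, H1, H2, H3, H4).
Qed.

Lemma chainE_F_right i l : (0 < i)%N -> (i + l.+1 <= n)%N ->
  chain q^-1 E i l.+1 * Fg (i + l.+1)
  = Fg (i + l.+1) * chain q^-1 E i l.+1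
    + q^-1 *: (chain q^-1 E i l * Kx (root (i + l.+1) (i + l.+1).+1)).
Proof.
move=> i0 iln; rewrite (chain_rcons qV_neq0 qV2_neqN1 E_far E_serre) //.
have H1 : chain q^-1 E i l * Fg (i + l.+1) = Fg (i + l.+1) * chain q^-1 E i l.
  by symmetry; apply: chain_comm => j Hj; rewrite EF_neq //; rewrite /inI; lia.
have H2 := @EF_eq (i + l.+1) ltac:(rewrite /inI; lia).
have H3 := @KE_chain (root (i + l.+1) (i + l.+1).+1) (-1) i l i0 ltac:(lia) ltac:(rewrite /root; lia).
have H4 := @KE_chain (root (i + l.+1).+1 (i + l.+1)) 1 i l i0 ltac:(lia) ltac:(rewrite /root; lia).
move: H3 H4; rewrite exprN1 expr1z => H3 H4.
by nc (tt, H1, H2, H3, H4).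
Qed.

(** For the second index the correction of [chainE_F_left] is bracketed with E_i, which commutes
    with the shorter chain and picks up a factor q from the torus element; this factor annihilates
    the q^-1-commutator. *)
Lemma chainE_F_interior i l j : (0 < i)%N -> (i + l <= n)%N -> (i < j < i + l)%N ->
  Fg j * chain q^-1 E i l = chain q^-1 E i l * Fg j.
Proof.
elim: l i => [|l IH] i i0 iln; first by lia.
rewrite leq_eqVlt => /andP[/orP[/eqP<-|ij] jl]; last first.
  rewrite chainS; apply: qbrC; last by apply: IH; lia.
  by rewrite EF_neq //; rewrite /inI; lia.
case: l {IH} iln jl => [|l] iln jl; first by lia.
rewrite chainS.
have H1 := @EF_neq i i.+1 ltac:(rewrite /inI; lia) ltac:(rewrite /inI; lia) ltac:(lia).
have H2 := @chainE_F_left i.+1 l isT ltac:(lia).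
have H3 : E i * chain q^-1 E i.+2 l = chain q^-1 E i.+2 l * E i.
  by apply: chain_comm => k Hk; rewrite E_far //; lia.
have H4 := @KE (root i.+2 i.+1) 1 i ltac:(rewrite /inI; lia) ltac:(rewrite /root; lia).
move: H4; rewrite expr1z => H4.
by nc (tt, H1, H2, H3, H4).
Qed.

(** Opposite root vectors of the highest root of an interval. The orders of nesting are opposite, so
    that the outermost F_i on one side faces an outermost E_i on the other; the induction strips
    both. *)
Lemma sl2_chain i l : (0 < i)%N -> (i + l <= n)%N ->
  dchain q^-1 E i l * chain q Fg i l
  = chain q Fg i l * dchain q^-1 E i l + nu *: (Kx (root i (i + l).+1) - Kx (root (i + l).+1 i)).
Proof.
elim: l i => [|l IH] i i0 iln.
  by rewrite chain0 /dchain /= EF_eq ?addn0 // /inI; lia.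
rewrite chainS dchainS; last by move=> j Hj; symmetry; apply: E_far; lia.
rewrite -addSnnS; set m := (i.+1 + l).+1.
have H1 := IH i.+1 isT ltac:(lia).
rewrite -/m in H1.
have H2 := @EF_eq i ltac:(rewrite /inI; lia).
have H3 : dchain q^-1 E i.+1 l * Fg i = Fg i * dchain q^-1 E i.+1 l.
  by symmetry; apply: dchain_comm => j Hj; rewrite EF_neq //; rewrite /inI; lia.
have H4 : E i * chain q Fg i.+1 l = chain q Fg i.+1 l * E i.
  by apply: chain_comm => j Hj; rewrite EF_neq //; rewrite /inI; lia.
have K1 := @KE (root i.+1 m) (-1) i ltac:(rewrite /inI; lia) ltac:(rewrite /root /m; lia).
have K2 := @KE (root m i.+1) 1 i ltac:(rewrite /inI; lia) ltac:(rewrite /root /m; lia).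
have K3 := @KF (root i.+1 m) 1 i ltac:(rewrite /inI; lia) ltac:(rewrite /root /m; lia).
have K4 := @KF (root m i.+1) (-1) i ltac:(rewrite /inI; lia) ltac:(rewrite /root /m; lia).
have K5 := @KE_dchain (root i i.+1) (-1) i.+1 l isT ltac:(lia) ltac:(rewrite /root; lia).
have K6 := @KE_dchain (root i.+1 i) 1 i.+1 l isT ltac:(lia) ltac:(rewrite /root; lia).
have K7 := @KF_chain (root i i.+1) 1 i.+1 l isT ltac:(lia) ltac:(rewrite /root; lia).
have K8 := @KF_chain (root i.+1 i) (-1) i.+1 l isT ltac:(lia) ltac:(rewrite /root; lia).
have K9 := Kw_comm (wt n (root i i.+1)) (wt n (root i.+1 m)).
have K11 := Kw_comm (wt n (root i i.+1)) (wt n (root m i.+1)).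
have K12 := Kw_comm (wt n (root i.+1 i)) (wt n (root i.+1 m)).
have K10 := Kw_comm (wt n (root i.+1 i)) (wt n (root m i.+1)).
have Ex : Kx (root i m) = Kx (root i.+1 m) * Kx (root i i.+1).
  by rewrite -Kw_D wtD; congr Kw; apply: eq_wt => k _; rewrite /root; lia.
have ExN : Kx (root m i) = Kx (root m i.+1) * Kx (root i.+1 i).
  by rewrite -Kw_D wtD; congr Kw; apply: eq_wt => k _; rewrite /root; lia.
rewrite Ex ExN; rewrite ?exprN1 ?expr1z in K1 K2 K3 K4 K5 K6 K7 K8.
by nc (tt, H1, H2, H3, H4, K1, K2, K3, K4, K5, K6, K7, K8, K9, K10, K11, K12).
Qed.

(** * The generators B_r and B_i with i < r *)

Section BGenerators.
Variables r l : nat.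
Hypotheses (r_gt0 : (0 < r)%N) (n_eq : n = (r + r + l.+1)%N).

Local Ltac inI_lia := rewrite /inI /tauI; lia.
Local Ltac root_lia := rewrite /root /tauI; lia.

Local Notation ta := (tauI n).
Local Notation e := (chain q^-1 E r.+1 l.+1).
(** Here [E_X^+, E_{tau(r)}]_{q^-1} is written as a single chain from r+1 to tau(r), as
    [chain_rcons] allows; the number of elements of X is l+1. *)
Definition Br (c : F) : A := Fg r - c *: (e * Kx (root r.+1 r)).
Definition Bi (i : nat) (c : F) : A := Fg i - c *: (E (ta i) * Kx (root i.+1 i)).

Lemma Kx_comm x y : Kx x * Kx y = Kx y * Kx x.
Proof. exact: @Kw_comm _ _. Qed.

(** The second condition is invariance under Theta at position r: it gives the two summands of B_r
    the same power of q. *)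
Lemma KBr x z c : x r.+1 - x r = z -> x r = x (r.+1 + l.+1).+1 ->
  Kx x * Br c = q ^ z *: (Br c * Kx x).
Proof.
move=> Hz Hx.
have H1 := @KF x z r ltac:(inI_lia) ltac:(lia).
have H2 := @KE_chain x z r.+1 l.+1 isT ltac:(lia) ltac:(lia).
have H3 := Kx_comm x (root r.+1 r).
by rewrite /Br; nc (tt, H1, H2, H3).
Qed.

Lemma KBi i x z c : (0 < i < r)%N -> x i.+1 - x i = z -> x i = x (ta i).+1 ->
  x i.+1 = x (ta i) -> Kx x * Bi i c = q ^ z *: (Bi i c * Kx x).
Proof.
move=> Hi Hz Hx Hx'.
have H1 := @KF x z i ltac:(inI_lia) ltac:(lia).
have H2 := @KE x z (ta i) ltac:(inI_lia) ltac:(lia).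
have H3 := Kx_comm x (root i.+1 i).
by rewrite /Bi; nc (tt, H1, H2, H3).
Qed.

Lemma Br_E c j : (r < j <= r.+1 + l)%N -> Br c * E j = E j * Br c.
Proof.
move=> Hj.
have H1 := @EF_neq j r ltac:(inI_lia) ltac:(inI_lia) ltac:(lia).
(* Only E_{r+1} fails to commute with [e]; its factor q is compensated by the one from K_r^{-1}. *)
pose z : int := (j == r.+1)%:Z.
have H2 := @KE (root r.+1 r) z j ltac:(inI_lia) ltac:(rewrite /z; root_lia).
have H3 : E j * e = q ^ z *: (e * E j).
  rewrite /z; case: eqP => [->|jp].
    rewrite (chain_left qV_neq0 qV2_neqN1 E_far E_serre) //; last by lia.
    by rewrite invrK expr1z.
  rewrite (chain_interior qV_neq0 qV2_neqN1 E_far E_serre) //; try lia.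
  by rewrite expr0z scale1r.
by rewrite /Br; nc (tt, H1, H2, H3).
Qed.

Lemma Br_F c j : (r.+1 < j <= r.+1 + l)%N -> Br c * Fg j = Fg j * Br c.
Proof.
move=> Hj.
have H1 := @F_far r j r_gt0 ltac:(lia) ltac:(lia).
have H2 := @KF (root r.+1 r) 0 j ltac:(inI_lia) ltac:(root_lia).
have H3 := @chainE_F_interior r.+1 l.+1 j isT ltac:(lia) ltac:(lia).
rewrite expr0z in H2.
by rewrite /Br; nc (tt, H1, H2, esym H3).
Qed.

Lemma Br_serre c : serre q (Br c) (Fg r.+1) /\ serre q (Fg r.+1) (Br c).
Proof.
have [S1 S2] := @F_serre r r_gt0 ltac:(lia).
(* F_{r+1} meets [e] only at its left end; [w] is the chain that remains when E_{r+1} is contracted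
   against it. *)
pose w := chain q^-1 E r.+2 l; pose ki := Kx (root r.+2 r.+1); pose kr := Kx (root r.+1 r).
have H1 : e * Fg r.+1 = Fg r.+1 * e - w * ki.
  by apply: chainE_F_left => //; lia.
have H2 : e * w = q *: (w * e).
  rewrite (chain_tail qV_neq0 qV2_neqN1 E_far E_serre) ?invrK //; lia.
have H3 : e * Fg r = Fg r * e.
  by symmetry; apply: chain_comm => j Hj; rewrite EF_neq //; inI_lia.
have H4 : w * Fg r = Fg r * w.
  by symmetry; apply: chain_comm => j Hj; rewrite EF_neq //; inI_lia.
have H5 : w * Fg r.+1 = Fg r.+1 * w.
  by symmetry; apply: chain_comm => j Hj; rewrite EF_neq //; inI_lia.
have K1 : kr * Fg r = q ^+ 2 *: (Fg r * kr).
  by apply: (@KF _ 2); [inI_lia|root_lia].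
have K2 : kr * Fg r.+1 = q^-1 *: (Fg r.+1 * kr).
  by apply: (@KF _ (-1)); [inI_lia|root_lia].
have K3 : kr * e = q *: (e * kr).
  by apply: (@KE_chain _ 1); [|lia|root_lia].
have K4 : kr * w = 1 *: (w * kr).
  by apply: (@KE_chain _ 0); [|lia|root_lia].
have K5 : ki * Fg r = q^-1 *: (Fg r * ki).
  by apply: (@KF _ (-1)); [inI_lia|root_lia].
have K6 : ki * e = q^-1 *: (e * ki).
  by apply: (@KE_chain _ (-1)); [|lia|root_lia].
have K7 : ki * Fg r.+1 = q ^+ 2 *: (Fg r.+1 * ki).
  by apply: (@KF _ 2); [inI_lia|root_lia].
have K8 : ki * kr = kr * ki by apply: Kx_comm.
rewrite /serre /Br -/kr; split.
  by nc (tt, S1, H1, H2, H3, H4, K1, K2, K3, K4, K5, K6, K8).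
by nc (tt, S2, H1, H3, H5, K2, K7, K8).
Qed.

Lemma Bi_E i c j : (0 < i < r)%N -> (r < j <= r.+1 + l)%N ->
  Bi i c * E j = E j * Bi i c.
Proof.
move=> Hi Hj.
have H1 := @EF_neq j i ltac:(inI_lia) ltac:(inI_lia) ltac:(lia).
have H2 := @KE (root i.+1 i) 0 j ltac:(inI_lia) ltac:(root_lia).
have H3 := @E_far j (ta i) ltac:(lia) ltac:(rewrite /tauI; lia) ltac:(rewrite /tauI; lia).
rewrite expr0z in H2.
by rewrite /Bi; nc (tt, H1, H2, H3).
Qed.

Lemma Bi_F i c j : (0 < i < r)%N -> (r < j <= r.+1 + l)%N ->
  Bi i c * Fg j = Fg j * Bi i c.
Proof.
move=> Hi Hj.
have H1 := @EF_neq (ta i) j ltac:(inI_lia) ltac:(inI_lia) ltac:(rewrite /tauI; lia).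
have H2 := @KF (root i.+1 i) 0 j ltac:(inI_lia) ltac:(root_lia).
have H3 := @F_far i j ltac:(lia) ltac:(lia) ltac:(lia).
rewrite expr0z in H2.
by rewrite /Bi; nc (tt, H1, H2, H3).
Qed.

Lemma Bi_Br_comm i c c' : (0 < i)%N -> (i.+1 < r)%N -> Bi i c * Br c' = Br c' * Bi i c.
Proof.
move=> i0 Hi.
have H1 := @EF_neq (ta i) r ltac:(inI_lia) ltac:(inI_lia) ltac:(rewrite /tauI; lia).
have H2 := @KF (root i.+1 i) 0 r ltac:(inI_lia) ltac:(root_lia).
have H3 := @F_far i r ltac:(lia) ltac:(lia) ltac:(lia).
have H4 : Fg i * e = e * Fg i.
  by apply: chain_comm => j Hj; rewrite EF_neq //; inI_lia.
have H5 : E (ta i) * e = e * E (ta i).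
  by apply: chain_comm => j Hj; symmetry; apply: E_far; rewrite /tauI; lia.
have H6 := @KE_chain (root i.+1 i) 0 r.+1 l.+1 isT ltac:(lia) ltac:(root_lia).
have H7 := @KF (root r.+1 r) 0 i ltac:(inI_lia) ltac:(root_lia).
have H8 := @KE (root r.+1 r) 0 (ta i) ltac:(inI_lia) ltac:(root_lia).
have H9 := Kx_comm (root i.+1 i) (root r.+1 r).
rewrite expr0z in H2 H6 H7 H8.
by rewrite /Bi /Br; nc (tt, H1, H2, H3, H4, H5, H6, H7, H8, H9).
Qed.

(** The relations between F_{r-1} and F_r and between E_{tau(r-1)} and [e] suffice, because all
    mixed products commute up to powers of q. *)
Lemma Bi_Br_serre c c' : (1 < r)%N ->
  serre q (Bi r.-1 c) (Br c') /\ serre q (Br c') (Bi r.-1 c).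
Proof.
move=> r1; set i := r.-1; have Er : r = i.+1 by rewrite /i; lia.
have [S1 S2] := @F_serre i ltac:(lia) ltac:(lia).
rewrite -Er in S1 S2.
have Et : ta i = (r.+1 + l.+2)%N by rewrite /tauI; lia.
have S3 : serre q^-1 (E (ta i)) e.
  rewrite Et; apply: (chain_serrer qV_neq0 qV2_neqN1 E_far E_serre) => //; lia.
have S4 : serre q^-1 e (E (ta i)).
  rewrite Et; apply: (chain_serre_tail qV_neq0 qV2_neqN1 E_far E_serre) => //; lia.
have H1 : E (ta i) * Fg i = Fg i * E (ta i).
  by apply: EF_neq; try inI_lia; rewrite /tauI; lia.
have H2 : E (ta i) * Fg r = Fg r * E (ta i).
  by apply: EF_neq; try inI_lia; rewrite /tauI; lia.
have H3 : e * Fg i = Fg i * e.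
  by symmetry; apply: chain_comm => j Hj; rewrite EF_neq //; inI_lia.
have H4 : e * Fg r = Fg r * e.
  by symmetry; apply: chain_comm => j Hj; rewrite EF_neq //; inI_lia.
pose ka := Kx (root i.+1 i); pose kr := Kx (root r.+1 r).
have K1 : ka * Fg i = q ^+ 2 *: (Fg i * ka).
  by apply: (@KF _ 2); [inI_lia|root_lia].
have K2 : ka * Fg r = q^-1 *: (Fg r * ka).
  by apply: (@KF _ (-1)); [inI_lia|root_lia].
have K3 : kr * Fg i = q^-1 *: (Fg i * kr).
  by apply: (@KF _ (-1)); [inI_lia|root_lia].
have K4 : kr * Fg r = q ^+ 2 *: (Fg r * kr).
  by apply: (@KF _ 2); [inI_lia|root_lia].
have K5 : ka * E (ta i) = 1 *: (E (ta i) * ka).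
  by apply: (@KE _ 0); [inI_lia|root_lia].
have K6 : kr * E (ta i) = 1 *: (E (ta i) * kr).
  by apply: (@KE _ 0); [inI_lia|root_lia].
have K7 : ka * e = 1 *: (e * ka).
  by apply: (@KE_chain _ 0); [|lia|root_lia].
have K8 : kr * e = q *: (e * kr).
  by apply: (@KE_chain _ 1); [|lia|root_lia].
have K9 : kr * ka = ka * kr by apply: Kx_comm.
rewrite /serre /Br /Bi -/kr -/ka; split.
  by nc (tt, S1, S3, H1, H2, H3, H4, K1, K2, K3, K4, K5, K6, K7, K8, K9).
by nc (tt, S2, S4, H1, H2, H3, H4, K1, K2, K3, K4, K5, K6, K7, K8, K9).
Qed.

Lemma Br_f_serre c : serre q (Br c) (chain q Fg r.+1 l).
Proof.
have [S _] := Br_serre c.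
case El : l => [|l']; first by rewrite chain0.
rewrite chainS; apply: serre_qbrr => //.
by apply: chain_comm => j Hj; apply: Br_F; lia.
Qed.

(** B_r followed by F_{r+1}, ..., F_{n-r} is a family with the relations of type A, and
    [B_r, F_X^+]_q is its full chain. All F_j of X commute with that chain except the last one,
    which q-commutes with it and occurs once in F_X^-. *)
Lemma Br_fg c :
  let z := qbr (Br c) (chain q Fg r.+1 l) q in
  let g := dchain q Fg r.+1 l in z * g = q^-1 *: (g * z).
Proof.
pose x j := if j == r then Br c else Fg j.
have x_far i j : (r <= i)%N -> (i.+1 < j)%N -> (j <= r + l.+1)%N -> x i * x j = x j * x i.
  move=> Hi Hij Hj; rewrite /x (_ : j == r = false); last by lia.
  case: eqP => Hir; first by apply: Br_F; lia.
  by apply: F_far; lia.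
have x_serre i : (r <= i)%N -> (i < r + l.+1)%N ->
    serre q (x i) (x i.+1) /\ serre q (x i.+1) (x i).
  move=> Hi Hij; rewrite /x (_ : i.+1 == r = false); last by lia.
  case: eqP => Hir; first by rewrite Hir; apply: Br_serre.
  by apply: F_serre; lia.
have Ez : qbr (Br c) (chain q Fg r.+1 l) q = chain q x r l.+1.
  rewrite chainS /x eqxx; congr (qbr _ _ _); apply: eq_qchain => [j|].
    by rewrite mem_iota => Hj; rewrite (_ : j == r = false) //; lia.
  by rewrite (_ : (_ + _ == r)%N = false) //; lia.
have xE j : (r < j)%N -> x j = Fg j by move=> Hj; rewrite /x (_ : j == r = false) //; lia.
move=> z g; rewrite /z Ez.
apply: dchain_qcommr => [j Hj|].
  rewrite -xE; last by lia.
  by symmetry; apply: (chain_interior q_neq0 q2_neqN1 x_far x_serre) => //; lia.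
rewrite -xE; last by lia.
by rewrite addSnnS (chain_right q_neq0 q2_neqN1 x_far x_serre).
Qed.
End BGenerators.
End UqRelations.
Unset Default Proof Using.

(** * The diagram automorphism *)

Section Flip.
Variables (F : fieldType) (A : algType F) (n : nat) (t : F).
Local Notation ta := (tauI n).

Lemma tauI_in i : inI n i -> inI n (ta i).
Proof. by rewrite /inI /tauI; lia. Qed.

Lemma tauIK i : inI n i -> ta (ta i) = i.
Proof. by rewrite /inI /tauI; lia. Qed.

Lemma cartan_tauI i j : inI n i -> inI n j -> cartan (ta i) (ta j) = cartan i j.
Proof. by rewrite /inI /tauI /cartan => Hi Hj; idx_lia. Qed.

Lemma wc_tauw (mu : weight n) i : inI n i -> wc (tauw mu) i = wc mu (ta i).
Proof. exact: wc_w_of. Qed.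

Lemma tauwD (mu la : weight n) : tauw (mu + la) = tauw mu + tauw la.
Proof. by apply: weightP => i Hi; rewrite wcD !wc_tauw // wcD. Qed.

Lemma tauwN (mu : weight n) : tauw (- mu) = - tauw mu.
Proof. by apply: weightP => i Hi; rewrite wcN !wc_tauw // wcN. Qed.

Lemma tauwK (mu : weight n) : tauw (tauw mu) = mu.
Proof. by apply: weightP => i Hi; rewrite !wc_tauw ?tauI_in // tauIK. Qed.

Lemma tauw_root i j : (0 < i <= n.+1)%N -> (0 < j <= n.+1)%N ->
  tauw (wt n (root i j)) = wt n (root (n.+2 - j) (n.+2 - i)).
Proof.
move=> Hi Hj; rewrite tauw_wt; apply: eq_wt => k; rewrite /inI /root => Hk; lia.
Qed.

Lemma tauw_sroot i : inI n i -> tauw (sroot n i) = sroot n (ta i).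
Proof.
move=> Hi; apply: weightP => j Hj.
by rewrite wc_tauw // !wc_w_of ?tauI_in // -[in RHS](tauIK Hj) cartan_tauI ?tauI_in.
Qed.

(** The relabelled data satisfy the same relations, so every lemma proved from the relations has a
    mirror image obtained by instantiation. *)
Lemma Uq_rels_flip (E Fg : nat -> A) (Kw : weight n -> A) : Uq_rels t E Fg Kw ->
  Uq_rels t (fun i => E (ta i)) (fun i => Fg (ta i)) (fun mu => Kw (tauw mu)).
Proof.
case=> H1 [H2 [H3 [H4 [H5 [H6 H7]]]]]; split.
  by rewrite (_ : tauw 0 = 0) //; apply: (addrI (tauw 0)); rewrite -tauwD !addr0.
split; first by move=> mu la; rewrite tauwD H2.
split; first by move=> mu i Hi; rewrite H3 ?tauI_in // wc_tauw ?tauI_in // tauIK.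
split; first by move=> mu i Hi; rewrite H4 ?tauI_in // wc_tauw ?tauI_in // tauIK.
split.
  move=> i j Hi Hj; rewrite H5 ?tauI_in // (_ : (ta i == ta j) = (i == j)).
    by rewrite /Ki /Kinv tauwN tauw_sroot.
  by apply/eqP/eqP => [/(congr1 ta)|->] //; rewrite !tauIK.
by split=> i j Hi Hj Hc; [apply: H6|apply: H7]; rewrite ?tauI_in ?cartan_tauI.
Qed.

Lemma dchain_flip (s : F) (x : nat -> A) i l : (0 < i)%N -> (i + l <= n)%N ->
  dchain s x i l = chain s (fun j => x (ta j)) (ta (i + l)) l.
Proof.
move=> i0; elim: l => [|l IH] il.
  by rewrite chain0 dchain0 addn0 tauIK // /inI; lia.
rewrite dchain_rcons chainS tauIK; last by rewrite /inI; lia.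
by rewrite IH; [congr (qbr _ (chain _ _ _ _) _); rewrite /tauI|]; lia.
Qed.

Lemma chain_flip (s : F) (x : nat -> A) i l : (0 < i)%N -> (i + l <= n)%N ->
  chain s x i l = dchain s (fun j => x (ta j)) (ta (i + l)) l.
Proof.
move=> i0 il; rewrite dchain_flip; try by rewrite /tauI; lia.
rewrite (_ : ta (ta (i + l) + l) = i); last by rewrite /tauI; lia.
apply: eq_qchain; last by rewrite tauIK // /inI; lia.
by move=> j; rewrite mem_iota => Hj; rewrite tauIK // /inI; lia.
Qed.
End Flip.

(** * Commutators of B_i with B_{tau(j)} *)

Section BPairs.
Variables (F : fieldType) (A : algType F) (n : nat) (t : F).
Variables (E Fg : nat -> A) (Kw : weight n -> A).
Local Notation q := (qq t).
Local Notation nu := ((q - q^-1)^-1).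
Local Notation Kx x := (Kw (wt n x)).
Local Notation ta := (tauI n).
Hypotheses (q_neq0 : q != 0) (q2_neq1 : q ^+ 2 - 1 != 0) (q2_neqN1 : q ^+ 2 + 1 != 0).
Hypothesis rels : Uq_rels t E Fg Kw.
Variables r l : nat.
Hypotheses (r_gt0 : (0 < r)%N) (n_eq : n = (r + r + l.+1)%N).
Set Default Proof Using "All".

Let qV_neq0 : q^-1 != 0. Proof. by rewrite invr_eq0. Qed.
Let qV2_neqN1 : q^-1 ^+ 2 + 1 != 0.
Proof. exact: inv_sqr_add1_neq0. Qed.

Let rels' := Uq_rels_flip rels.

Let UKE_chain := @KE_chain F A n t E Fg Kw q_neq0 q2_neq1 q2_neqN1 rels.
Let UKE_dchain := @KE_dchain F A n t E Fg Kw q_neq0 q2_neq1 q2_neqN1 rels.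
Let UKE := @KE F A n t E Fg Kw q_neq0 q2_neq1 q2_neqN1 rels.
Let UKF := @KF F A n t E Fg Kw q_neq0 q2_neq1 q2_neqN1 rels.
Let UEF_neq := @EF_neq F A n t E Fg Kw q_neq0 q2_neq1 q2_neqN1 rels.
Let UEF_eq := @EF_eq F A n t E Fg Kw q_neq0 q2_neq1 q2_neqN1 rels.
Let UE_far := @E_far F A n t E Fg Kw q_neq0 q2_neq1 q2_neqN1 rels.
Let UF_far := @F_far F A n t E Fg Kw q_neq0 q2_neq1 q2_neqN1 rels.
Let UE_serre := @E_serre F A n t E Fg Kw q_neq0 q2_neq1 q2_neqN1 rels.
Let UchainE_F_right := @chainE_F_right F A n t E Fg Kw q_neq0 q2_neq1 q2_neqN1 rels.
Let UKw_comm := @Kw_comm F A n t E Fg Kw q_neq0 q2_neq1 q2_neqN1 rels.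

Local Ltac inI_lia := rewrite /inI /tauI; lia.
Local Ltac root_lia := rewrite /root /tauI; lia.

Local Notation e := (chain q^-1 E r.+1 l.+1).
Local Notation e' := (dchain q^-1 E r l.+1).
Local Notation Ep := (chain q^-1 E r.+1 l).
Local Notation Em := (dchain q^-1 E r.+1 l).
Local Notation b := (Br t E Fg Kw r l).
Local Notation a := (Bi E Fg Kw).
(** B_{tau(r)} is introduced as B_r for the relabelled data, so that lemmas transfer without proof;
    [Br'E] recovers the explicit formula. *)
Definition Br' c := Br t (fun i => E (ta i)) (fun i => Fg (ta i)) (fun mu => Kw (tauw mu)) r l c.
Definition Bi' i c := Bi (fun i => E (ta i)) (fun i => Fg (ta i)) (fun mu => Kw (tauw mu)) i c.

Lemma e'_flip : e' = chain q^-1 (fun j => E (ta j)) r.+1 l.+1.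
Proof.
rewrite (@dchain_flip _ _ n); [|by []|lia].
by rewrite (_ : ta (r + l.+1) = r.+1) //; rewrite /tauI; lia.
Qed.

Lemma Em_flip : Em = chain q^-1 (fun j => E (ta j)) r.+1 l.+1.-1.
Proof.
rewrite (@dchain_flip _ _ n); [|by []|lia].
by rewrite (_ : ta (r.+1 + l) = r.+1) //; rewrite /tauI; lia.
Qed.

Lemma Br'E c :
  Br' c = Fg (ta r) - c *: (e' * Kx (root (ta r).+1 (ta r))).
Proof.
rewrite /Br' /Br tauw_root; [|lia|lia].
rewrite e'_flip (_ : (n.+2 - r)%N = (ta r).+1); last by rewrite /tauI; lia.
by rewrite (_ : (n.+2 - r.+1)%N = ta r) //; rewrite /tauI; lia.
Qed.

Lemma Bi'E i c : (0 < i < r)%N ->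
  Bi' i c = Fg (ta i) - c *: (E i * Kx (root (ta i).+1 (ta i))).
Proof.
move=> Hi; rewrite /Bi' /Bi tauw_root; [|lia|lia].
rewrite tauIK; last by inI_lia.
rewrite (_ : (n.+2 - i)%N = (ta i).+1); last by rewrite /tauI; lia.
by rewrite (_ : (n.+2 - i.+1)%N = ta i) //; rewrite /tauI; lia.
Qed.

Lemma KxD x y : Kx (fun k => x k + y k) = Kx x * Kx y.
Proof. by rewrite -(Kw_D q_neq0 q2_neq1 q2_neqN1 rels) wtD. Qed.

Lemma Kx_flip x : Kx x = Kw (tauw (wt n (fun k => - x (n.+2 - k)%N))).
Proof. by rewrite -tauw_wt tauwK. Qed.

Lemma KBi' i x z c : (0 < i < r)%N -> x (ta i).+1 - x (ta i) = z ->
  x i = x (ta i).+1 -> x i.+1 = x (ta i) ->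
  Kx x * Bi' i c = q ^ z *: (Bi' i c * Kx x).
Proof.
move=> Hi Hz Hx Hx'; rewrite !Kx_flip.
apply: (KBi q_neq0 q2_neq1 q2_neqN1 rels' r_gt0 n_eq) => //.
- by rewrite -Hz /tauI opprK addrC; congr (x _ - x _); lia.
- rewrite (_ : (n.+2 - i)%N = (ta i).+1) -?Hx; last by rewrite /tauI; lia.
  by congr (- x _); rewrite /tauI; lia.
- rewrite (_ : (n.+2 - i.+1)%N = ta i) -?Hx'; last by rewrite /tauI; lia.
  by congr (- x _); rewrite /tauI; lia.
Qed.

(** Split off the innermost bracket of [e]. The remaining letters of [e] are interior to [e'] and
    commute with it, and the innermost bracket starts with the same generator E_{n-r} as [e'], so
    [serre_comm] applies. *)
Lemma e'_comm : e * e' = e' * e.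
Proof.
have far' := E_far q_neq0 q2_neq1 q2_neqN1 rels'.
have serre' := E_serre q_neq0 q2_neq1 q2_neqN1 rels'.
have -> : e = qchain q^-1 E (iota r.+1 l) (qbr (E (r.+1 + l)) (E (r.+1 + l.+1)) q^-1).
  by rewrite /chain -{1}[l.+1]addn1 iotaD qchain_cat.
symmetry.
apply: qchain_comm => [j|].
  rewrite mem_iota => Hj; rewrite e'_flip -(@tauIK n j); last by inI_lia.
  symmetry; apply: (chain_interior qV_neq0 qV2_neqN1 far' serre') => //; rewrite /tauI; lia.
rewrite dchain_rcons addSnnS; apply: (serre_comm qV_neq0 qV2_neqN1).
- rewrite -(@tauIK n (r + l.+1)); last by inI_lia.
  rewrite (@dchain_flip _ _ n) //; last by lia.
  rewrite (_ : ta (r + l) = (ta (r + l.+1)).+1); last by rewrite /tauI; lia.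
  by apply: (chain_serrel qV_neq0 qV2_neqN1 far' serre') => //; rewrite /tauI; lia.
- by have [] := @UE_serre (r + l.+1) ltac:(lia) ltac:(lia).
by symmetry; apply: dchain_comm => j Hj; symmetry; apply: UE_far; lia.
Qed.

(** Only the contractions of F_{tau(r)} with the right end of [e] and of F_r with the left end of
    [e'] contribute; the second is the mirror image of the first. *)
Lemma Br_Br' c c' : b c * Br' c' = Br' c' * b c +
  q^-1 *: (c' *: (Em * Kx (fun k => root r r.+1 k + root (ta r).+1 (ta r) k))
           - c *: (Ep * Kx (fun k => root r.+1 r k + root (ta r) (ta r).+1 k))).
Proof.
rewrite Br'E /Br (KxD (root r r.+1)) (KxD (root r.+1 r)).
have Et : ta r = (r.+1 + l.+1)%N by rewrite /tauI; lia.
have H0 := e'_comm.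
have H1 := @UchainE_F_right r.+1 l isT ltac:(lia); rewrite -Et in H1.
have H2 := @chainE_F_right _ _ _ _ _ _ _ q_neq0 q2_neq1 q2_neqN1 rels' r.+1 l isT ltac:(lia).
have {}H2 : e' * Fg r = Fg r * e' + q^-1 *: (Em * Kx (root r r.+1)).
  move: H2; rewrite -Et tauIK; last by inI_lia.
  rewrite tauw_root; [|inI_lia|inI_lia].
  rewrite -e'_flip -Em_flip (_ : (n.+2 - (ta r).+1)%N = r); last by rewrite /tauI; lia.
  by rewrite (_ : (n.+2 - ta r)%N = r.+1) //; rewrite /tauI; lia.
pose kr := Kx (root r.+1 r); pose kt := Kx (root (ta r).+1 (ta r)).
pose kr' := Kx (root r r.+1); pose kt' := Kx (root (ta r) (ta r).+1).
rewrite -/kr -/kt -/kr' -/kt' in H1 H2 *.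
have H3 : Fg (ta r) * Fg r = Fg r * Fg (ta r).
  by symmetry; apply: UF_far; rewrite /tauI; lia.
have K1 : kr * Fg (ta r) = 1 *: (Fg (ta r) * kr).
  by apply: (@UKF _ 0); [inI_lia|root_lia].
have K2 : kt * Fg r = 1 *: (Fg r * kt).
  by apply: (@UKF _ 0); [inI_lia|root_lia].
have K3 : kr * e' = q^-1 *: (e' * kr).
  by apply: (@UKE_dchain _ (-1)); [|lia|root_lia].
have K4 : kt * e = q^-1 *: (e * kt).
  by apply: (@UKE_chain _ (-1)); [|lia|root_lia].
have K5 : kt * kr = kr * kt by apply: UKw_comm.
have K6 : kt' * kr = kr * kt' by apply: UKw_comm.
by nc (tt, H0, H1, H2, H3, K1, K2, K3, K4, K5, K6).
Qed.

(** Both generators carry the same parameter, since c_i = c_{tau(i)} for i < r; this cancels the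
    terms in K_i^{-1} K_{tau(i)}^{-1}. *)
Lemma Bi_Bi' i c : (0 < i < r)%N ->
  a i c * Bi' i c = Bi' i c * a i c +
  (c * nu) *: (Kx (fun k => root i i.+1 k + root (ta i).+1 (ta i) k)
               - Kx (fun k => root i.+1 i k + root (ta i) (ta i).+1 k)).
Proof.
move=> Hi; rewrite Bi'E // /Bi (KxD (root i i.+1)) (KxD (root i.+1 i)).
have H1 := @UEF_eq i ltac:(inI_lia).
have H2 := @UEF_eq (ta i) ltac:(inI_lia).
have H3 : Fg (ta i) * Fg i = Fg i * Fg (ta i).
  by symmetry; apply: UF_far; rewrite /tauI; lia.
have H4 : E (ta i) * E i = E i * E (ta i).
  by symmetry; apply: UE_far; rewrite /tauI; lia.
have H5 := @UEF_neq i (ta i) ltac:(inI_lia) ltac:(inI_lia) ltac:(rewrite /tauI; lia).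
have H6 := @UEF_neq (ta i) i ltac:(inI_lia) ltac:(inI_lia) ltac:(rewrite /tauI; lia).
pose k := Kx (root i.+1 i); pose kt := Kx (root (ta i).+1 (ta i)).
pose k' := Kx (root i i.+1); pose kt' := Kx (root (ta i) (ta i).+1).
rewrite -/k -/kt -/k' -/kt' in H1 H2 *.
have K1 : k * Fg (ta i) = 1 *: (Fg (ta i) * k).
  by apply: (@UKF _ 0); [inI_lia|root_lia].
have K2 : kt * Fg i = 1 *: (Fg i * kt).
  by apply: (@UKF _ 0); [inI_lia|root_lia].
have K3 : k * E i = q ^- 2 *: (E i * k).
  by apply: (@UKE _ (- 2%:Z)); [inI_lia|root_lia].
have K4 : kt * E (ta i) = q ^- 2 *: (E (ta i) * kt).
  by apply: (@UKE _ (- 2%:Z)); [inI_lia|root_lia].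
have K5 : kt * k = k * kt by apply: UKw_comm.
have K6 : kt' * k = k * kt' by apply: UKw_comm.
by nc (tt, H1, H2, H3, H4, H5, H6, K1, K2, K3, K4, K5, K6).
Qed.

Lemma Bi_Br'_comm i c c' : (0 < i < r)%N -> a i c * Br' c' = Br' c' * a i c.
Proof.
move=> Hi; rewrite Br'E /Bi.
(* For i = r-1 both torus elements contribute a factor q, and the two factors cancel in the
   commutator. *)
pose z : int := (i.+1 == r)%:Z.
have H1 : Fg (ta r) * Fg i = Fg i * Fg (ta r).
  by symmetry; apply: UF_far; rewrite /tauI; lia.
have H2 : e' * Fg i = Fg i * e'.
  by symmetry; apply: dchain_comm => j Hj; rewrite UEF_neq //; inI_lia.
have H3 := @UEF_neq (ta i) (ta r) ltac:(inI_lia) ltac:(inI_lia) ltac:(rewrite /tauI; lia).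
have H4 : E (ta i) * e' = e' * E (ta i).
  by apply: dchain_comm => j Hj; symmetry; apply: UE_far; rewrite /tauI; lia.
pose k := Kx (root i.+1 i); pose kt := Kx (root (ta r).+1 (ta r)).
rewrite -/k -/kt.
have K1 : k * Fg (ta r) = 1 *: (Fg (ta r) * k).
  by apply: (@UKF _ 0); [inI_lia|root_lia].
have K2 : kt * Fg i = 1 *: (Fg i * kt).
  by apply: (@UKF _ 0); [inI_lia|root_lia].
have K3 : k * e' = q ^ z *: (e' * k).
  by apply: (@UKE_dchain _ z); [|lia|rewrite /z; root_lia].
have K4 : kt * E (ta i) = q ^ z *: (E (ta i) * kt).
  by apply: (@UKE _ z); [inI_lia|rewrite /z; root_lia].
have K5 : kt * k = k * kt by apply: UKw_comm.
by nc (tt, H1, H2, H3, H4, K1, K2, K3, K4, K5).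
Qed.

Lemma Bi_Bi'_comm i j c c' : (0 < i < r)%N -> (0 < j < r)%N -> i != j ->
  a i c * Bi' j c' = Bi' j c' * a i c.
Proof.
move=> Hi Hj ij; rewrite Bi'E // /Bi.
pose z : int := (i.+1 == j)%:Z + (j.+1 == i)%:Z.
have H1 : Fg (ta j) * Fg i = Fg i * Fg (ta j).
  by symmetry; apply: UF_far; rewrite /tauI; lia.
have H2 := @UEF_neq j i ltac:(inI_lia) ltac:(inI_lia) ltac:(lia).
have H3 := @UEF_neq (ta i) (ta j) ltac:(inI_lia) ltac:(inI_lia) ltac:(rewrite /tauI; lia).
have H4 : E (ta i) * E j = E j * E (ta i).
  by symmetry; apply: UE_far; rewrite /tauI; lia.
pose k := Kx (root i.+1 i); pose kt := Kx (root (ta j).+1 (ta j)).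
rewrite -/k -/kt.
have K1 : k * Fg (ta j) = 1 *: (Fg (ta j) * k).
  by apply: (@UKF _ 0); [inI_lia|root_lia].
have K2 : kt * Fg i = 1 *: (Fg i * kt).
  by apply: (@UKF _ 0); [inI_lia|root_lia].
have K3 : k * E j = q ^ z *: (E j * k).
  by apply: (@UKE _ z); [inI_lia|rewrite /z; root_lia].
have K4 : kt * E (ta i) = q ^ z *: (E (ta i) * kt).
  by apply: (@UKE _ z); [inI_lia|rewrite /z; root_lia].
have K5 : kt * k = k * kt by apply: UKw_comm.
by nc (tt, H1, H2, H3, H4, K1, K2, K3, K4, K5).
Qed.

End BPairs.
Unset Default Proof Using.

(** * The braid relation in rank two *)

Section Abstract.
Variables (F : fieldType) (A : algType F) (q : F).
Local Notation nu := ((q - q^-1)^-1).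

Definition qcomm (u v : A) (c : F) := u * v = c *: (v * u).

(* a, a' are B_{r-1}, B_{tau(r-1)}, with ca = c_{r-1}; b, b' are B_r, B_{tau r}, with
   c = c_r, c' = c_{tau r}; f, g are F_X^+, F_X^- and Ep, Em are E_X^+, E_X^-; K, X, V, L
   are K_mu for mu = alpha_r - alpha_{tau r}, the sum of the alpha_j for j in X,
   varpi'_{r+1} and alpha_{r-1} - alpha_{tau(r-1)}; K', X', V', L' are their inverses.
   Only half of the relations are listed: the diagram automorphism exchanges a and a',
   b and b', f and g, Ep and Em and inverts K, V, L, and yields the others. *)
Record rel_half (ca c c' : F) (a a' b b' f g Ep Em K K' X X' V V' L L' : A) : Prop :=
  RelHalf {
  rh_fa : f * a = a * f; rh_ga : g * a = a * g;
  rh_Epa : Ep * a = a * Ep; rh_Ema : Em * a = a * Em;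
  rh_b'a : b' * a = a * b';
  rh_Epb : Ep * b = b * Ep; rh_Emb : Em * b = b * Em;
  rh_bf : serre q b f; rh_ab : serre q a b; rh_ba : serre q b a;
  rh_sl2 : Em * f = f * Em + nu *: (X - X');
  rh_bb' : b * b' = b' * b + q^-1 *: (c' *: (Em * K) - c *: (Ep * K'));
  rh_aa' : a * a' = a' * a + (ca * nu) *: (L - L');
  rh_bfg : qbr b f q * g = q^-1 *: (g * qbr b f q);
  rh_Ka : qcomm K a q; rh_Kb : qcomm K b (q ^- 2); rh_Kf : qcomm K f 1;
  rh_KEp : qcomm K Ep 1; rh_KEm : qcomm K Em 1;
  rh_K'a : qcomm K' a q^-1; rh_K'b : qcomm K' b (q ^+ 2); rh_K'f : qcomm K' f 1;
  rh_K'Ep : qcomm K' Ep 1; rh_K'Em : qcomm K' Em 1;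
  rh_Xa : qcomm X a 1; rh_Xb : qcomm X b q; rh_Xf : qcomm X f (q ^- 2);
  rh_X'a : qcomm X' a 1; rh_X'b : qcomm X' b q^-1; rh_X'f : qcomm X' f (q ^+ 2);
  rh_Va : qcomm V a 1; rh_Vb : qcomm V b 1; rh_Vf : qcomm V f 1;
  rh_V'a : qcomm V' a 1; rh_V'b : qcomm V' b 1; rh_V'f : qcomm V' f 1;
  rh_V'Ep : qcomm V' Ep 1; rh_V'Em : qcomm V' Em 1;
  rh_VEp : qcomm V Ep 1; rh_VEm : qcomm V Em 1;
  rh_La : qcomm L a (q ^- 2); rh_Lb : qcomm L b q; rh_Lf : qcomm L f 1;
  rh_LEp : qcomm L Ep 1; rh_LEm : qcomm L Em 1;
  rh_L'a : qcomm L' a (q ^+ 2); rh_L'b : qcomm L' b q^-1; rh_L'f : qcomm L' f 1;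
  rh_L'Ep : qcomm L' Ep 1; rh_L'Em : qcomm L' Em 1
}.

(* The equations are oriented for rewriting by [nc]: K and K' are moved to the right. *)
Record torus_rels (K K' X X' V V' L L' : A) : Prop := TorusRels {
  tr_KK' : K * K' = 1; tr_K'K : K' * K = 1; tr_XX' : X * X' = 1; tr_X'X : X' * X = 1;
  tr_LL' : L * L' = 1; tr_L'L : L' * L = 1;
  tr_VV' : V * V' = 1; tr_V'V : V' * V = 1;
  tr_XK : X * K = K * X; tr_XK' : X * K' = K' * X;
  tr_X'K : X' * K = K * X'; tr_X'K' : X' * K' = K' * X';
  tr_VK : V * K = K * V; tr_VK' : V * K' = K' * V;
  tr_V'K : V' * K = K * V'; tr_V'K' : V' * K' = K' * V';
  tr_LK : L * K = K * L; tr_LK' : L * K' = K' * L;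
  tr_L'K : L' * K = K * L'; tr_L'K' : L' * K' = K' * L';
  tr_LX' : L * X' = X' * L; tr_L'X' : L' * X' = X' * L';
  tr_VX' : V * X' = X' * V; tr_V'X' : V' * X' = X' * V';
  tr_LV : L * V = V * L; tr_L'V : L' * V = V * L';
  tr_LV' : L * V' = V' * L; tr_L'V' : L' * V' = V' * L'
}.

Lemma torus_flip K K' X X' V V' L L' :
  torus_rels K K' X X' V V' L L' -> torus_rels K' K X X' V' V L' L.
Proof. by case. Qed.

Hypotheses (q_neq0 : q != 0) (q2_neq1 : q ^+ 2 - 1 != 0) (q2_neqN1 : q ^+ 2 + 1 != 0).
Variables (ca c c' : F) (a a' b b' f g Ep Em K K' X X' V V' L L' : A).
Hypotheses (H : rel_half ca c c' a a' b b' f g Ep Em K K' X X' V V' L L')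
  (H' : rel_half ca c' c a' a b' b g f Em Ep K' K X X' V' V L' L)
  (T : torus_rels K K' X X' V V' L L').
Set Default Proof Using "All".

Local Notation y := (qbr f b' q).
Local Notation Y := (qbr b y q).
Local Notation Y' := (qbr b' (qbr g b q) q).
Local Notation W := (qbr a Y q + (q * c') *: (a * K * X')).
Local Notation W' := (qbr a' Y' q + (q * c) *: (a' * K' * X')).
Local Notation q2 := (q + q^-1).

(** When [Ep] commutes with [b], this is [[b, f]_q, Ep]_{q^2}. It is fully expanded so that [b]
    occurs exactly once in each monomial. *)
Definition beta_core (b f Ep : A) : A :=
  b * f * Ep - q *: (f * b * Ep) - q ^+ 2 *: (b * Ep * f) + q ^+ 3 *: (Ep * f * b).
Local Notation B0 := (- (q^-1 * c) *: (beta_core b f Ep * K')).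

(** The Serre relation of [b] with [f] would pass to [y] if [b] commuted with [b']; the right-hand
    side is the defect, linear in their commutator [Z]. It is kept divisible by q + q^-1, the factor
    that [comm_b_W] cancels. *)
Lemma serre_b_y :
  b * b * y - q2 *: (b * y * b) + y * b * b
  = q2 *: (q ^- 2 *: (c' *: (b * K * X')) + B0).
Proof.
pose Z := q^-1 *: (c' *: (Em * K) - c *: (Ep * K')).
have E1 : b * b' = b' * b + Z by apply: rh_bb' H.
have E2 : b' * b = b * b' - Z by rewrite E1 addrK.
have S := rh_bf H.
have H1 : b * b * (f * b') - q2 *: (b * (f * b') * b) + f * b' * b * b
    = q2 *: (b * f * Z) - f * (b * Z + Z * b) by nc (tt, S, E2).
have H2 : b * b * (b' * f) - q2 *: (b * (b' * f) * b) + b' * f * b * b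
    = (Z * b + b * Z) * f - q2 *: (Z * f * b) by nc (tt, S, E1).
transitivity (q2 *: (b * f * Z) - f * (b * Z + Z * b)
    - q *: ((Z * b + b * Z) * f - q2 *: (Z * f * b))).
  by rewrite -H1 -H2; nc tt.
rewrite /Z /beta_core.
by nc (tt, rh_sl2 H, rh_Epb H, rh_Emb H, rh_Kb H, rh_Kf H, rh_K'b H, rh_K'f H,
  rh_Xb H, rh_X'b H, tr_XK T, tr_X'K T).
Qed.

Let scale_inj (k : F) (u v : A) : k != 0 -> k *: u = k *: v -> u = v.
Proof. by move=> k0; apply: scalerI. Qed.

Let q2_neq0 : q2 != 0.
Proof.
apply: contraNneq q2_neqN1 => /(congr1 ( *%R q)).
by rewrite mulr0 mulrDr divff // -expr2 => ->.
Qed.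

Lemma y_a : y * a = a * y.
Proof. by nc (tt, rh_fa H, rh_b'a H). Qed.

(** The certificate of [serre_interior] for [b], [a], [y], with [D2] corrected by the defect of
    [serre_b_y]. The summand a K X' of [W] absorbs the part b K X' of the defect, which explains its
    presence in tau_r(B_{r-1}); the part [B0] survives. *)
Lemma comm_b_W : b * W = W * b + (a * B0 - q ^+ 2 *: (B0 * a)).
Proof.
set beta := B0.
pose S := q2 *: (q ^- 2 *: (c' *: (b * K * X')) + beta).
pose D1 := b * b * a - (q2 *: (b * a * b) - a * b * b).
pose D2 := b * b * y - q2 *: (b * y * b) + y * b * b - S.
have D10 : D1 = 0 by rewrite /D1 (rh_ba H) subrr.
have D20 : D2 = 0 by rewrite /D2 serre_b_y subrr.
apply: (scale_inj q2_neq0); apply/subr0_eq.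
transitivity (q ^+ 2 *: (y * D1) - D1 * y + a * D2 - q ^+ 2 *: (D2 * a)).
  have Ea := y_a; rewrite /D1 /D2 /S; set yy := y in Ea *.
  by nc (tt, Ea, rh_Ka H, rh_Kb H, rh_X'a H, rh_X'b H).
by rewrite D10 D20 !mul0r !mulr0 !scaler0 !addr0 ?oppr0 ?addr0.
Qed.

(** The left side is tau_{r-1}(Y) without its scalar. Since [a] commutes with [f] and [b'], and [a']
    with [b] and [f], both can be moved outside Y; the torus term comes from the commutator of [a]
    and [a']. *)
Lemma s_Y_expand :
  qbr (qbr b a q) (qbr f (qbr b' a' q) q) q =
  Y * a * a' - q *: (a' * Y * a) - q *: (a * Y * a') + q ^+ 2 *: (a * a' * Y)
  - (ca * nu) *: (Y * (L - q ^+ 2 *: L')).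
Proof.
have E : a' * a = a * a' - (ca * nu) *: (L - L') by rewrite (rh_aa' H) addrK.
by nc (tt, rh_fa H, rh_b'a H, esym (rh_ga H'), esym (rh_b'a H'), E,
  rh_Lb H, rh_L'b H, rh_Lf H, rh_L'f H, rh_Lb H', rh_L'b H',
  rh_La H, rh_L'a H, rh_La H', rh_L'a H').
Qed.

Lemma st_a_expand (P := Y * a * a' - q *: (a' * Y * a) - q *: (a * Y * a')
    + q ^+ 2 *: (a * a' * Y) - (ca * nu) *: (Y * (L - q ^+ 2 *: L'))) :
  qbr (a' * L') P q = (ca * q ^+ 2) *: qbr Y a' q.
Proof.
have LY : L * Y = Y * L.
  by nc (tt, rh_Lb H, rh_Lf H, rh_L'b H').
have L'Y : L' * Y = Y * L'.
  by nc (tt, rh_L'b H, rh_L'f H, rh_Lb H').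
(* [a'] commutes with [b] and [f], so Y inherits the Serre relation of [a'] with [b']. *)
have S : serre q a' Y.
  have E1 : a' * b = b * a' by rewrite (rh_b'a H').
  have E2 : a' * f = f * a' by rewrite (rh_ga H').
  have [S1 S2] := (rh_ab H', tt).
  by rewrite /serre; nc (tt, S1, E1, E2).
have E : a' * a = a * a' - (ca * nu) *: (L - L') by rewrite (rh_aa' H) addrK.
rewrite /P; set YY := Y in LY L'Y S *.
by nc (tt, E, S, LY, L'Y, rh_La H, rh_L'a H, rh_La H', rh_L'a H', tr_LL' T, tr_L'L T).
Qed.

Local Notation z := (qbr b' g q).
Local Notation B0' := (- (q^-1 * c') *: (beta_core b' g Em * K)).

(** [B0'] is a multiple of [z, Em]_{q^2} K, and [f] q-commutes with [z], so only the sl_2 relation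
    between [Em] and [f] contributes; of its two torus terms X' remains. *)
Lemma f_B0' : qbr f B0' q = (q * c') *: (z * K * X').
Proof.
have Ez : z * f = q^-1 *: (f * z) by exact: rh_bfg H'.
have EB : B0' = - (q^-1 * c') *: ((z * Em - q ^+ 2 *: (Em * z)) * K).
  by rewrite /beta_core; nc (tt, esym (rh_Epb H')).
have Xz : X * z = q^-1 *: (z * X) by nc (tt, rh_Xb H', rh_Xf H').
have X'z : X' * z = q *: (z * X') by nc (tt, rh_X'b H', rh_X'f H').
rewrite EB; set zz := z in Ez Xz X'z *.
by nc (tt, Ez, rh_sl2 H, rh_Kf H, Xz, X'z, tr_XK T, tr_X'K T).
Qed.

(* [W'] is [t a'] up to a scalar: the first two hypotheses are the images under [t] of
   the commutation of [a'] with [b] and [f]. *)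
Lemma t_inverse_expand :
  b * W' = q *: (W' * b) -> f * W' = W' * f ->
  b' * W' = W' * b' + (a' * B0' - q ^+ 2 *: (B0' * a')) ->
  qbr Y W' q + c' *: (W' * (K * X')) = (q * c * c') *: a'.
Proof.
move=> Eb Ef Eb'.
have Efh := f_B0'.
(* [W'] passes [b] up to q and passes [f] freely, so the whole bracket is carried by [d], the
   commutator of [b'] and [W']. *)
have E1 : qbr Y W' q = b * qbr f (a' * B0' - q ^+ 2 *: (B0' * a')) q
    - q ^+ 2 *: (qbr f (a' * B0' - q ^+ 2 *: (B0' * a')) q * b).
  set w := W' in Eb Ef Eb' *; set d := a' * B0' - _ in Eb' *.
  by nc (tt, Eb, Ef, Eb').
have E2 : qbr f (a' * B0' - q ^+ 2 *: (B0' * a')) q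
    = a' * ((q * c') *: (z * K * X')) - q ^+ 2 *: ((q * c') *: (z * K * X') * a').
  rewrite -Efh; have E3 := rh_ga H'; set B := B0'.
  by nc (tt, E3).
rewrite E1 E2.
by nc (tt, rh_b'a H', rh_fa H', rh_Epa H', rh_Ema H', rh_sl2 H', rh_bb' H,
  rh_Epb H, rh_Emb H, rh_Epb H', rh_Emb H',
  rh_Ka H', rh_Kb H, rh_Kf H', rh_Kb H', rh_K'b H', rh_K'f H', rh_K'a H', rh_K'b H,
  rh_X'a H', rh_X'b H, rh_X'b H', rh_X'f H',
  rh_Xa H', rh_Xb H, rh_Xb H', rh_Xf H',
  tr_XK T, tr_X'K T, tr_XK' T, tr_X'K' T, tr_KK' T, tr_K'K T, tr_XX' T, tr_X'X T).
Qed.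

(** With [a2] = B_{r-2}, the two sides are, up to a common scalar, those of the braid relation at
    B_{r-2}. As [a2] commutes with Y and [a'], the difference reduces to the commutator of [a] and
    [a']. *)
Lemma outer_braid_expand a2 :
  a2 * b = b * a2 -> a2 * b' = b' * a2 -> a2 * f = f * a2 -> a2 * a' = a' * a2 ->
  K * a2 = a2 * K -> X' * a2 = a2 * X' -> L * a2 = q *: (a2 * L) ->
  L' * a2 = q^-1 *: (a2 * L') ->
  qbr (qbr a2 W q) a' q = qbr (qbr a2 a q) (qbr Y a' q + c' *: (a' * (K * X'))) q.
Proof.
move=> E1 E2 E3 E4 E5 E6 E7 E8.
have E9 : Y * a2 = a2 * Y by nc (tt, esym E1, esym E2, esym E3).
have LY : L * Y = Y * L.
  by nc (tt, rh_Lb H, rh_Lf H, rh_L'b H').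
have L'Y : L' * Y = Y * L'.
  by nc (tt, rh_L'b H, rh_L'f H, rh_Lb H').
have KY : K * Y = Y * K.
  by nc (tt, rh_Kb H, rh_Kf H, rh_K'b H').
have XY : X' * Y = Y * X'.
  by nc (tt, rh_X'b H, rh_X'f H, rh_X'b H').
have E : a' * a = a * a' - (ca * nu) *: (L - L') by rewrite (rh_aa' H) addrK.
have Ka' : K * a' = q^-1 *: (a' * K) by exact: rh_K'a H'.
set YY := Y in E9 LY L'Y KY XY *.
by nc (tt, E9, LY, L'Y, KY, XY, E, esym E4, E5, E6, E7, E8, rh_Ka H, Ka', rh_X'a H,
  rh_X'a H', tr_LK T, tr_L'K T, tr_LX' T, tr_L'X' T).
Qed.
End Abstract.
Unset Default Proof Using.

(** * Two homomorphisms satisfying the rank two braid relation *)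

Section Actions.
Variables (F : fieldType) (A : algType F) (q : F).
Local Notation nu := ((q - q^-1)^-1).

(* Here s and t are tau_{r-1} and tau_r. *)
Record act_half (P : A -> Prop) (s t : A -> A) (C alpha c' : F)
    (a a' b b' f Ep K X' V L L' : A) : Prop := ActHalf {
  ah_Pa : P a; ah_Pb : P b; ah_Pf : P f; ah_PEp : P Ep; ah_PK : P K; ah_PX' : P X';
  ah_PV : P V; ah_PL : P L;
  ah_ta : t a = C *: (qbr a (qbr b (qbr f b' q) q) q + (q * c') *: (a * K * X'));
  ah_tb : t b = q^-1 *: (b * K * V);
  ah_tf : t f = f; ah_tEp : t Ep = Ep; ah_tK : t K = K; ah_tX' : t X' = X';
  ah_tV : t V = V; ah_tL : t L = L;
  ah_sa : s a = q^-1 *: (a' * L');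
  ah_sb : s b = alpha *: qbr b a q;
  ah_sf : s f = f; ah_sEp : s Ep = Ep; ah_sK : s K = K * L; ah_sX' : s X' = X';
  ah_sV : s V = V; ah_sL : s L = L'
}.

(** The maps are total on [A] but multiplicative only on the subalgebra [P], hence a membership
    condition at each use. *)
Record hom_on (P : A -> Prop) (h : A -> A) : Prop := HomOn {
  ho_P : forall x, P x -> P (h x);
  ho_D : forall x y, P x -> P y -> h (x + y) = h x + h y;
  ho_Z : forall k x, P x -> h (k *: x) = k *: h x;
  ho_M : forall x y, P x -> P y -> h (x * y) = h x * h y
}.

Record subalg (P : A -> Prop) : Prop := SubAlg {
  sa_D : forall x y, P x -> P y -> P (x + y);
  sa_Z : forall k x, P x -> P (k *: x);
  sa_M : forall x y, P x -> P y -> P (x * y)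
}.

Lemma sa_N P x : subalg P -> P x -> P (- x).
Proof. by move=> SP Px; rewrite -scaleN1r; apply: sa_Z. Qed.

Lemma sa_qbr P x y k : subalg P -> P x -> P y -> P (qbr x y k).
Proof.
by move=> SP Px Py; apply: (sa_D SP); [|apply: sa_N => //; apply: (sa_Z SP)];
  apply: (sa_M SP).
Qed.

Lemma ho_N P h x : subalg P -> hom_on P h -> P x -> h (- x) = - h x.
Proof. by move=> SP Hh Px; rewrite -scaleN1r (ho_Z Hh) // scaleN1r. Qed.

Lemma ho_qbr P h x y k : subalg P -> hom_on P h -> P x -> P y ->
  h (qbr x y k) = qbr (h x) (h y) k.
Proof.
move=> SP Hh Px Py; have [Pxy Pyx] := (sa_M SP Px Py, sa_M SP Py Px).
rewrite /qbr (ho_D Hh) ?(ho_N SP Hh) ?(ho_Z Hh) ?(ho_M Hh) //.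
- exact: (sa_Z SP).
- exact/(sa_N SP)/(sa_Z SP).
Qed.

Section Half.
Variables (P : A -> Prop) (s t : A -> A) (C alpha ca c c' : F).
Variables (a a' b b' f g Ep Em K K' X X' V V' L L' : A).
Hypotheses (q_neq0 : q != 0) (q2_neq1 : q ^+ 2 - 1 != 0) (q2_neqN1 : q ^+ 2 + 1 != 0).
Hypotheses (ca_neq0 : ca != 0) (c_neq0 : c != 0) (c'_neq0 : c' != 0).
Hypotheses (alpha2 : alpha ^+ 2 = (q * ca)^-1) (C2 : C ^+ 2 = (q * c * c')^-1).
Hypotheses (H : rel_half q ca c c' a a' b b' f g Ep Em K K' X X' V V' L L')
  (H' : rel_half q ca c' c a' a b' b g f Em Ep K' K X X' V' V L' L)
  (T : torus_rels K K' X X' V V' L L').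
Hypotheses (SP : subalg P) (Hs : hom_on P s) (Ht : hom_on P t).
Hypotheses (Ac : act_half P s t C alpha c' a a' b b' f Ep K X' V L L')
  (Ac' : act_half P s t C alpha c a' a b' b g Em K' X' V' L' L).
Set Default Proof Using "All".

Local Notation y := (qbr f b' q).
Local Notation Y := (qbr b y q).
Local Notation Y' := (qbr b' (qbr g b q) q).
Local Notation W := (qbr a Y q + (q * c') *: (a * K * X')).
Local Notation W' := (qbr a' Y' q + (q * c) *: (a' * K' * X')).
Local Notation B0 := (- (q^-1 * c) *: (beta_core q b f Ep * K')).
Local Notation B0' := (- (q^-1 * c') *: (beta_core q b' g Em * K)).
Local Notation B1 := (- (q^-1 * c) *: (beta_core q b f Ep * V)).

Let C_neq0 : C != 0.
Proof.
have : C ^+ 2 != 0 by rewrite C2 invr_eq0 !mulf_neq0.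
by rewrite expf_eq0.
Qed.

Local Ltac inP := repeat first
  [ exact: (ah_Pa Ac) | exact: (ah_Pb Ac) | exact: (ah_Pf Ac) | exact: (ah_PEp Ac)
  | exact: (ah_PK Ac) | exact: (ah_PX' Ac) | exact: (ah_PV Ac) | exact: (ah_PL Ac)
  | exact: (ah_Pa Ac') | exact: (ah_Pb Ac') | exact: (ah_Pf Ac') | exact: (ah_PEp Ac')
  | exact: (ah_PK Ac') | exact: (ah_PV Ac') | exact: (ah_PL Ac') | assumption
  | apply: (sa_qbr _ SP) | apply: (sa_D SP) | apply: (sa_Z SP) | apply: (sa_M SP)
  | apply: (sa_N SP) | apply: (ho_P Hs) | apply: (ho_P Ht) ].
Local Ltac hom Hh := repeat first
  [ rewrite (ho_qbr _ SP Hh); [|by inP|by inP] | rewrite (ho_D Hh); [|by inP|by inP]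
  | rewrite (ho_Z Hh); [|by inP] | rewrite (ho_M Hh); [|by inP|by inP]
  | rewrite (ho_N SP Hh); [|by inP] ].

Lemma t_Y : t Y = Y.
Proof.
hom Ht; rewrite (ah_tb Ac) (ah_tb Ac') (ah_tf Ac).
by nc (tt, rh_Kb H, rh_K'b H, rh_Kf H, rh_K'f H, rh_Kb H', rh_K'b H',
  rh_Vb H, rh_V'b H, rh_Vf H, rh_V'f H, rh_Vb H', rh_V'b H',
  tr_VK T, tr_VK' T, tr_V'K T, tr_V'K' T, tr_KK' T, tr_K'K T, tr_VV' T, tr_V'V T).
Qed.

Lemma s_Y : s Y = alpha ^+ 2 *: (Y * a * a' - q *: (a' * Y * a) - q *: (a * Y * a')
  + q ^+ 2 *: (a * a' * Y) - (ca * nu) *: (Y * (L - q ^+ 2 *: L'))).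
Proof.
rewrite -(s_Y_expand q_neq0 q2_neq1 q2_neqN1 H H' T); hom Hs.
by rewrite (ah_sb Ac) (ah_sb Ac') (ah_sf Ac); nc tt.
Qed.

Lemma st_a : s (t a) = C *: (qbr Y a' q + c' *: (a' * (K * X'))).
Proof.
have PY : P Y by inP.
have E := st_a_expand q_neq0 q2_neq1 q2_neqN1 H H' T.
rewrite (ah_ta Ac); move: PY s_Y E; move: Y => R PR sR E.
hom Hs; rewrite sR (ah_sa Ac) (ah_sK Ac) (ah_sX' Ac).
set Q := _ - (ca * nu) *: _ in E *.
(* The factor c_{r-1} q^2 of [st_a_expand] is cancelled by alpha^2 q^-1, since alpha^2 = (q
   c_{r-1})^{-1}. *)
have -> : qbr (q^-1 *: (a' * L')) (alpha ^+ 2 *: Q) q = qbr R a' q.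
  transitivity ((q^-1 * (q * ca)^-1) *: qbr (a' * L') Q q).
    by rewrite alpha2; nc tt.
  by rewrite E; nc tt.
by nc (tt, tr_L'K T, tr_L'L T).
Qed.

Lemma KV_W' : K * V * W' = q^-1 *: (W' * K * V).
Proof.
by nc (tt, rh_Ka H', rh_K'a H', rh_Kb H, rh_K'b H, rh_Kb H', rh_K'b H', rh_Kf H', rh_K'f H',
  rh_Vb H, rh_V'b H, rh_Vb H', rh_V'b H', rh_V'a H', rh_V'f H', tr_VK T, tr_VK' T, tr_KK' T, tr_K'K T,
  tr_VX' T, tr_X'K T, tr_X'K' T).
Qed.

Lemma ta'E : t a' = C *: W'. Proof. exact: ah_ta Ac'. Qed.

(** Applying [t] to the commutation of [b] and [a'] produces an extra K V next to [b]; moving it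
    past [W'] and cancelling it leaves the factor q. *)
Lemma b_W' : b * W' = q *: (W' * b).
Proof.
have E : W' * (b * K * V) = b * K * V * W'.
  have := congr1 t (esym (rh_b'a H')).
  rewrite (ho_M Ht) ?(ho_M Ht); try by inP.
  rewrite ta'E (ah_tb Ac) -!scalerAl -!scalerAr !scalerA mulrC.
  by apply: scalerI; rewrite mulf_neq0 ?invr_eq0.
have KV := KV_W'.
have := congr1 (fun x => x * (V' * K')) E; set w := W' in KV *.
have -> : w * (b * K * V) * (V' * K') = w * b.
  by nc (tt, tr_VV' T, tr_KK' T).
have -> : b * K * V * w * (V' * K') = q^-1 *: (b * w).
  rewrite -[b * K * V](mulrA b) -(mulrA b) KV.
  by nc (tt, tr_VV' T, tr_KK' T).
by move=> ->; rewrite scalerA divff // scale1r.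
Qed.

Lemma f_W' : f * W' = W' * f.
Proof.
have := congr1 t (rh_ga H'); rewrite (ho_M Ht) ?(ho_M Ht); try by inP.
rewrite ta'E (ah_tf Ac) -!scalerAl -!scalerAr.
exact: scalerI.
Qed.

Lemma tst_a : t (s (t a)) = a'.
Proof.
have PY : P Y by inP.
have E := t_inverse_expand q_neq0 q2_neq1 q2_neqN1 H H' T b_W' f_W'
  (comm_b_W q_neq0 q2_neq1 q2_neqN1 H' H (torus_flip T)).
rewrite st_a; move: PY t_Y ta'E E; move: Y W' => R w PR tR ta' E.
hom Ht; rewrite tR ta' (ah_tK Ac) (ah_tX' Ac).
(* One factor C comes from t(a), the other from t(a'); C^2 cancels the q c c' of
   [t_inverse_expand]. *)
transitivity (C ^+ 2 *: (qbr R w q + c' *: (w * (K * X')))); first by nc tt.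
by rewrite E C2 scalerA mulVf ?scale1r // !mulf_neq0.
Qed.

(** Each monomial of [beta_core] contains [b] once, the other letters are fixed by [t], and K V
    commutes with them. *)
Lemma t_B1 : t B1 = q^-1 *: (B1 * K * V).
Proof.
rewrite /beta_core; hom Ht; rewrite (ah_tb Ac) (ah_tf Ac) (ah_tEp Ac) (ah_tV Ac).
by nc (tt, rh_Kf H, rh_KEp H, rh_Vf H, rh_VEp H, rh_Kb H, rh_Vb H, tr_VK T).
Qed.

Lemma s_B1 : s B1 = alpha *: qbr B1 a q.
Proof.
rewrite /beta_core; hom Hs; rewrite (ah_sb Ac) (ah_sf Ac) (ah_sEp Ac) (ah_sV Ac).
by nc (tt, rh_fa H, rh_Epa H, rh_Va H).
Qed.

Lemma PB1 : P B1.
Proof. by rewrite /beta_core; inP. Qed.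

(** Up to the torus factor K V, t(s b) is the commutator of [b] with [W], which [comm_b_W] expresses
    through [B0]. Absorbing K V turns K' into V, and so [B0] into [B1]. *)
Lemma sts_b : s (t (s b)) = C *: B1.
Proof.
have E : t (s b) = (alpha * C) *: (a * B1 - q *: (B1 * a)).
  rewrite (ah_sb Ac); hom Ht; rewrite (ah_tb Ac) (ah_ta Ac).
  have KY : K * Y = Y * K by nc (tt, rh_Kb H, rh_Kf H, rh_K'b H').
  have VY : V * Y = Y * V by nc (tt, rh_Vb H, rh_Vf H, rh_V'b H').
  have KW : K * V * W = q *: (W * K * V).
    set R := Y in KY VY *.
    by nc (tt, KY, VY, rh_Ka H, rh_Va H, tr_VK T, tr_X'K T, tr_VX' T).
  transitivity ((alpha * C) *: ((b * W - W * b) * (K * V))).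
    transitivity ((alpha * C * q^-1) *: (b * (K * V * W) - q *: (W * (b * K * V)))).
      by set w := W; nc tt.
    by rewrite KW; set w := W; nc tt.
  rewrite (comm_b_W q_neq0 q2_neq1 q2_neqN1 H H' T).
  have -> : B1 = B0 * K * V.
    by set R := beta_core q b f Ep; nc (tt, tr_K'K T).
  set w := W; set R := B0.
  by nc (tt, rh_Ka H, rh_Va H, tr_VK T).
have E1 : L' * B1 = q^-1 *: (B1 * L').
  by rewrite /beta_core; nc (tt, rh_L'b H, rh_L'f H, rh_L'Ep H, tr_L'V T).
have V_a' : a' * V = V * a'.
  by have := rh_V'a H'; rewrite /qcomm scale1r => ->.
have E2 : a' * B1 = B1 * a'.
  rewrite /beta_core.
  by nc (tt, esym (rh_b'a H'), esym (rh_ga H'), esym (rh_Ema H'), V_a').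
have E3 : a * a' = a' * a + (ca * nu) *: (L - L') by apply: rh_aa' H.
have E4 : L * B1 = q *: (B1 * L).
  by rewrite /beta_core; nc (tt, rh_Lb H, rh_Lf H, rh_LEp H, tr_LV T).
move: PB1 s_B1 E E1 E2 E4; move: B1 => R PR sR E E1 E2 E4.
rewrite E; hom Hs; rewrite sR (ah_sa Ac).
(* [a'] commutes with [B1], so the double bracket collapses, through the commutator of [a] and [a'],
   to c_{r-1} q^2 [B1]; alpha^2 q^-1 removes the factor. *)
transitivity ((alpha ^+ 2 * C) *: (q^-1 *: (qbr (a' * L') (qbr R a q) q))); first by nc tt.
rewrite alpha2.
by nc (tt, E1, esym E2, E3, E4, rh_L'a H, rh_La H, tr_LL' T, tr_L'L T).
Qed.

(** Both sides equal C q^-1 B1 K V: on K V the map s t s is the identity, because the second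
    application of [s] removes the factor L introduced by the first. *)
Lemma braid_b : t (s (t (s b))) = s (t (s (t b))).
Proof.
move: PB1 sts_b t_B1; move: B1 => R PR stsR tR.
rewrite stsR (ah_tb Ac); hom Ht; hom Hs; rewrite tR (ah_sK Ac) (ah_sV Ac).
hom Ht; rewrite (ah_tK Ac) (ah_tV Ac) (ah_tL Ac); hom Hs.
rewrite stsR (ah_sK Ac) (ah_sV Ac) (ah_sL Ac).
by nc (tt, tr_LL' T).
Qed.

Lemma braid_outer a2 : P a2 -> s a2 = alpha *: qbr a2 a q -> t a2 = a2 ->
  a2 * b = b * a2 -> a2 * b' = b' * a2 -> a2 * f = f * a2 -> a2 * a' = a' * a2 ->
  K * a2 = a2 * K -> X' * a2 = a2 * X' -> L * a2 = q *: (a2 * L) ->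
  L' * a2 = q^-1 *: (a2 * L') ->
  t (s (t (s a2))) = s (t (s (t a2))).
Proof.
move=> Pa2 sa2 ta2 E1 E2 E3 E4 E5 E6 E7 E8.
rewrite ta2 sa2; hom Ht; hom Hs; hom Ht; hom Hs.
rewrite ta2 sa2; hom Ht; rewrite ta2 tst_a st_a (ah_ta Ac).
have := outer_braid_expand q_neq0 q2_neq1 q2_neqN1 H H' T E1 E2 E3 E4 E5 E6 E7 E8.
set w := W; set R := Y; set M := K * X' => E.
transitivity ((alpha * alpha * C) *: qbr (qbr a2 w q) a' q); first by nc tt.
by rewrite E; nc tt.
Qed.
End Half.

(** The composite t s t exchanges [a] with [a'] and L with L', while [s] is symmetric under this
    exchange. *)
Lemma braid_inner P s t C alpha ca c c' a a' b b' f g Ep Em K K' X X' V V' L L' :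
  q != 0 -> q ^+ 2 - 1 != 0 -> q ^+ 2 + 1 != 0 ->
  ca != 0 -> c != 0 -> c' != 0 ->
  alpha ^+ 2 = (q * ca)^-1 -> C ^+ 2 = (q * c * c')^-1 ->
  rel_half q ca c c' a a' b b' f g Ep Em K K' X X' V V' L L' ->
  rel_half q ca c' c a' a b' b g f Em Ep K' K X X' V' V L' L ->
  torus_rels K K' X X' V V' L L' -> subalg P -> hom_on P s -> hom_on P t ->
  act_half P s t C alpha c' a a' b b' f Ep K X' V L L' ->
  act_half P s t C alpha c a' a b' b g Em K' X' V' L' L ->
  t (s (t (s a))) = s (t (s (t a))).
Proof.
move=> q0 q1 qN1 ca0 c0 c'0 al2 C2 H H' T SP Hs Ht Ac Ac'.
have C2' : C ^+ 2 = (q * c' * c)^-1 by rewrite C2 mulrAC.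
have T' := torus_flip T.
rewrite (tst_a q0 q1 qN1 ca0 c0 c'0 al2 C2 H H' T SP Hs Ht Ac Ac').
rewrite (ah_sa Ac) (ho_Z Ht) ?(ho_M Ht) ?(ho_Z Hs) ?(ho_M Hs) ?(ho_Z Ht) ?(ho_M Ht).
all: try by do ?[apply: (ho_P Hs) | apply: (ho_P Ht) | apply: (sa_M SP)];
  first [exact: (ah_Pa Ac') | exact: (ah_PL Ac')].
rewrite (tst_a q0 q1 qN1 ca0 c'0 c0 al2 C2' H' H T' SP Hs Ht Ac' Ac).
by rewrite (ah_tL Ac') (ah_sL Ac') (ah_tL Ac) (ah_sa Ac').
Qed.
End Actions.
Unset Default Proof Using.

(** * The rank two relations in the quantum group *)

Section Half.
Variables (F : fieldType) (A : algType F) (n : nat) (t : F) (r l : nat).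
Local Notation q := (qq t).
Local Notation ta := (tauI n).
Hypotheses (q_neq0 : q != 0) (q2_neq1 : q ^+ 2 - 1 != 0) (q2_neqN1 : q ^+ 2 + 1 != 0).
Hypotheses (r_gt1 : (1 < r)%N) (n_eq : n = (r + r + l.+1)%N).

Let r_gt0 : (0 < r)%N. Proof. exact: ltnW. Qed.

(* [x_gap i] is alpha_i - alpha_{tau i} and [x_varpi] is varpi'_{r+1}. *)
Definition x_gap i k : int := root i i.+1 k + root (ta i).+1 (ta i) k.
Definition x_gapN i k : int := root i.+1 i k + root (ta i) (ta i).+1 k.
Definition x_varpi k : int := (k <= r.+1)%N%:Z - (k <= r.+1 + l)%N%:Z.
Definition x_varpiN k : int := (k <= r.+1 + l)%N%:Z - (k <= r.+1)%N%:Z.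

Local Ltac x_lia := rewrite /inI /x_gap /x_gapN /x_varpi /x_varpiN /root /tauI; lia.

Section Rels.
Variables (E Fg : nat -> A) (Kw : weight n -> A).
Hypothesis rels : Uq_rels t E Fg Kw.
Local Notation Kx x := (Kw (wt n x)).

Lemma Kx_inv x y : (forall k, x k + y k = 0) -> Kx x * Kx y = 1.
Proof.
move=> xy; rewrite -(Kw_D q_neq0 q2_neq1 q2_neqN1 rels) wtD.
rewrite (_ : wt n _ = 0) ?(Kw_0 q_neq0 q2_neq1 q2_neqN1 rels) //.
by rewrite -[RHS](@wt0 n); apply: eq_wt => k _; rewrite !xy.
Qed.

Lemma torus_rels_Kw :
  torus_rels (Kx (x_gap r)) (Kx (x_gapN r)) (Kx (root r.+1 (r.+1 + l).+1))
    (Kx (root (r.+1 + l).+1 r.+1)) (Kx x_varpi) (Kx x_varpiN)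
    (Kx (x_gap r.-1)) (Kx (x_gapN r.-1)).
Proof.
by split; (apply: (Kw_comm q_neq0 q2_neq1 q2_neqN1 rels)) || (apply: Kx_inv => k; x_lia).
Qed.

Lemma rel_half_Uq ca c c' :
  rel_half q ca c c' (Bi E Fg Kw r.-1 ca) (Bi' E Fg Kw r.-1 ca)
    (Br t E Fg Kw r l c) (Br' t E Fg Kw r l c')
    (chain q Fg r.+1 l) (dchain q Fg r.+1 l) (chain q^-1 E r.+1 l) (dchain q^-1 E r.+1 l)
    (Kx (x_gap r)) (Kx (x_gapN r)) (Kx (root r.+1 (r.+1 + l).+1))
    (Kx (root (r.+1 + l).+1 r.+1)) (Kx x_varpi) (Kx x_varpiN)
    (Kx (x_gap r.-1)) (Kx (x_gapN r.-1)).
Proof.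
have Er : r.-1.+1 = r by lia.
have aF j : (r < j <= r.+1 + l)%N -> Bi E Fg Kw r.-1 ca * Fg j = Fg j * Bi E Fg Kw r.-1 ca.
  by move=> Hj; apply: (Bi_F q_neq0 q2_neq1 q2_neqN1 rels r_gt0 n_eq) => //; lia.
have aE j : (r < j <= r.+1 + l)%N -> Bi E Fg Kw r.-1 ca * E j = E j * Bi E Fg Kw r.-1 ca.
  by move=> Hj; apply: (Bi_E q_neq0 q2_neq1 q2_neqN1 rels r_gt0 n_eq) => //; lia.
have bE j : (r < j <= r.+1 + l)%N -> Br t E Fg Kw r l c * E j = E j * Br t E Fg Kw r l c.
  exact: (Br_E q_neq0 q2_neq1 q2_neqN1 rels r_gt0 n_eq).
have Ka x z : x r - x r.-1 = z -> x r.-1 = x (ta r.-1).+1 -> x r = x (ta r.-1) ->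
    qcomm (Kx x) (Bi E Fg Kw r.-1 ca) (q ^ z).
  move=> H1 H2 H3; apply: (KBi q_neq0 q2_neq1 q2_neqN1 rels r_gt0 n_eq); rewrite ?Er //; lia.
have Kb x z : x r.+1 - x r = z -> x r = x (r.+1 + l.+1).+1 ->
    qcomm (Kx x) (Br t E Fg Kw r l c) (q ^ z).
  exact: (KBr q_neq0 q2_neq1 q2_neqN1 rels r_gt0 n_eq).
have Kf x z : x r.+1 - x (r.+1 + l).+1 = - z -> qcomm (Kx x) (chain q Fg r.+1 l) (q ^ z).
  by apply: (KF_chain q_neq0 q2_neq1 q2_neqN1 rels) => //; lia.
have KEp x z : x r.+1 - x (r.+1 + l).+1 = z -> qcomm (Kx x) (chain q^-1 E r.+1 l) (q ^ z).
  by apply: (KE_chain q_neq0 q2_neq1 q2_neqN1 rels) => //; lia.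
have KEm x z : x r.+1 - x (r.+1 + l).+1 = z -> qcomm (Kx x) (dchain q^-1 E r.+1 l) (q ^ z).
  by apply: (KE_dchain q_neq0 q2_neq1 q2_neqN1 rels) => //; lia.
have [S1 S2] := Bi_Br_serre q_neq0 q2_neq1 q2_neqN1 rels r_gt0 n_eq ca c r_gt1.
split=> //.
- by symmetry; apply: chain_comm => j Hj; apply: aF; lia.
- by symmetry; apply: dchain_comm => j Hj; apply: aF; lia.
- by symmetry; apply: chain_comm => j Hj; apply: aE; lia.
- by symmetry; apply: dchain_comm => j Hj; apply: aE; lia.
- symmetry; apply: (Bi_Br'_comm q_neq0 q2_neq1 q2_neqN1 rels r_gt0 n_eq); lia.
- by symmetry; apply: chain_comm => j Hj; apply: bE; lia.
- by symmetry; apply: dchain_comm => j Hj; apply: bE; lia.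
- exact: (Br_f_serre q_neq0 q2_neq1 q2_neqN1 rels r_gt0 n_eq).
- by apply: (sl2_chain q_neq0 q2_neq1 q2_neqN1 rels) => //; lia.
- exact: (Br_Br' q_neq0 q2_neq1 q2_neqN1 rels r_gt0 n_eq).
- apply: (Bi_Bi' q_neq0 q2_neq1 q2_neqN1 rels r_gt0 n_eq); lia.
- exact: (Br_fg q_neq0 q2_neq1 q2_neqN1 rels r_gt0 n_eq).
- by apply: (Ka _ 1); x_lia.
- by apply: (Kb _ (- 2%:Z)); x_lia.
- by apply: (Kf _ 0); x_lia.
- by apply: (KEp _ 0); x_lia.
- by apply: (KEm _ 0); x_lia.
- by apply: (Ka _ (-1)); x_lia.
- by apply: (Kb _ 2); x_lia.
- by apply: (Kf _ 0); x_lia.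
- by apply: (KEp _ 0); x_lia.
- by apply: (KEm _ 0); x_lia.
- by apply: (Ka _ 0); x_lia.
- by apply: (Kb _ 1); x_lia.
- by apply: (Kf _ (- 2%:Z)); x_lia.
- by apply: (Ka _ 0); x_lia.
- by apply: (Kb _ (-1)); x_lia.
- by apply: (Kf _ 2); x_lia.
- by apply: (Ka _ 0); x_lia.
- by apply: (Kb _ 0); x_lia.
- by apply: (Kf _ 0); x_lia.
- by apply: (Ka _ 0); x_lia.
- by apply: (Kb _ 0); x_lia.
- by apply: (Kf _ 0); x_lia.
- by apply: (KEp _ 0); x_lia.
- by apply: (KEm _ 0); x_lia.
- by apply: (KEp _ 0); x_lia.
- by apply: (KEm _ 0); x_lia.
- by apply: (Ka _ (- 2%:Z)); x_lia.
- by apply: (Kb _ 1); x_lia.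
- by apply: (Kf _ 0); x_lia.
- by apply: (KEp _ 0); x_lia.
- by apply: (KEm _ 0); x_lia.
- by apply: (Ka _ 2); x_lia.
- by apply: (Kb _ (-1)); x_lia.
- by apply: (Kf _ 0); x_lia.
- by apply: (KEp _ 0); x_lia.
- by apply: (KEm _ 0); x_lia.
Qed.
End Rels.
End Half.

(** * The mirror relations and the identification of the generators *)

Section HalfFlip.
Variables (F : fieldType) (A : algType F) (n : nat) (t : F) (r l : nat).
Local Notation q := (qq t).
Local Notation ta := (tauI n).
Hypotheses (q_neq0 : q != 0) (q2_neq1 : q ^+ 2 - 1 != 0) (q2_neqN1 : q ^+ 2 + 1 != 0).
Hypotheses (r_gt1 : (1 < r)%N) (n_eq : n = (r + r + l.+1)%N).
Variables (E Fg : nat -> A) (Kw : weight n -> A).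
Hypothesis rels : Uq_rels t E Fg Kw.
Local Notation Kx x := (Kw (wt n x)).
Set Default Proof Using "All".

Let ta_X : ta (r.+1 + l) = r.+1. Proof. by rewrite /tauI; lia. Qed.

Lemma chain_tau (s : F) (x : nat -> A) :
  chain s (fun j => x (ta j)) r.+1 l = dchain s x r.+1 l.
Proof. by rewrite (@dchain_flip _ _ n) ?ta_X //; lia. Qed.

Lemma dchain_tau (s : F) (x : nat -> A) :
  dchain s (fun j => x (ta j)) r.+1 l = chain s x r.+1 l.
Proof. by rewrite (@chain_flip _ _ n) ?ta_X //; lia. Qed.

Lemma Kw_tauw (x y : nat -> int) :
  (forall k, (0 < k <= n.+1)%N -> - x (n.+2 - k)%N = y k) -> Kw (tauw (wt n x)) = Kx y.
Proof.
move=> xy; rewrite tauw_wt; congr Kw; apply: eq_wt => k; rewrite /inI => Hk.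
by rewrite !xy //; lia.
Qed.

Lemma Bi'_tau i c : (0 < i <= n)%N ->
  Bi' (fun j => E (ta j)) (fun j => Fg (ta j)) (fun mu => Kw (tauw mu)) i c = Bi E Fg Kw i c.
Proof.
by move=> Hi; rewrite /Bi' /Bi tauwK !tauIK // /inI /tauI; lia.
Qed.

Lemma Br'_tau c :
  Br' t (fun j => E (ta j)) (fun j => Fg (ta j)) (fun mu => Kw (tauw mu)) r l c
  = Br t E Fg Kw r l c.
Proof.
rewrite /Br' /Br tauwK tauIK; last by rewrite /inI; lia.
congr (_ - _ *: (_ * _)); apply: eq_qchain => [j|].
  by rewrite mem_iota => Hj; rewrite tauIK // /inI; lia.
by rewrite tauIK // /inI; lia.
Qed.

Local Ltac x_lia := rewrite /x_gap /x_gapN /x_varpi /x_varpiN /root /tauI; lia.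

(** [rel_half_Uq] for the relabelled data with c and c' exchanged; relabelling twice restores the
    original generators, and the torus elements are translated by [Kw_tauw]. *)
Lemma rel_half_Uq_flip ca c c' :
  rel_half q ca c' c (Bi' E Fg Kw r.-1 ca) (Bi E Fg Kw r.-1 ca)
    (Br' t E Fg Kw r l c') (Br t E Fg Kw r l c)
    (dchain q Fg r.+1 l) (chain q Fg r.+1 l) (dchain q^-1 E r.+1 l) (chain q^-1 E r.+1 l)
    (Kx (x_gapN n r)) (Kx (x_gap n r)) (Kx (root r.+1 (r.+1 + l).+1))
    (Kx (root (r.+1 + l).+1 r.+1)) (Kx (x_varpiN r l)) (Kx (x_varpi r l))
    (Kx (x_gapN n r.-1)) (Kx (x_gap n r.-1)).
Proof.
have := rel_half_Uq q_neq0 q2_neq1 q2_neqN1 r_gt1 n_eq (Uq_rels_flip rels) ca c' c.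
cbv beta; rewrite !chain_tau !dchain_tau Br'_tau Bi'_tau; last by lia.
rewrite (@Kw_tauw _ (x_gapN n r)); last by move=> k Hk; x_lia.
rewrite (@Kw_tauw _ (x_gap n r)); last by move=> k Hk; x_lia.
rewrite (@Kw_tauw _ (root r.+1 (r.+1 + l).+1)); last by move=> k Hk; x_lia.
rewrite (@Kw_tauw _ (root (r.+1 + l).+1 r.+1)); last by move=> k Hk; x_lia.
rewrite (@Kw_tauw _ (x_varpiN r l)); last by move=> k Hk; x_lia.
rewrite (@Kw_tauw _ (x_varpi r l)); last by move=> k Hk; x_lia.
rewrite (@Kw_tauw _ (x_gapN n r.-1)); last by move=> k Hk; x_lia.
rewrite (@Kw_tauw _ (x_gap n r.-1)); last by move=> k Hk; x_lia.
by [].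
Qed.

Lemma EXpE : EXp n r t E = chain q^-1 E r.+1 l.
Proof.
have -> : EXp n r t E = qchain (qq t)^-1 E (iota r.+1 (n - r - r).-1) (E (n - r)%N) by [].
have -> : (n - r)%N = (r.+1 + l)%N by lia.
by have -> : (r.+1 + l - r).-1 = l by lia.
Qed.

Lemma FXpE : FXp n r t Fg = chain q Fg r.+1 l.
Proof.
have -> : FXp n r t Fg = qchain (qq t) Fg (iota r.+1 (n - r - r).-1) (Fg (n - r)%N) by [].
have -> : (n - r)%N = (r.+1 + l)%N by lia.
by have -> : (r.+1 + l - r).-1 = l by lia.
Qed.

Lemma EXmE : EXm n r t E = dchain q^-1 E r.+1 l.
Proof.
have -> : EXm n r t E = qchain (qq t)^-1 E (rev (iota r.+2 (n - r - r).-1)) (E r.+1) by [].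
by have -> : (n - r - r).-1 = l by lia.
Qed.

Lemma FXmE : FXm n r t Fg = dchain q Fg r.+1 l.
Proof.
have -> : FXm n r t Fg = qchain (qq t) Fg (rev (iota r.+2 (n - r - r).-1)) (Fg r.+1) by [].
by have -> : (n - r - r).-1 = l by lia.
Qed.

Lemma LwE i : inI n i -> Lw Kw i = Kx (x_gap n i).
Proof.
move=> Hi; rewrite /Lw !sroot_wt ?tauI_in // wtB; congr Kw; apply: eq_wt => k _.
by rewrite /x_gap /root; lia.
Qed.

Lemma Lw_tau i : inI n i -> Lw Kw (ta i) = Kx (x_gapN n i).
Proof.
move=> Hi; rewrite /Lw tauIK // !sroot_wt ?tauI_in // wtB; congr Kw; apply: eq_wt => k _.
by rewrite /x_gapN /root; lia.
Qed.

Lemma KXwE : Kw (- KXw n r) = Kx (root (r.+1 + l).+1 r.+1).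
Proof.
have -> : KXw n r = wt n (root r.+1 (r.+1 + l).+1).
  rewrite /KXw (_ : (n - r - r)%N = l.+1); last by lia.
  have : (r.+1 + l <= n)%N by lia.
  elim: (l) => [|k IH] Hk.
    by rewrite big_seq1 addn0 sroot_wt //; rewrite /inI; lia.
  rewrite -[k.+2]addn1 iotaD big_cat /= big_seq1 IH; last by lia.
  rewrite sroot_wt; last by rewrite /inI; lia.
  by rewrite wtD; apply: eq_wt => j _; rewrite /root; lia.
by rewrite wtN; congr Kw; apply: eq_wt => k _; rewrite /root; lia.
Qed.

Lemma fweightE i : fweight n i = wt n (fun k => (k <= i)%N%:Z).
Proof. by apply: weightP => j Hj; rewrite wc_wt // wc_w_of //; lia. Qed.

Lemma varpi'E : Kw (varpi' n r.+1) = Kx (x_varpi r l).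
Proof.
rewrite /varpi' !fweightE wtB; congr Kw; apply: eq_wt => k _.
by rewrite /x_varpi /tauI; lia.
Qed.

Lemma varpi'_tauE : Kw (varpi' n (ta r.+1)) = Kx (x_varpiN r l).
Proof.
rewrite /varpi' !fweightE wtB tauIK; last by rewrite /inI; lia.
by congr Kw; apply: eq_wt => k _; rewrite /x_varpiN /tauI; lia.
Qed.

Variable c : nat -> F.
Local Notation B := (Bg r t E Fg Kw c).

Lemma Bg_r : B r = Br t E Fg Kw r l (c r).
Proof.
have Ef := E_far q_neq0 q2_neq1 q2_neqN1 rels.
have Es := E_serre q_neq0 q2_neq1 q2_neqN1 rels.
have qV0 : q^-1 != 0 by rewrite invr_eq0.
have qV2 := inv_sqr_add1_neq0 q_neq0 q2_neqN1.
rewrite /Bg eqxx EXpE /Br (chain_rcons qV0 qV2 Ef Es) //; last by lia.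
rewrite (Kinv_wt q_neq0 q2_neq1 q2_neqN1 rels); last by rewrite /inI; lia.
by rewrite (_ : ta r = (r.+1 + l.+1)%N) // /tauI; lia.
Qed.

Lemma Bg_tau_r : B (ta r) = Br' t E Fg Kw r l (c (ta r)).
Proof.
have r0 : (0 < r)%N by lia.
rewrite (Br'E q_neq0 q2_neq1 q2_neqN1 rels r0 n_eq) /Bg eqxx.
rewrite (_ : ta r == r = false); last by rewrite /tauI; lia.
rewrite EXmE dchainS; last first.
  by move=> j Hj; symmetry; apply: (E_far q_neq0 q2_neq1 q2_neqN1 rels); lia.
by rewrite (Kinv_wt q_neq0 q2_neq1 q2_neqN1 rels) //; apply: tauI_in; rewrite /inI; lia.
Qed.

Lemma Bg_i i : (0 < i < r)%N -> B i = Bi E Fg Kw i (c i).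
Proof.
move=> Hi; have Iin : inI n i by rewrite /inI; lia.
have E1 : i == r = false by lia.
have E2 : i == ta r = false by rewrite /tauI; lia.
by rewrite /Bg E1 E2 (Kinv_wt q_neq0 q2_neq1 q2_neqN1 rels).
Qed.

Lemma Bg_tau_i i : (0 < i < r)%N -> B (ta i) = Bi' E Fg Kw i (c (ta i)).
Proof.
have r0 : (0 < r)%N by lia.
move=> Hi; rewrite (Bi'E q_neq0 q2_neq1 q2_neqN1 rels r0 n_eq) // /Bg.
have Iin : inI n i by rewrite /inI; lia.
have E1 : ta i == r = false by rewrite /tauI; lia.
have E2 : ta i == ta r = false by rewrite /tauI; lia.
by rewrite E1 E2 tauIK // (Kinv_wt q_neq0 q2_neq1 q2_neqN1 rels) // tauI_in.
Qed.
End HalfFlip.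
Unset Default Proof Using.

Lemma is_alg_aut_hom (F : fieldType) (A : algType F) (P : A -> Prop) (h : A -> A) :
  is_alg_aut_on P h -> hom_on P h.
Proof. by case=> ? [? [? [? _]]]; split. Qed.

(** * Lusztig automorphisms along the word of tau_r *)

Lemma foldr_fix (S : Type) (T : nat -> S -> S) (x : S) (w : seq nat) :
  (forall i, i \in w -> T i x = x) -> foldr T x w = x.
Proof.
elim: w => [|i w IH] H //=; rewrite IH; first by apply: H; rewrite mem_head.
by move=> j Hj; apply: H; rewrite in_cons Hj orbT.
Qed.

Lemma iota_split r m j : (r < j < r + m)%N ->
  iota r m = iota r (j.-1 - r) ++ [:: j.-1; j] ++ iota j.+1 (r + m - j.+1).
Proof.
move=> Hj; have -> : m = ((j.-1 - r) + (2 + (r + m - j.+1)))%N by lia.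
rewrite !iotaD; have -> : (r + (j.-1 - r))%N = j.-1 by lia.
have -> : (r + (j.-1 - r + (2 + (r + m - j.+1))) - j.+1 = r + m - j.+1)%N by lia.
have -> : (j.-1 + 2 = j.+1)%N by lia.
by rewrite /= (_ : j.-1.+1 = j) //; lia.
Qed.

(* The word is a reduced expression of the reflection in the highest root of the interval
   [r, r + l + 2], which is orthogonal to the inner simple roots. *)
Lemma reflection_word_fix (S : Type) (T : nat -> S -> S) (G : nat -> S) (r l j : nat) :
  (forall i k, (r <= i <= r + l.+2)%N -> (r <= k <= r + l.+1)%N ->
     (i.+1 < k)%N || (k.+1 < i)%N -> T i (G k) = G k) ->
  (forall i k, (r <= i <= r + l.+2)%N -> (r <= k <= r + l.+2)%N ->
     (i.+1 == k) || (k.+1 == i) -> T k (T i (G k)) = G i) ->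
  (r < j <= r + l.+1)%N ->
  foldr T (G j) (iota r l.+3 ++ rev (iota r l.+2)) = G j.
Proof.
move=> Tfar Tadj Hj; rewrite foldr_cat.
(* Only the neighbours j-1 and j act nontrivially: the pass with increasing indices turns G_j into
   G_{j-1}, and the pass with decreasing indices turns it back. *)
rewrite (@iota_split r l.+2 j) 1?(@iota_split r l.+3 j); try lia.
rewrite !rev_cat !foldr_cat /=.
rewrite (foldr_fix (w := rev (iota r _))); last first.
  by move=> i; rewrite mem_rev mem_iota => Hi; apply: Tfar; lia.
rewrite Tadj; try lia.
rewrite (foldr_fix (w := rev (iota j.+1 _))); last first.
  by move=> i; rewrite mem_rev mem_iota => Hi; apply: Tfar; lia.
rewrite (foldr_fix (w := iota j.+1 _)); last first.
  by move=> i; rewrite mem_iota => Hi; apply: Tfar; lia.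
rewrite Tadj; try lia.
by apply: foldr_fix => i; rewrite mem_iota => Hi; apply: Tfar; lia.
Qed.

Section LusztigAction.
Set Default Proof Using "All".
Variables (F : fieldType) (A : algType F) (n : nat) (t : F).
Variables (E Fg : nat -> A) (Kw : weight n -> A) (T : nat -> A -> A).
Local Notation q := (qq t).
Hypotheses (q_neq0 : q != 0) (q2_neq1 : q ^+ 2 - 1 != 0) (q2_neqN1 : q ^+ 2 + 1 != 0).
Hypotheses (rels : Uq_rels t E Fg Kw) (Lus : Lusztig t E Fg Kw T).

Lemma Lusztig_far i j : inI n i -> inI n j -> (i.+1 < j)%N || (j.+1 < i)%N ->
  T i (E j) = E j /\ T i (Fg j) = Fg j.
Proof.
move=> Hi Hj ij; have [_ [_ [_ [_ [H _]]]]] := Lus Hi.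
by apply: H => //; rewrite /cartan; idx_lia.
Qed.

Lemma Lusztig_Kw i mu : inI n i -> T i (Kw mu) = Kw (srefl i mu).
Proof. by move=> Hi; have [_ [_ [_ [H _]]]] := Lus Hi. Qed.

(** A rank two computation from the values on generators: the torus part of the commutator of E_j
    and F_j releases the generator of index i. *)
Lemma Lusztig_adj i j : inI n i -> inI n j -> (i.+1 == j) || (j.+1 == i) ->
  T j (T i (E j)) = E i /\ T j (T i (Fg j)) = Fg i.
Proof.
move=> Hi Hj ij.
have Cij : cartan i j = -1 by rewrite /cartan; idx_lia.
have Cji : cartan j i = -1 by rewrite /cartan; idx_lia.
have [_ [_ [_ [_ [_ /(_ j Hj Cij) [Ei Fi]]]]]] := Lus Hi.
have [Hom [Ej [Fj [_ [_ /(_ i Hi Cji) [Eji Fji]]]]]] := Lus Hj.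
have Th := is_alg_aut_hom Hom.
have TT : subalg (fun _ : A => True) by [].
have Sg1 : wc (sroot n j) i = -1 by rewrite wc_w_of // Cij.
have Sg2 : wc (sroot n j) j = 2 by rewrite wc_w_of // /cartan eqxx.
have [_ [_ [KE [KF [EF _]]]]] := rels.
have R1 := EF j j Hj Hj; rewrite eqxx in R1.
have ji : j == i = false by lia.
have ij' : i == j = false by lia.
have R2 := EF i j Hi Hj; rewrite ij' in R2.
have R3 := EF j i Hj Hi; rewrite ji in R3.
have K1 := KE (sroot n j) i Hi; have K2 := KE (sroot n j) j Hj.
have K3 := KF (sroot n j) i Hi; have K4 := KF (sroot n j) j Hj.
have K5 := KE (- sroot n j) i Hi; have K6 := KE (- sroot n j) j Hj.
have K7 := KF (- sroot n j) i Hi; have K8 := KF (- sroot n j) j Hj.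
rewrite ?wcN ?Sg1 ?Sg2 ?opprK in K1 K2 K3 K4 K5 K6 K7 K8.
rewrite -[q ^ 2]/(q ^+ 2) -?[q ^ (- 2)]/(q ^- 2) ?exprN1 ?expr1z in K1 K2 K3 K4 K5 K6 K7 K8.
have KK : Ki Kw j * Kinv Kw j = 1 by apply: (Kw_V q_neq0 q2_neq1 q2_neqN1 rels).
have KK' : Kinv Kw j * Ki Kw j = 1 by apply: (Kw_V' q_neq0 q2_neq1 q2_neqN1 rels).
have R1' : E j * Fg j = Fg j * E j + (q - q^-1)^-1 *: (Ki Kw j - Kinv Kw j).
  by rewrite -R1 addrC subrK.
have R2' : E i * Fg j = Fg j * E i by apply/subr0_eq.
have R3' : E j * Fg i = Fg i * E j by apply/subr0_eq.
rewrite Ei Fi !(ho_qbr _ TT Th) // Ej Fj Eji Fji.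
rewrite -/(Ki Kw j) -/(Kinv Kw j) in K1 K2 K3 K4 K5 K6 K7 K8.
split.
  by nc (tt, R1', R2', K1, K2, K4, K5, K6, K8, KK, KK').
by nc (tt, R1', R3', K1, K2, K3, K4, K5, K6, K7, K8, KK, KK').
Qed.

Variables (r l : nat).
Hypotheses (r_gt1 : (1 < r)%N) (n_eq : n = (r + r + l.+1)%N).

Let word_eq : tauR_word n r = iota r l.+3 ++ rev (iota r l.+2).
Proof.
have E1 : (n - r - r)%N = l.+1 by lia.
by rewrite /tauR_word E1.
Qed.

Lemma tauR_word_E j : inX n r j -> foldr T (E j) (tauR_word n r) = E j.
Proof.
rewrite /inX word_eq => Hj; apply: reflection_word_fix; last by lia.
- by move=> i k Hi Hk ik; case: (@Lusztig_far i k) => //; rewrite /inI; lia.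
- by move=> i k Hi Hk ik; case: (@Lusztig_adj i k) => //; rewrite /inI; lia.
Qed.

Lemma tauR_word_F j : inX n r j -> foldr T (Fg j) (tauR_word n r) = Fg j.
Proof.
rewrite /inX word_eq => Hj; apply: reflection_word_fix; last by lia.
- by move=> i k Hi Hk ik; case: (@Lusztig_far i k) => //; rewrite /inI; lia.
- by move=> i k Hi Hk ik; case: (@Lusztig_adj i k) => //; rewrite /inI; lia.
Qed.

Lemma tauR_word_Kw mu : in_Theta r mu -> foldr T (Kw mu) (tauR_word n r) = Kw mu.
Proof.
move=> Hmu; have r0 : (0 < r)%N by lia.
have rn : (r <= n.+1./2 - 1)%N by lia.
rewrite -[in RHS](tauR_word_Theta r0 rn Hmu).
have : {in tauR_word n r, forall i, inI n i}.
  by move=> i; rewrite word_eq mem_cat mem_rev !mem_iota /inI; lia.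
elim: (tauR_word n r) => [|i w IH] //= Hw.
rewrite IH => [|k Hk]; first by rewrite Lusztig_Kw //; apply: Hw; rewrite mem_head.
by apply: Hw; rewrite in_cons Hk orbT.
Qed.
End LusztigAction.
Unset Default Proof Using.

(** * Extension from generators to the subalgebra *)

Lemma subalg_subalg_gen (F : fieldType) (A : algType F) (G : A -> Prop) :
  subalg (subalg_gen G).
Proof. by split=> *; [apply: sg_add|apply: sg_scale|apply: sg_mul]. Qed.

Lemma hom_on_comp (F : fieldType) (A : algType F) (P : A -> Prop) (g h : A -> A) :
  hom_on P g -> hom_on P h -> hom_on P (g \o h).
Proof.
move=> Hg Hh; split=> [x Px|x y Px Py|k x Px|x y Px Py] /=.
- exact/(ho_P Hg)/(ho_P Hh).
- by rewrite (ho_D Hh) // (ho_D Hg) //; apply: (ho_P Hh).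
- by rewrite (ho_Z Hh) // (ho_Z Hg) //; apply: (ho_P Hh).
- by rewrite (ho_M Hh) // (ho_M Hg) //; apply: (ho_P Hh).
Qed.

Lemma hom_on_eq (F : fieldType) (A : algType F) (G : A -> Prop) (g h : A -> A) :
  hom_on (subalg_gen G) g -> hom_on (subalg_gen G) h -> g 1 = 1 -> h 1 = 1 ->
  (forall x, G x -> g x = h x) -> forall x, subalg_gen G x -> g x = h x.
Proof.
move=> Hg Hh g1 h1 GH x; elim=> {x} [x /GH //||x y Px IHx Py IHy|k x Px IHx|x y Px IHx Py IHy].
- by rewrite g1 h1.
- by rewrite (ho_D Hg) // (ho_D Hh) // IHx IHy.
- by rewrite (ho_Z Hg) // (ho_Z Hh) // IHx.
- by rewrite (ho_M Hg) // (ho_M Hh) // IHx IHy.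
Qed.

Lemma qchain_ind (F : fieldType) (A : algType F) (Q : A -> Prop) (s : F) x l y :
  (forall u v, Q u -> Q v -> Q (qbr u v s)) -> (forall j, j \in l -> Q (x j)) -> Q y ->
  Q (qchain s x l y).
Proof.
move=> HQ Hl Hy; elim: l Hl => [|j l IH] Hl //=; apply: HQ.
  by apply: Hl; rewrite mem_head.
by apply: IH => k Hk; apply: Hl; rewrite in_cons Hk orbT.
Qed.

Lemma cartan_eqN1 i j : (cartan i j == -1) = (i == j.+1) || (j == i.+1).
Proof. by rewrite /cartan; idx_lia. Qed.

(** Used with u = tau_i, i < r-2, and v = tau_r at B_{r-1}: every ingredient of tau_r(B_{r-1}) is
    fixed by tau_i. *)
Lemma hom_fix_pred (F : fieldType) (A : algType F) (q C k : F) (P : A -> Prop)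
  (u v : A -> A) (a Y K X : A) :
  subalg P -> hom_on P u -> P a -> P Y -> P K -> P X ->
  v a = C *: (qbr a Y q + k *: (a * K * X)) ->
  u a = a -> u Y = Y -> u K = K -> u X = X -> u (v a) = v a.
Proof.
move=> SP Hu Pa PY PK PX va ua uY uK uX.
have PaY := sa_qbr q SP Pa PY.
have PaK := sa_M SP Pa PK; have PaKX := sa_M SP PaK PX.
have PkX : P (k *: (a * K * X)) by apply: (sa_Z SP).
have PS : P (qbr a Y q + k *: (a * K * X)) by apply: (sa_D SP).
rewrite va (ho_Z Hu) // (ho_D Hu) // (ho_Z Hu) // (ho_qbr _ SP Hu) // !(ho_M Hu) //.
by rewrite ua uY uK uX.
Qed.

(** Used with u = tau_{r-2}, v = tau_r, a = B_{r-1} and x = B_{r-2}: since [x] commutes with Y and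
    the torus factors, bracketing [a] with [x] and with Y can be done in either order. *)
Lemma comm_pred (F : fieldType) (A : algType F) (q C al k : F) (P : A -> Prop)
  (u v : A -> A) (a x Y K X : A) :
  subalg P -> hom_on P u -> hom_on P v -> P a -> P x -> P Y -> P K -> P X ->
  v a = C *: (qbr a Y q + k *: (a * K * X)) -> v x = x ->
  u a = al *: qbr a x q -> u Y = Y -> u K = K -> u X = X ->
  x * Y = Y * x -> x * K = K * x -> x * X = X * x -> v (u a) = u (v a).
Proof.
move=> SP Hu Hv Pa Px PY PK PX va vx ua uY uK uX E1 E2 E3.
have PaY := sa_qbr q SP Pa PY; have Pax := sa_qbr q SP Pa Px.
have PaK := sa_M SP Pa PK; have PaKX := sa_M SP PaK PX.
rewrite ua (ho_Z Hv) // (ho_qbr _ SP Hv) // vx va.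
have PkX : P (k *: (a * K * X)) by apply: (sa_Z SP).
have PS : P (qbr a Y q + k *: (a * K * X)) by apply: (sa_D SP).
rewrite (ho_Z Hu) // (ho_D Hu) // (ho_Z Hu) // (ho_qbr _ SP Hu) // !(ho_M Hu) //.
by rewrite ua uY uK uX; nc (tt, E1, E2, E3).
Qed.

Lemma root_swap i a b k : root a b (swap_idx i k) = root (swap_idx i a) (swap_idx i b) k.
Proof.
have E j : (swap_idx i k == j) = (k == swap_idx i j) by rewrite /swap_idx; idx_lia.
by rewrite /root !E.
Qed.

Lemma swap_idxK i k : swap_idx i (swap_idx i k) = k.
Proof. by rewrite /swap_idx; idx_lia. Qed.

Lemma swap_idxC i j k : (i.+1 < j)%N ->
  swap_idx j (swap_idx i k) = swap_idx i (swap_idx j k).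
Proof. by rewrite /swap_idx => ij; idx_lia. Qed.

Lemma leq_swap i m k : m != i -> (swap_idx i k <= m)%N = (k <= m)%N.
Proof. by rewrite /swap_idx => mi; idx_lia. Qed.

(** * The automorphisms on the generators *)

Section BraidAction.
Variables (F : fieldType) (A : algType F) (n r l : nat) (t : F).
Variables (E Fg : nat -> A) (Kw : weight n -> A) (c : nat -> F) (sq : F -> F).
Variables (T tau : nat -> A -> A).
Local Notation q := (qq t).
Local Notation ta := (tauI n).
Local Notation Kx x := (Kw (wt n x)).
Local Notation B := (Bg r t E Fg Kw c).
Local Notation P := (Bc r t E Fg Kw c).
Lemma BcP : subalg P. Proof. exact: subalg_subalg_gen. Qed.

Lemma P_E j : inX n r j -> P (E j).
Proof. by move=> Hj; apply: sg_gen; left; left; exists j; split=> //; left. Qed.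
Lemma P_F j : inX n r j -> P (Fg j).
Proof. by move=> Hj; apply: sg_gen; left; left; exists j; split=> //; right; left. Qed.
Lemma P_Kw mu : in_Theta r mu -> P (Kw mu).
Proof. by move=> Hm; apply: sg_gen; left; right; exists mu. Qed.
Lemma P_B i : inI n i -> ~~ inX n r i -> P (B i).
Proof. by move=> Hi Xi; apply: sg_gen; right; exists i. Qed.

Hypotheses (q_neq0 : q != 0) (q2_neq1 : q ^+ 2 - 1 != 0) (q2_neqN1 : q ^+ 2 + 1 != 0).
Hypotheses (r_gt1 : (1 < r)%N) (n_eq : n = (r + r + l.+1)%N).
Hypotheses (c_neq0 : forall i, inI n i -> ~~ inX n r i -> c i != 0)
  (c_tau : forall i, (0 < i < r)%N -> c (ta i) = c i)
  (sq_c : forall i, inI n i -> ~~ inX n r i -> sq (c i) ^+ 2 = c i).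
Hypotheses (rels : Uq_rels t E Fg Kw) (Lus : Lusztig t E Fg Kw T).
Hypothesis tau_small :
  forall i, (1 <= i <= r.-1)%N -> tau_small_spec r t E Fg Kw c sq T i (tau i).
Hypothesis tau_r : tau_r_spec r t E Fg Kw c sq T (tau r).
Set Default Proof Using "All".

Let r_gt0 : (0 < r)%N. Proof. exact: ltnW. Qed.
Let r_le : (r <= n.+1./2 - 1)%N. Proof. by lia. Qed.

Local Ltac inI_lia := rewrite /inI /inX /tauI; lia.

Lemma hom_small i : (0 < i < r)%N -> hom_on P (tau i).
Proof. by move=> Hi; have [/is_alg_aut_hom] := @tau_small i ltac:(lia). Qed.

Lemma hom_r : hom_on P (tau r).
Proof. by have [/is_alg_aut_hom] := tau_r. Qed.

Lemma tau_r_E j : inX n r j -> tau r (E j) = E j.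
Proof.
move=> Hj; have [_ [H _]] := tau_r; rewrite H.
  exact: (tauR_word_E q_neq0 q2_neq1 q2_neqN1 rels Lus r_gt1 n_eq).
by apply: sg_gen; left; exists j; split=> //; left.
Qed.

Lemma tau_r_F j : inX n r j -> tau r (Fg j) = Fg j.
Proof.
move=> Hj; have [_ [H _]] := tau_r; rewrite H.
  exact: (tauR_word_F q_neq0 q2_neq1 q2_neqN1 rels Lus r_gt1 n_eq).
by apply: sg_gen; left; exists j; split=> //; right; left.
Qed.

Lemma tau_r_Kw mu : in_Theta r mu -> tau r (Kw mu) = Kw mu.
Proof.
move=> Hm; have [_ [H _]] := tau_r; rewrite H.
  exact: (tauR_word_Kw q_neq0 q2_neq1 q2_neqN1 rels Lus r_gt1 n_eq).
by apply: sg_gen; right; exists mu.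
Qed.

Lemma tau_i_E i j : (0 < i < r)%N -> inX n r j -> tau i (E j) = E j.
Proof.
move=> Hi Hj; have [_ [H _]] := @tau_small i ltac:(lia); rewrite H; last first.
  by apply: sg_gen; left; exists j; split=> //; left.
move: Hj; rewrite /inX => Hj.
have [-> _] : T (ta i) (E j) = E j /\ T (ta i) (Fg j) = Fg j.
  by apply: (Lusztig_far q_neq0 q2_neq1 q2_neqN1 rels Lus); inI_lia.
have [-> //] : T i (E j) = E j /\ T i (Fg j) = Fg j.
by apply: (Lusztig_far q_neq0 q2_neq1 q2_neqN1 rels Lus); inI_lia.
Qed.

Lemma tau_i_F i j : (0 < i < r)%N -> inX n r j -> tau i (Fg j) = Fg j.
Proof.
move=> Hi Hj; have [_ [H _]] := @tau_small i ltac:(lia); rewrite H; last first.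
  by apply: sg_gen; left; exists j; split=> //; right; left.
move: Hj; rewrite /inX => Hj.
have [_ ->] : T (ta i) (E j) = E j /\ T (ta i) (Fg j) = Fg j.
  by apply: (Lusztig_far q_neq0 q2_neq1 q2_neqN1 rels Lus); inI_lia.
have [_ -> //] : T i (E j) = E j /\ T i (Fg j) = Fg j.
by apply: (Lusztig_far q_neq0 q2_neq1 q2_neqN1 rels Lus); inI_lia.
Qed.

Lemma tau_i_Kw i mu : (0 < i < r)%N -> in_Theta r mu ->
  tau i (Kw mu) = Kw (srefl i (srefl (ta i) mu)).
Proof.
move=> Hi Hm; have [_ [H _]] := @tau_small i ltac:(lia); rewrite H; last first.
  by apply: sg_gen; right; exists mu.
by rewrite !(Lusztig_Kw q_neq0 q2_neq1 q2_neqN1 rels Lus) //; inI_lia.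
Qed.

Lemma tau_i_Kx i x y : (0 < i < r)%N -> in_Theta r (wt n x) ->
  (forall k, (0 < k <= n.+1)%N -> x (swap_idx (ta i) (swap_idx i k)) = y k) ->
  tau i (Kx x) = Kx y.
Proof.
move=> Hi Hx xy; rewrite tau_i_Kw // !srefl_wt; try inI_lia.
congr Kw; apply: eq_wt => k /andP[k0 kn]; rewrite /= !xy //; lia.
Qed.

Lemma tau_i_self i : (0 < i < r)%N ->
  tau i (B i) = q^-1 *: (B (ta i) * Kx (x_gapN n i)) /\
  tau i (B (ta i)) = q^-1 *: (B i * Kx (x_gap n i)).
Proof.
move=> Hi; have [_ [_ H]] := @tau_small i ltac:(lia).
have Ii : inI n i by inI_lia.
split.
  by rewrite H; [|inI_lia|inI_lia]; rewrite eqxx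
    (Lw_tau q_neq0 q2_neq1 q2_neqN1 r_gt1 n_eq rels Ii).
rewrite H; [|inI_lia|inI_lia].
by rewrite eqxx orbT tauIK // (LwE q_neq0 q2_neq1 q2_neqN1 r_gt1 n_eq rels Ii).
Qed.

Lemma tau_i_adj i j : (0 < i < r)%N -> (0 < j <= r)%N -> (i == j.+1) || (j == i.+1) ->
  tau i (B j) = qcinvsqrt t c sq i *: qbr (B j) (B i) q /\
  tau i (B (ta j)) = qcinvsqrt t c sq i *: qbr (B (ta j)) (B (ta i)) q.
Proof.
move=> Hi Hj ij; have [_ [_ H]] := @tau_small i ltac:(lia).
split; (rewrite H; [|inI_lia|inI_lia]); rewrite !cartan_eqN1.
  by rewrite ij (_ : (j == i) || _ = false) //; rewrite /tauI; lia.
rewrite (_ : (ta j == i) || _ = false); last by rewrite /tauI; lia.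
rewrite (_ : (i == (ta j).+1) || _ = false); last by rewrite /tauI; lia.
rewrite (_ : (ta i == (ta j).+1) || _); last by rewrite /tauI; lia.
(* The chosen root depends only on the value of the parameter, so c_{tau(i)} = c_i gives the same
   scalar on both sides. *)
by rewrite /qcinvsqrt c_tau.
Qed.

Lemma tau_i_far i j : (0 < i < r)%N -> (0 < j <= r)%N ->
  (i.+1 < j)%N || (j.+1 < i)%N -> tau i (B j) = B j /\ tau i (B (ta j)) = B (ta j).
Proof.
move=> Hi Hj ij; have [_ [_ H]] := @tau_small i ltac:(lia).
split; (rewrite H; [|inI_lia|inI_lia]); rewrite !cartan_eqN1.
  rewrite (_ : (j == i) || _ = false); last by rewrite /tauI; lia.
  rewrite (_ : (i == j.+1) || _ = false); last by rewrite /tauI; lia.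
  by rewrite (_ : (ta i == j.+1) || _ = false) //; rewrite /tauI; lia.
rewrite (_ : (ta j == i) || _ = false); last by rewrite /tauI; lia.
rewrite (_ : (i == (ta j).+1) || _ = false); last by rewrite /tauI; lia.
by rewrite (_ : (ta i == (ta j).+1) || _ = false) //; rewrite /tauI; lia.
Qed.

Lemma tau_r_far j : (0 < j < r.-1)%N -> tau r (B j) = B j /\ tau r (B (ta j)) = B (ta j).
Proof.
move=> Hj; have [_ [_ H]] := tau_r.
have N i k : (0 < i < r.-1)%N -> (r.-1 <= k <= r)%N ->
    [/\ i == k = false, i == ta k = false, ta i == k = false & ta i == ta k = false].
  by move=> Hi Hk; split; rewrite /tauI; lia.
have [N1 N2 N3 N4] := @N j r Hj ltac:(lia).
have [N5 N6 N7 N8] := @N j r.-1 Hj ltac:(lia).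
by split; (rewrite H; [|inI_lia|inI_lia]); rewrite ?N1 ?N2 ?N3 ?N4 ?N5 ?N6 ?N7 ?N8.
Qed.

Lemma tau_r_r :
  tau r (B r) = q^-1 *: (B r * Kx (x_gap n r) * Kx (x_varpi r l)) /\
  tau r (B (ta r)) = q^-1 *: (B (ta r) * Kx (x_gapN n r) * Kx (x_varpiN r l)).
Proof.
have [_ [_ H]] := tau_r; have Ir : inI n r by inI_lia.
split; (rewrite H; [|inI_lia|inI_lia]).
  by rewrite eqxx (LwE q_neq0 q2_neq1 q2_neqN1 r_gt1 n_eq rels Ir)
    (varpi'E q_neq0 q2_neq1 q2_neqN1 r_gt1 n_eq rels).
rewrite eqxx (_ : ta r == r = false); last by rewrite /tauI; lia.
by rewrite (Lw_tau q_neq0 q2_neq1 q2_neqN1 r_gt1 n_eq rels Ir)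
    (varpi'_tauE q_neq0 q2_neq1 q2_neqN1 r_gt1 n_eq rels).
Qed.

Lemma tau_r_pred :
  tau r (B r.-1) = Ccst n r t c sq *:
    (qbr (B r.-1) (qbr (B r) (qbr (chain q Fg r.+1 l) (B (ta r)) q) q) q
     + (q * c (ta r)) *: (B r.-1 * Kx (x_gap n r) * Kx (root (r.+1 + l).+1 r.+1))) /\
  tau r (B (ta r.-1)) = Ccst n r t c sq *:
    (qbr (B (ta r.-1)) (qbr (B (ta r)) (qbr (dchain q Fg r.+1 l) (B r) q) q) q
     + (q * c r) *: (B (ta r.-1) * Kx (x_gapN n r) * Kx (root (r.+1 + l).+1 r.+1))).
Proof.
have [_ [_ H]] := tau_r; have Ir : inI n r by inI_lia.
have KX := KXwE q_neq0 q2_neq1 q2_neqN1 r_gt1 n_eq rels.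
have L1 := LwE q_neq0 q2_neq1 q2_neqN1 r_gt1 n_eq rels Ir.
have L2 := Lw_tau q_neq0 q2_neq1 q2_neqN1 r_gt1 n_eq rels Ir.
split; (rewrite H; [|inI_lia|inI_lia]).
  rewrite (_ : r.-1 == r = false); last by lia.
  rewrite (_ : r.-1 == ta r = false); last by rewrite /tauI; lia.
  by rewrite eqxx (FXpE q_neq0 q2_neq1 q2_neqN1 r_gt1 n_eq rels) L1 KX.
rewrite (_ : ta r.-1 == r = false); last by rewrite /tauI; lia.
rewrite (_ : ta r.-1 == ta r = false); last by rewrite /tauI; lia.
rewrite (_ : ta r.-1 == r.-1 = false); last by rewrite /tauI; lia.
by rewrite eqxx (FXmE q_neq0 q2_neq1 q2_neqN1 r_gt1 n_eq rels) L2 KX.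
Qed.

Let rels' := Uq_rels_flip rels.
Local Ltac x_lia := rewrite /inI /x_gap /x_gapN /x_varpi /x_varpiN /root /tauI; lia.
Let SP : subalg P. Proof. exact: BcP. Qed.

Let f := chain q Fg r.+1 l.
Let g := dchain q Fg r.+1 l.
Let Ep := chain q^-1 E r.+1 l.
Let Em := dchain q^-1 E r.+1 l.

Lemma Theta_wt x : (forall k, (0 < k <= r)%N -> x k = x (n.+2 - k)%N) ->
  in_Theta r (wt n x).
Proof. by move=> Hx; apply/(in_Theta_wt r_gt0 r_le). Qed.

Lemma Theta_gap i : (0 < i <= r)%N -> in_Theta r (wt n (x_gap n i)).
Proof.
move=> Hi; apply: Theta_wt => k Hk.
have Ek j : (0 < j <= n.+1)%N -> ((n.+2 - k)%N == j) = (k == (n.+2 - j)%N) by lia.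
have E1 : (n.+2 - i)%N = (ta i).+1 by rewrite /tauI; lia.
have E2 : (n.+2 - i.+1)%N = ta i by rewrite /tauI; lia.
have E3 : (n.+2 - ta i)%N = i.+1 by rewrite /tauI; lia.
have E4 : (n.+2 - (ta i).+1)%N = i by rewrite /tauI; lia.
by rewrite /x_gap /root !Ek ?E1 ?E2 ?E3 ?E4; [ring|inI_lia..].
Qed.

Lemma Theta_gapN i : (0 < i <= r)%N -> in_Theta r (wt n (x_gapN n i)).
Proof.
move=> Hi; have -> : wt n (x_gapN n i) = - wt n (x_gap n i).
  by rewrite wtN; apply: eq_wt => k _; rewrite /x_gap /x_gapN /root; ring.
exact/(in_ThetaN r_gt0 r_le)/Theta_gap.
Qed.

Lemma Theta_varpi : in_Theta r (wt n (x_varpi r l)).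
Proof. by apply: Theta_wt => k Hk; x_lia. Qed.
Lemma Theta_varpiN : in_Theta r (wt n (x_varpiN r l)).
Proof. by apply: Theta_wt => k Hk; x_lia. Qed.
Lemma Theta_X : in_Theta r (wt n (root (r.+1 + l).+1 r.+1)).
Proof. by apply: Theta_wt => k Hk; x_lia. Qed.

Lemma inX_bounds j : (r < j <= r.+1 + l)%N -> inX n r j.
Proof. by rewrite /inX; lia. Qed.

Lemma chains_fixed (h : A -> A) : hom_on P h ->
  (forall j, inX n r j -> h (E j) = E j) -> (forall j, inX n r j -> h (Fg j) = Fg j) ->
  [/\ P f /\ h f = f, P g /\ h g = g, P Ep /\ h Ep = Ep & P Em /\ h Em = Em].
Proof.
move=> Hh hE hF.
have Q s u v : P u /\ h u = u -> P v /\ h v = v -> P (qbr u v s) /\ h (qbr u v s) = qbr u v s.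
  by case=> Pu hu [Pv hv]; split; [apply: sa_qbr|rewrite (ho_qbr _ SP Hh) // hu hv].
have QE j : (r < j <= r.+1 + l)%N -> P (E j) /\ h (E j) = E j.
  by move=> Hj; have Xj := inX_bounds Hj; split; [exact: P_E|exact: hE].
have QF j : (r < j <= r.+1 + l)%N -> P (Fg j) /\ h (Fg j) = Fg j.
  by move=> Hj; have Xj := inX_bounds Hj; split; [exact: P_F|exact: hF].
have QE' w y : {subset w <= iota r.+1 l.+1} -> (r < y <= r.+1 + l)%N ->
    P (qchain q^-1 E w (E y)) /\ h (qchain q^-1 E w (E y)) = qchain q^-1 E w (E y).
  move=> Hw Hy; pose R x := P x /\ h x = x.
  apply: (@qchain_ind F A R q^-1 E w (E y) (Q q^-1)); last exact: QE.
  by move=> j /Hw; rewrite mem_iota => Hj; apply: QE; lia.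
have QF' w y : {subset w <= iota r.+1 l.+1} -> (r < y <= r.+1 + l)%N ->
    P (qchain q Fg w (Fg y)) /\ h (qchain q Fg w (Fg y)) = qchain q Fg w (Fg y).
  move=> Hw Hy; pose R x := P x /\ h x = x.
  apply: (@qchain_ind F A R q Fg w (Fg y) (Q q)); last exact: QF.
  by move=> j /Hw; rewrite mem_iota => Hj; apply: QF; lia.
have S1 : {subset iota r.+1 l <= iota r.+1 l.+1}.
  by move=> j; rewrite !mem_iota; lia.
have S2 : {subset rev (iota r.+2 l) <= iota r.+1 l.+1}.
  by move=> j; rewrite mem_rev !mem_iota; lia.
by split; [apply: QF'|apply: QF'|apply: QE'|apply: QE'] => //; lia.
Qed.

Local Notation alpha := (qcinvsqrt t c sq r.-1).
Local Notation C := (Ccst n r t c sq).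

Lemma alpha2 : alpha ^+ 2 = (q * c r.-1)^-1.
Proof. by rewrite /qcinvsqrt exprVn exprMn sq_c //; inI_lia. Qed.

Lemma C2 : C ^+ 2 = (q * c r * c (ta r))^-1.
Proof. by rewrite /Ccst exprVn !exprMn !sq_c //; inI_lia. Qed.

Lemma rels_half : rel_half q (c r.-1) (c r) (c (ta r)) (B r.-1) (B (ta r.-1)) (B r) (B (ta r))
  f g Ep Em (Kx (x_gap n r)) (Kx (x_gapN n r)) (Kx (root r.+1 (r.+1 + l).+1))
  (Kx (root (r.+1 + l).+1 r.+1)) (Kx (x_varpi r l)) (Kx (x_varpiN r l))
  (Kx (x_gap n r.-1)) (Kx (x_gapN n r.-1)).
Proof.
have Hp : (0 < r.-1 < r)%N by lia.
rewrite (Bg_r q_neq0 q2_neq1 q2_neqN1 r_gt1 n_eq rels).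
rewrite (Bg_tau_r q_neq0 q2_neq1 q2_neqN1 r_gt1 n_eq rels).
rewrite (Bg_i q_neq0 q2_neq1 q2_neqN1 r_gt1 n_eq rels _ Hp).
rewrite (Bg_tau_i q_neq0 q2_neq1 q2_neqN1 r_gt1 n_eq rels _ Hp) (c_tau Hp).
exact: (rel_half_Uq q_neq0 q2_neq1 q2_neqN1 r_gt1 n_eq rels).
Qed.

Lemma rels_flip : rel_half q (c r.-1) (c (ta r)) (c r) (B (ta r.-1)) (B r.-1) (B (ta r)) (B r)
  g f Em Ep (Kx (x_gapN n r)) (Kx (x_gap n r)) (Kx (root r.+1 (r.+1 + l).+1))
  (Kx (root (r.+1 + l).+1 r.+1)) (Kx (x_varpiN r l)) (Kx (x_varpi r l))
  (Kx (x_gapN n r.-1)) (Kx (x_gap n r.-1)).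
Proof.
have Hp : (0 < r.-1 < r)%N by lia.
rewrite (Bg_r q_neq0 q2_neq1 q2_neqN1 r_gt1 n_eq rels).
rewrite (Bg_tau_r q_neq0 q2_neq1 q2_neqN1 r_gt1 n_eq rels).
rewrite (Bg_i q_neq0 q2_neq1 q2_neqN1 r_gt1 n_eq rels _ Hp).
rewrite (Bg_tau_i q_neq0 q2_neq1 q2_neqN1 r_gt1 n_eq rels _ Hp) (c_tau Hp).
exact: (rel_half_Uq_flip q_neq0 q2_neq1 q2_neqN1 r_gt1 n_eq rels).
Qed.

Local Ltac swap_eval := rewrite ?root_swap; repeat match goal with
  | |- context [swap_idx ?i ?j] =>
    first [ have -> : swap_idx i j = j by rewrite /swap_idx /tauI; idx_lia
          | have -> : swap_idx i j = i.+1 by rewrite /swap_idx /tauI; idx_lia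
          | have -> : swap_idx i j = i by rewrite /swap_idx /tauI; idx_lia ]
  end.
Local Ltac tauK := apply: tau_i_Kx;
  [lia | first [apply: Theta_gap; lia | apply: Theta_gapN; lia | apply: Theta_varpi
               | apply: Theta_varpiN | apply: Theta_X]
  | move=> k Hk; rewrite /x_gap /x_gapN /x_varpi /x_varpiN].
Local Ltac tau_root := tauK; swap_eval; rewrite /root /tauI; lia.
Local Ltac tau_leq := tauK; rewrite !leq_swap //; rewrite /tauI; lia.

Lemma Kx_gapD i j : Kx (fun k => x_gap n i k + x_gap n j k) = Kx (x_gap n i) * Kx (x_gap n j).
Proof. by rewrite -(Kw_D q_neq0 q2_neq1 q2_neqN1 rels) wtD. Qed.

Lemma Kx_gapND i j :
  Kx (fun k => x_gapN n i k + x_gapN n j k) = Kx (x_gapN n i) * Kx (x_gapN n j).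
Proof. by rewrite -(Kw_D q_neq0 q2_neq1 q2_neqN1 rels) wtD. Qed.

Lemma act_rank2 : act_half q P (tau r.-1) (tau r) C alpha (c (ta r))
  (B r.-1) (B (ta r.-1)) (B r) (B (ta r)) f Ep (Kx (x_gap n r))
  (Kx (root (r.+1 + l).+1 r.+1)) (Kx (x_varpi r l)) (Kx (x_gap n r.-1)) (Kx (x_gapN n r.-1)).
Proof.
have Hp : (0 < r.-1 < r)%N by lia.
have [[Pf tf] _ [PEp tEp] _] := chains_fixed hom_r tau_r_E tau_r_F.
have [[_ sf] _ [_ sEp] _] := chains_fixed (hom_small Hp) (fun j => tau_i_E Hp) (fun j => tau_i_F Hp).
have [sa _] := tau_i_self Hp.
have [sb _] := @tau_i_adj r.-1 r Hp ltac:(lia) ltac:(lia).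
have [tb _] := tau_r_r; have [ta' _] := tau_r_pred.
have Tg1 := @Theta_gap r ltac:(lia); have Tg2 := @Theta_gap r.-1 ltac:(lia).
have Tv := Theta_varpi; have TX := Theta_X.
have Etr : (ta r).+1 = ta r.-1 by rewrite /tauI; lia.
have Er : r.-1.+1 = r by lia.
split=> //; try exact: P_Kw; try exact: tau_r_Kw.
- by apply: P_B; inI_lia.
- by apply: P_B; inI_lia.
(* s_{r-1} s_{tau(r-1)} adds alpha_{r-1} - alpha_{tau(r-1)} to alpha_r - alpha_{tau(r)}. *)
- by rewrite -Kx_gapD; tauK; swap_eval; rewrite Etr Er /root; ring.
- by tau_root.
- by tau_leq.
- by tau_root.
Qed.

Lemma act_flip : act_half q P (tau r.-1) (tau r) C alpha (c r)
  (B (ta r.-1)) (B r.-1) (B (ta r)) (B r) g Em (Kx (x_gapN n r))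
  (Kx (root (r.+1 + l).+1 r.+1)) (Kx (x_varpiN r l)) (Kx (x_gapN n r.-1)) (Kx (x_gap n r.-1)).
Proof.
have Hp : (0 < r.-1 < r)%N by lia.
have [_ [Pf tf] _ [PEp tEp]] := chains_fixed hom_r tau_r_E tau_r_F.
have [_ [_ sf] _ [_ sEp]] := chains_fixed (hom_small Hp) (fun j => tau_i_E Hp) (fun j => tau_i_F Hp).
have [_ sa] := tau_i_self Hp.
have [_ sb] := @tau_i_adj r.-1 r Hp ltac:(lia) ltac:(lia).
have [_ tb] := tau_r_r; have [_ ta'] := tau_r_pred.
have Tg1 := @Theta_gapN r ltac:(lia); have Tg2 := @Theta_gapN r.-1 ltac:(lia).
have Tv := Theta_varpiN; have TX := Theta_X.
have Etr : (ta r).+1 = ta r.-1 by rewrite /tauI; lia.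
have Er : r.-1.+1 = r by lia.
split=> //; try exact: P_Kw; try exact: tau_r_Kw.
- by apply: P_B; inI_lia.
- by apply: P_B; inI_lia.
- by rewrite -Kx_gapND; tauK; swap_eval; rewrite Etr Er /root; ring.
- by tau_root.
- by tau_leq.
- by tau_root.
Qed.
Let Hp : (0 < r.-1 < r)%N. Proof. lia. Qed.
Let torus_H := torus_rels_Kw q_neq0 q2_neq1 q2_neqN1 r_gt1 n_eq rels.
Let torus_H' := torus_flip torus_H.

Let cp0 : c r.-1 != 0. Proof. by apply: c_neq0; inI_lia. Qed.
Let cr0 : c r != 0. Proof. by apply: c_neq0; inI_lia. Qed.
Let ctr0 : c (ta r) != 0. Proof. by apply: c_neq0; inI_lia. Qed.
Let C2_flip : C ^+ 2 = (q * c (ta r) * c r)^-1. Proof. by rewrite C2 mulrAC. Qed.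

Lemma outI j : inI n j -> ~~ inX n r j ->
  (0 < j <= r)%N \/ exists2 i, (0 < i <= r)%N & j = ta i.
Proof.
move=> Ij Xj; have [jr|rj] := leqP j r; first by left; move: Ij; rewrite /inI; lia.
by right; exists (ta j); [move: Ij Xj; inI_lia|rewrite tauIK].
Qed.

Lemma B_far i : (0 < i < r.-1)%N ->
  [/\ B i * B r = B r * B i, B i * B (ta r) = B (ta r) * B i, B i * f = f * B i,
      B i * g = g * B i & B i * B (ta r.-1) = B (ta r.-1) * B i].
Proof.
move=> Hi; have Hi' : (0 < i < r)%N by lia.
rewrite (Bg_r q_neq0 q2_neq1 q2_neqN1 r_gt1 n_eq rels).
rewrite (Bg_tau_r q_neq0 q2_neq1 q2_neqN1 r_gt1 n_eq rels).
rewrite (Bg_i q_neq0 q2_neq1 q2_neqN1 r_gt1 n_eq rels _ Hi').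
rewrite (Bg_tau_i q_neq0 q2_neq1 q2_neqN1 r_gt1 n_eq rels _ Hp).
have BF j : (r < j <= r.+1 + l)%N -> Bi E Fg Kw i (c i) * Fg j = Fg j * Bi E Fg Kw i (c i).
  exact: (Bi_F q_neq0 q2_neq1 q2_neqN1 rels r_gt0 n_eq).
split.
- by apply: (Bi_Br_comm q_neq0 q2_neq1 q2_neqN1 rels r_gt0 n_eq); lia.
- by apply: (Bi_Br'_comm q_neq0 q2_neq1 q2_neqN1 rels r_gt0 n_eq).
- by apply: chain_comm => j Hj; apply: BF; lia.
- by apply: dchain_comm => j Hj; apply: BF; lia.
- by apply: (Bi_Bi'_comm q_neq0 q2_neq1 q2_neqN1 rels r_gt0 n_eq) => //; lia.
Qed.

Lemma B_tau_far i : (0 < i < r.-1)%N ->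
  [/\ B (ta i) * B r = B r * B (ta i), B (ta i) * B (ta r) = B (ta r) * B (ta i),
      B (ta i) * f = f * B (ta i), B (ta i) * g = g * B (ta i)
    & B (ta i) * B r.-1 = B r.-1 * B (ta i)].
Proof.
move=> Hi; have Hi' : (0 < i < r)%N by lia.
rewrite (Bg_r q_neq0 q2_neq1 q2_neqN1 r_gt1 n_eq rels).
rewrite (Bg_tau_r q_neq0 q2_neq1 q2_neqN1 r_gt1 n_eq rels).
rewrite (Bg_tau_i q_neq0 q2_neq1 q2_neqN1 r_gt1 n_eq rels _ Hi').
rewrite (Bg_i q_neq0 q2_neq1 q2_neqN1 r_gt1 n_eq rels _ Hp).
have BF j : (r < j <= r.+1 + l)%N ->
    Bi' E Fg Kw i (c (ta i)) * Fg j = Fg j * Bi' E Fg Kw i (c (ta i)).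
  move=> Hj; rewrite -(@tauIK n j); last by inI_lia.
  by apply: (Bi_F q_neq0 q2_neq1 q2_neqN1 rels' r_gt0 n_eq) => //; rewrite /tauI; lia.
split.
- have := Bi_Br'_comm q_neq0 q2_neq1 q2_neqN1 rels' r_gt0 n_eq (c (ta i)) (c r) Hi'.
  by rewrite (Br'_tau q_neq0 q2_neq1 q2_neqN1 r_gt1 n_eq rels).
- by apply: (Bi_Br_comm q_neq0 q2_neq1 q2_neqN1 rels' r_gt0 n_eq); lia.
- by apply: chain_comm => j Hj; apply: BF; lia.
- by apply: dchain_comm => j Hj; apply: BF; lia.
- by symmetry; apply: (Bi_Bi'_comm q_neq0 q2_neq1 q2_neqN1 rels r_gt0 n_eq) => //; lia.
Qed.

Lemma Kx_B i x z : (0 < i < r)%N -> x i.+1 - x i = z -> x i = x (ta i).+1 ->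
  x i.+1 = x (ta i) -> Kx x * B i = q ^ z *: (B i * Kx x).
Proof.
move=> Hi Hz H1 H2; rewrite (Bg_i q_neq0 q2_neq1 q2_neqN1 r_gt1 n_eq rels _ Hi).
exact: (KBi q_neq0 q2_neq1 q2_neqN1 rels r_gt0 n_eq).
Qed.

Lemma Kx_B_tau i x z : (0 < i < r)%N -> x (ta i).+1 - x (ta i) = z ->
  x i = x (ta i).+1 -> x i.+1 = x (ta i) -> Kx x * B (ta i) = q ^ z *: (B (ta i) * Kx x).
Proof.
move=> Hi Hz H1 H2; rewrite (Bg_tau_i q_neq0 q2_neq1 q2_neqN1 r_gt1 n_eq rels _ Hi).
exact: (KBi' q_neq0 q2_neq1 q2_neqN1 rels r_gt0 n_eq).
Qed.

Lemma Kx_B_comm i x : (0 < i < r)%N -> x i.+1 = x i -> x i = x (ta i).+1 ->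
  x i.+1 = x (ta i) -> Kx x * B i = B i * Kx x /\ Kx x * B (ta i) = B (ta i) * Kx x.
Proof.
move=> Hi H1 H2 H3; split.
  by rewrite (@Kx_B i x 0) ?expr0z ?scale1r // H1 subrr.
by rewrite (@Kx_B_tau i x 0) ?expr0z ?scale1r // -H2 -H3 H1 subrr.
Qed.

Lemma x_gap0 i k : k != i -> k != i.+1 -> k != ta i -> k != (ta i).+1 ->
  x_gap n i k = 0 /\ x_gapN n i k = 0.
Proof.
rewrite /x_gap /x_gapN /root.
by move=> /negbTE-> /negbTE-> /negbTE-> /negbTE->; rewrite !subrr.
Qed.

Lemma x_gap1 i : (0 < i <= r)%N ->
  [/\ x_gap n i i = 1, x_gap n i (ta i).+1 = 1, x_gapN n i i = -1 & x_gapN n i (ta i).+1 = -1].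
Proof.
move=> Hi; have E1 : i == i.+1 = false by lia.
have E2 : i == (ta i).+1 = false by rewrite /tauI; lia.
have E3 : i == ta i = false by rewrite /tauI; lia.
have E4 : (ta i).+1 == i = false by lia.
have E5 : (ta i).+1 == i.+1 = false by lia.
have E6 : (ta i).+1 == ta i = false by lia.
by rewrite /x_gap /x_gapN /root !eqxx E1 E2 E3 E4 E5 E6.
Qed.

Lemma torus_far i : (0 < i < r.-1)%N ->
  [/\ Kx (x_gap n r) * B i = B i * Kx (x_gap n r)
        /\ Kx (x_gap n r) * B (ta i) = B (ta i) * Kx (x_gap n r),
      Kx (x_gapN n r) * B i = B i * Kx (x_gapN n r)
        /\ Kx (x_gapN n r) * B (ta i) = B (ta i) * Kx (x_gapN n r)
    & Kx (root (r.+1 + l).+1 r.+1) * B i = B i * Kx (root (r.+1 + l).+1 r.+1)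
        /\ Kx (root (r.+1 + l).+1 r.+1) * B (ta i)
            = B (ta i) * Kx (root (r.+1 + l).+1 r.+1)].
Proof.
move=> Hi; have Hi' : (0 < i < r)%N by lia.
have Z k : (k < r)%N || (r + l.+3 < k)%N -> x_gap n r k = 0 /\ x_gapN n r k = 0.
  by move=> Hk; apply: x_gap0; rewrite /tauI; lia.
have Z' k : (k < r)%N || (r + l.+3 < k)%N -> root (r.+1 + l).+1 r.+1 k = 0.
  by move=> Hk; rewrite /root; lia.
have H1 : (i < r)%N || (r + l.+3 < i)%N by lia.
have H2 : (i.+1 < r)%N || (r + l.+3 < i.+1)%N by lia.
have H3 : (ta i < r)%N || (r + l.+3 < ta i)%N by rewrite /tauI; lia.
have H4 : ((ta i).+1 < r)%N || (r + l.+3 < (ta i).+1)%N by rewrite /tauI; lia.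
have [[a1 b1] [a2 b2]] := (Z _ H1, Z _ H2); have [[a3 b3] [a4 b4]] := (Z _ H3, Z _ H4).
split; apply: Kx_B_comm => //; by rewrite ?a1 ?a2 ?a3 ?a4 ?b1 ?b2 ?b3 ?b4 ?Z'.
Qed.

Lemma torus_adj i : (0 < i)%N -> i.+1 = r.-1 ->
  [/\ Kx (x_gap n r.-1) * B i = q *: (B i * Kx (x_gap n r.-1)),
      Kx (x_gapN n r.-1) * B i = q^-1 *: (B i * Kx (x_gapN n r.-1)),
      Kx (x_gapN n r.-1) * B (ta i) = q *: (B (ta i) * Kx (x_gapN n r.-1))
    & Kx (x_gap n r.-1) * B (ta i) = q^-1 *: (B (ta i) * Kx (x_gap n r.-1))].
Proof.
move=> i0 Er; have Hi : (0 < i < r)%N by lia.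
have Et : ta i = (ta r.-1).+1 by rewrite /tauI; lia.
have [g1 g2 g3 g4] := @x_gap1 r.-1 ltac:(lia).
rewrite -Er in Et g1 g2 g3 g4 *; rewrite -Et in g2 g4.
have [z1 z1'] : x_gap n i.+1 i = 0 /\ x_gapN n i.+1 i = 0.
  by apply: x_gap0; rewrite ?/tauI; lia.
have [z2 z2'] : x_gap n i.+1 (ta i).+1 = 0 /\ x_gapN n i.+1 (ta i).+1 = 0.
  by apply: x_gap0; rewrite ?/tauI; lia.
by split; [apply: (@Kx_B i _ 1)|apply: (@Kx_B i _ (-1))|apply: (@Kx_B_tau i _ 1)
  |apply: (@Kx_B_tau i _ (-1))]; rewrite ?g1 ?g2 ?g3 ?g4 ?z1 ?z1' ?z2 ?z2'.
Qed.

Local Notation s := (tau r.-1).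
Local Notation v := (tau r).

Lemma adj_pred j : j.+1 = r.-1 -> (r.-1 == j.+1) || (j == r.-1.+1).
Proof. by move=> ->; rewrite eqxx. Qed.

Lemma far_pred j : (0 < j < r.-1)%N -> j.+1 != r.-1 -> (r.-1.+1 < j)%N || (j.+1 < r.-1)%N.
Proof. lia. Qed.

Lemma lt_pred j : (0 < j <= r)%N -> j != r -> j != r.-1 -> (0 < j < r.-1)%N.
Proof. lia. Qed.

(** The cases j = tau(i) are those of i <= r with the two halves of the relations and of the actions
    exchanged. *)
Lemma braid_B j : inI n j -> ~~ inX n r j -> v (s (v (s (B j)))) = s (v (s (v (B j)))).
Proof.
move=> Ij Xj; have Hs : hom_on P s by apply: hom_small.
have Hv : hom_on P v by apply: hom_r.
have [jr_le|[i ir Ei]] := outI Ij Xj; [have [Er|jr0] := eqVneq j r|have [Er|ir0] := eqVneq i r].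
- rewrite Er; exact: (braid_b q_neq0 q2_neq1 q2_neqN1 cp0 cr0 ctr0 alpha2 C2 rels_half rels_flip
    torus_H SP Hs Hv act_rank2 act_flip).
- have [Er|jr1] := eqVneq j r.-1.
    rewrite Er; exact: (braid_inner q_neq0 q2_neq1 q2_neqN1 cp0 cr0 ctr0 alpha2 C2 rels_half
      rels_flip torus_H SP Hs Hv act_rank2 act_flip).
  have Hj := lt_pred jr_le jr0 jr1.
  have [vB _] := tau_r_far Hj; have [b1 b2 b3 b4 b5] := B_far Hj.
  have [Er2|jr2] := eqVneq j.+1 r.-1; last first.
    have [sB _] := @tau_i_far r.-1 j Hp jr_le (far_pred Hj jr2).
    by rewrite !(sB, vB).
  have [sB _] := @tau_i_adj r.-1 j Hp jr_le (adj_pred Er2).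
  have [[k1 _] _ [k2 _]] := torus_far Hj; have [k3 k4 _ _] := torus_adj (proj1 (andP Hj)) Er2.
  apply: (braid_outer q_neq0 q2_neq1 q2_neqN1 cp0 cr0 ctr0 alpha2 C2 rels_half
      rels_flip torus_H SP Hs Hv act_rank2 act_flip) => //; exact: P_B.
- rewrite Ei Er; exact: (braid_b q_neq0 q2_neq1 q2_neqN1 cp0 ctr0 cr0 alpha2 C2_flip rels_flip rels_half
    torus_H' SP Hs Hv act_flip act_rank2).
have [Er|jr1] := eqVneq i r.-1.
  rewrite Ei Er; exact: (braid_inner q_neq0 q2_neq1 q2_neqN1 cp0 ctr0 cr0 alpha2 C2_flip rels_flip
    rels_half torus_H' SP Hs Hv act_flip act_rank2).
have Hj := lt_pred ir ir0 jr1.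
have [_ vB] := tau_r_far Hj; have [b1 b2 b3 b4 b5] := B_tau_far Hj.
rewrite Ei; have [Er2|jr2] := eqVneq i.+1 r.-1; last first.
  have [_ sB] := @tau_i_far r.-1 i Hp ir (far_pred Hj jr2).
  by rewrite !(sB, vB).
have [_ sB] := @tau_i_adj r.-1 i Hp ir (adj_pred Er2).
have [_ [_ k1] [_ k2]] := torus_far Hj; have [_ _ k3 k4] := torus_adj (proj1 (andP Hj)) Er2.
apply: (braid_outer q_neq0 q2_neq1 q2_neqN1 cp0 ctr0 cr0 alpha2 C2_flip rels_flip
    rels_half torus_H' SP Hs Hv act_flip act_rank2) => //; by rewrite -Ei; apply: P_B.
Qed.

Lemma torus_fixed i : (0 < i < r.-1)%N ->
  [/\ tau i (Kx (x_gap n r)) = Kx (x_gap n r), tau i (Kx (x_gapN n r)) = Kx (x_gapN n r),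
      tau i (Kx (root (r.+1 + l).+1 r.+1)) = Kx (root (r.+1 + l).+1 r.+1),
      tau i (Kx (x_varpi r l)) = Kx (x_varpi r l)
    & tau i (Kx (x_varpiN r l)) = Kx (x_varpiN r l)].
Proof.
move=> Hi; have Hir : (0 < i < r)%N by lia.
have rr : (0 < r <= r)%N by lia.
have S k : (r <= k)%N -> (k <= r + l.+3)%N -> swap_idx i (swap_idx (ta i) k) = k.
  by move=> *; rewrite /swap_idx /tauI; idx_lia.
have Et : ta r = (r + l.+2)%N by rewrite /tauI; lia.
have S1 : swap_idx i (swap_idx (ta i) r) = r by apply: S; lia.
have S2 : swap_idx i (swap_idx (ta i) r.+1) = r.+1 by apply: S; lia.
have S3 : swap_idx i (swap_idx (ta i) (ta r)) = ta r by apply: S; rewrite Et; lia.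
have S4 : swap_idx i (swap_idx (ta i) (ta r).+1) = (ta r).+1 by apply: S; rewrite Et; lia.
have S5 : swap_idx i (swap_idx (ta i) (r.+1 + l).+1) = (r.+1 + l).+1 by apply: S; lia.
have N1 : r.+1 != i by lia.
have N2 : (r.+1 + l)%N != i by lia.
have N3 : r.+1 != ta i by rewrite /tauI; lia.
have N4 : (r.+1 + l)%N != ta i by rewrite /tauI; lia.
split.
- by apply: (tau_i_Kx Hir (Theta_gap rr)) => k _; rewrite /x_gap !root_swap S1 S2 S3 S4.
- by apply: (tau_i_Kx Hir (Theta_gapN rr)) => k _; rewrite /x_gapN !root_swap S1 S2 S3 S4.
- by apply: (tau_i_Kx Hir Theta_X) => k _; rewrite !root_swap S2 S5.
- by apply: (tau_i_Kx Hir Theta_varpi) => k _; rewrite /x_varpi !leq_swap.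
- by apply: (tau_i_Kx Hir Theta_varpiN) => k _; rewrite /x_varpiN !leq_swap.
Qed.

Lemma P_B_le k : (0 < k <= r)%N -> P (B k) /\ P (B (ta k)).
Proof. by move=> Hk; split; apply: P_B; inI_lia. Qed.

(** For k < r-1 the values of tau_i involve only elements fixed by tau_r, and for k = r the roles
    are exchanged. Only k = r-1 combines both maps, and there i = r-2 has to be separated from i <
    r-2. *)
Lemma far_B_le i k : (0 < i < r.-1)%N -> (0 < k <= r)%N ->
  v (tau i (B k)) = tau i (v (B k)) /\ v (tau i (B (ta k))) = tau i (v (B (ta k))).
Proof.
move: k => k0 Hi Hk0; have Hir : (0 < i < r)%N by lia.
have Hu : hom_on P (tau i) by apply: hom_small.
have Hv : hom_on P v by apply: hom_r.
have ir : (0 < i <= r)%N by lia.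
have rr0 : (0 < r <= r)%N by lia.
have pr0 : (0 < r.-1 <= r)%N by lia.
have PB := P_B_le; have [PBi PBti] := PB i ir.
have [vBi vBti] := tau_r_far Hi; have [uBi uBti] := tau_i_self Hir.
have [uBr uBtr] := @tau_i_far i r Hir rr0 ltac:(lia).
have [[Pf uf] [Pg ug] _ _] := chains_fixed Hu (fun j => tau_i_E Hir) (fun j => tau_i_F Hir).
have [ugap ugapN uX uv1 uv2] := torus_fixed Hi.
have PKg : P (Kx (x_gap n r)) by exact/P_Kw/Theta_gap.
have PKgN : P (Kx (x_gapN n r)) by exact/P_Kw/Theta_gapN.
have PX : P (Kx (root (r.+1 + l).+1 r.+1)) by apply/P_Kw/Theta_X.
have Pv1 : P (Kx (x_varpi r l)) by apply/P_Kw/Theta_varpi.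
have Pv2 : P (Kx (x_varpiN r l)) by apply/P_Kw/Theta_varpiN.
have [Pbr Pbtr] := PB r rr0.
have [br btr] := tau_r_r; have [bp btp] := tau_r_pred.
have [c1 c2 c3 c4 c5] := B_far Hi; have [d1 d2 d3 d4 d5] := B_tau_far Hi.
have PY : P (qbr (B r) (qbr f (B (ta r)) q) q) by do ?[apply: (sa_qbr _ SP) => //].
have PY' : P (qbr (B (ta r)) (qbr g (B r) q) q) by do ?[apply: (sa_qbr _ SP) => //].
have uY : tau i (qbr (B r) (qbr f (B (ta r)) q) q) = qbr (B r) (qbr f (B (ta r)) q) q.
  by rewrite !(ho_qbr _ SP Hu) ?uBr ?uBtr ?uf //; apply: (sa_qbr _ SP).
have uY' : tau i (qbr (B (ta r)) (qbr g (B r) q) q) = qbr (B (ta r)) (qbr g (B r) q) q.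
  by rewrite !(ho_qbr _ SP Hu) ?uBr ?uBtr ?ug //; apply: (sa_qbr _ SP).
have small k : (0 < k < r.-1)%N -> v (tau i (B k)) = tau i (v (B k)) /\
    v (tau i (B (ta k))) = tau i (v (B (ta k))).
  move=> Hk; have [vB vBt] := tau_r_far Hk; have kr : (0 < k <= r)%N by lia.
  have [PBk PBtk] := PB k kr.
  rewrite vB vBt; have [->|ki] := eqVneq k i.
    rewrite uBi uBti; have P1 : P (Kx (x_gapN n i)) by exact/P_Kw/Theta_gapN.
    have P2 : P (Kx (x_gap n i)) by exact/P_Kw/Theta_gap.
    have P3 := sa_M SP PBti P1; have P4 := sa_M SP PBi P2.
    rewrite !(ho_Z Hv) // !(ho_M Hv) // vBi vBti.
    by rewrite !tau_r_Kw //; [apply: Theta_gap|apply: Theta_gapN].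
  have [ik|ik] := boolP ((i == k.+1) || (k == i.+1)); last first.
    by have [-> ->] := @tau_i_far i k Hir kr ltac:(lia); rewrite vB vBt.
  have [-> ->] := @tau_i_adj i k Hir kr ik.
  have P1 := sa_qbr q SP PBk PBi; have P2 := sa_qbr q SP PBtk PBti.
  by rewrite !(ho_Z Hv) // !(ho_qbr _ SP Hv) // vB vBt vBi vBti.
have rr k : k = r -> v (tau i (B k)) = tau i (v (B k)) /\
    v (tau i (B (ta k))) = tau i (v (B (ta k))).
  move=> ->; rewrite uBr uBtr br btr.
  have P1 := sa_M SP Pbr PKg; have P2 := sa_M SP Pbtr PKgN.
  have P3 := sa_M SP P1 Pv1; have P4 := sa_M SP P2 Pv2.
  by rewrite !(ho_Z Hu) // !(ho_M Hu) // uBr uBtr ugap ugapN uv1 uv2.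
have pred k : k = r.-1 -> v (tau i (B k)) = tau i (v (B k)) /\
    v (tau i (B (ta k))) = tau i (v (B (ta k))).
  move=> ->; have [Pp Ptp] := PB r.-1 pr0.
  have [ik|ik] := eqVneq r.-1 i.+1; last first.
    have [up utp] := @tau_i_far i r.-1 Hir pr0 ltac:(lia).
    split.
      by rewrite up (hom_fix_pred SP Hu Pp PY PKg PX bp up uY ugap uX).
    by rewrite utp (hom_fix_pred SP Hu Ptp PY' PKgN PX btp utp uY' ugapN uX).
  have [up utp] := @tau_i_adj i r.-1 Hir pr0 ltac:(lia).
  have [[k1 k1'] [k2 k2'] [k3 k3']] := torus_far Hi.
  split.
    apply: (comm_pred SP Hu Hv Pp PBi PY PKg PX bp vBi up uY ugap uX) => //.
    by nc (tt, c1, c2, c3).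
  apply: (comm_pred SP Hu Hv Ptp PBti PY' PKgN PX btp vBti utp uY' ugapN uX) => //.
  by nc (tt, d1, d2, d4).
have [Er|kr] := eqVneq k0 r; first exact: rr.
have [Er|kr1] := eqVneq k0 r.-1; first exact: pred.
exact/small/lt_pred.
Qed.

Lemma far_B i j : (0 < i < r.-1)%N -> inI n j -> ~~ inX n r j ->
  v (tau i (B j)) = tau i (v (B j)).
Proof.
move=> Hi Ij Xj.
have [jr|[k kr ->]] := outI Ij Xj; first by case: (far_B_le Hi jr).
by case: (far_B_le Hi kr).
Qed.

Lemma srefl2K i (mu : weight n) : (0 < i < r)%N ->
  srefl i (srefl (ta i) (srefl i (srefl (ta i) mu))) = mu.
Proof.
move=> Hi; have [x ->] := wt_onto mu; rewrite !srefl_wt; try inI_lia.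
apply: eq_wt => k _ /=.
have it : (i.+1 < ta i)%N by rewrite /tauI; lia.
by rewrite !(swap_idxC _ it) !swap_idxK.
Qed.

Lemma braid_gens x : Bc_gens r t E Fg Kw c x -> v (s (v (s x))) = s (v (s (v x))).
Proof.
case=> [|[i [Ii [Xi ->]]]]; last exact: braid_B.
(* On the torus tau_r is the identity and tau_{r-1} an involution, so both sides act trivially. *)
have HK mu : in_Theta r mu -> v (s (v (s (Kw mu)))) = s (v (s (v (Kw mu)))).
  move=> Hm; have Hm' := in_Theta_srefl2 r_gt0 r_le Hp Hm.
  by rewrite (tau_r_Kw Hm) (tau_i_Kw Hp Hm) (tau_r_Kw Hm') (tau_i_Kw Hp Hm') srefl2K // (tau_r_Kw Hm).
have Ts j : inX n r j -> in_Theta r (sroot n j).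
  move=> Hj; rewrite sroot_wt; last by move: Hj; inI_lia.
  by apply/(in_Theta_wt r_gt0 r_le) => k Hk; move: Hj; inI_lia.
case=> [[j [Xj]]|[mu [Hm ->]]]; last exact: HK.
case=> [->|[->|[->|->]]].
- by rewrite !(tau_i_E Hp Xj, tau_r_E Xj).
- by rewrite !(tau_i_F Hp Xj, tau_r_F Xj).
- exact/HK/Ts.
- exact/HK/(in_ThetaN r_gt0 r_le)/Ts.
Qed.

Lemma far_gens i x : (0 < i < r.-1)%N -> Bc_gens r t E Fg Kw c x ->
  v (tau i x) = tau i (v x).
Proof.
move=> Hi; have Hir : (0 < i < r)%N by lia.
case=> [|[j [Ij [Xj ->]]]]; last exact: far_B.
have HK mu : in_Theta r mu -> v (tau i (Kw mu)) = tau i (v (Kw mu)).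
  move=> Hm; have Hm' := in_Theta_srefl2 r_gt0 r_le Hir Hm.
  by rewrite (tau_r_Kw Hm) (tau_i_Kw Hir Hm) (tau_r_Kw Hm').
have Ts j : inX n r j -> in_Theta r (sroot n j).
  move=> Hj; rewrite sroot_wt; last by move: Hj; inI_lia.
  by apply/(in_Theta_wt r_gt0 r_le) => k Hk; move: Hj; inI_lia.
case=> [[j [Xj]]|[mu [Hm ->]]]; last exact: HK.
case=> [->|[->|[->|->]]].
- by rewrite (tau_i_E Hir Xj) (tau_r_E Xj) (tau_i_E Hir Xj).
- by rewrite (tau_i_F Hir Xj) (tau_r_F Xj) (tau_i_F Hir Xj).
- exact/HK/Ts.
- exact/HK/(in_ThetaN r_gt0 r_le)/Ts.
Qed.

Let one_r : v 1 = 1.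
Proof. by have [[_ [_ [_ [_ []]]]]] := tau_r. Qed.
Let one_i i : (0 < i < r)%N -> tau i 1 = 1.
Proof. by move=> Hi; have [[_ [_ [_ [_ []]]]]] := @tau_small i ltac:(lia). Qed.

Lemma braid_Bc x : P x -> v (s (v (s x))) = s (v (s (v x))).
Proof.
have Hs : hom_on P s by apply: hom_small.
have Hv : hom_on P v by apply: hom_r.
have vs := hom_on_comp Hv Hs; have sv := hom_on_comp Hs Hv.
have s1 : s 1 = 1 by apply: one_i.
apply: (hom_on_eq (hom_on_comp vs vs) (hom_on_comp sv sv)) => /=; try by rewrite !(s1, one_r).
exact: braid_gens.
Qed.

Lemma far_Bc i x : (0 < i < r.-1)%N -> P x -> v (tau i x) = tau i (v x).
Proof.
move=> Hi; have Hu : hom_on P (tau i) by apply: hom_small; lia.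
have Hv : hom_on P v by apply: hom_r.
have u1 : tau i 1 = 1 by apply: one_i; lia.
apply: (hom_on_eq (hom_on_comp Hv Hu) (hom_on_comp Hu Hv)) => /=; try by rewrite !(u1, one_r).
by move=> y; apply: far_gens.
Qed.
End BraidAction.
Unset Default Proof Using.

Theorem theorem3p6 (K0 F : fieldType) (iota : {rmorphism K0 -> F}) (t : F)
  (n r : nat) (c : nat -> F) (sq : F -> F)
  (A : algType F) (E Fg : nat -> A) (Kw : weight n -> A)
  (T : nat -> A -> A) (tau : nat -> A -> A) :
  [pchar K0] =i pred0 ->
  (forall p : {poly K0}, p != 0 -> (map_poly iota p).[t] != 0) ->
  (2 <= r)%N -> (r <= (n.+1)./2 - 1)%N ->
  (forall i, inI n i -> ~~ inX n r i ->
     c i != 0 /\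
     exists a b : {poly K0}, (map_poly iota b).[t] != 0 /\
        c i = (map_poly iota a).[t] / (map_poly iota b).[t]) ->
  (forall i, inI n i -> ~~ inX n r i -> i != r -> i != tauI n r ->
     c i = c (tauI n i)) ->
  (forall i, inI n i -> ~~ inX n r i -> sq (c i) ^+ 2 = c i) ->
  Uq_rels t E Fg Kw ->
  Lusztig t E Fg Kw T ->
  (forall i, (1 <= i <= r.-1)%N -> tau_small_spec r t E Fg Kw c sq T i (tau i)) ->
  tau_r_spec r t E Fg Kw c sq T (tau r) ->
  (forall x, Bc r t E Fg Kw c x ->
     tau r (tau r.-1 (tau r (tau r.-1 x))) = tau r.-1 (tau r (tau r.-1 (tau r x)))) /\
  (forall i, (1 <= i < r.-1)%N -> forall x, Bc r t E Fg Kw c x ->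
     tau r (tau i x) = tau i (tau r x)).
Proof.
move=> _ Ht r2 rn c0 ct sqc rels Lus small big.
(* X has n - 2r elements, at least one by the bound on r; l+1 is their number. *)
pose l := (n - r - r).-1; have n_eq : n = (r + r + l.+1)%N by rewrite /l; lia.
(* As q = t^2, the three nonvanishing conditions are the hypothesis on [t] for X^2, X^4 - 1 and X^4
   + 1. *)
have q0 : qq t != 0.
  have := Ht 'X^2 (monic_neq0 (monicXn _ 2)).
  by rewrite map_polyXn hornerXn.
have q1 : qq t ^+ 2 - 1 != 0.
  have := Ht ('X^4 - 1) (monic_neq0 (monicXnsubC _ (isT : (0 < 4)%N))).
  by rewrite rmorphB /= map_polyXn rmorph1 !hornerE ?hornerXn /qq -exprM.
have qN1 : qq t ^+ 2 + 1 != 0.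
  have := Ht ('X^4 + 1) (monic_neq0 (monicXnaddC _ (isT : (0 < 4)%N))).
  by rewrite rmorphD /= map_polyXn rmorph1 !hornerE ?hornerXn /qq -exprM.
have c0' i : inI n i -> ~~ inX n r i -> c i != 0 by move=> Ii Xi; case: (c0 i Ii Xi).
have ct' i : (0 < i < r)%N -> c (tauI n i) = c i.
  by move=> Hi; rewrite -ct //; rewrite /inI /inX /tauI; lia.
split=> [x Px|i Hi x Px].
  exact: (braid_Bc q0 q1 qN1 r2 n_eq c0' ct' sqc rels Lus small big).
exact: (far_Bc q0 q1 qN1 r2 n_eq c0' ct' sqc rels Lus small big).
Qed.
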